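(* Let $2<p<\infty$ and let $X$ be a closed subspace of $c_p$. Then the following conditions on $X$ are equivalent: (i) $X$ contains no subspace isomorphic to $\ell_2$. (ii) $X$ is isomorphic to a subspace of $\ell_p(c_p^n)$. (iii) For any $\varepsilon>0$ there exists a closed subspace $X_0$ of $\ell_p(c_p^n)$ such that $d(X,X_0)<1+\varepsilon$.
   Context: $c_p$ is the Schatten class of compact operators on a separable (infinite-dimensional) Hilbert space with $p$-summable singular values, normed by the $\ell_p$-norm of the singular values. $c_p^n$ is the space of $n\times n$-matrices with the $c_p$-norm, and $\ell_p(c_p^n)$ is the $\ell_p$-direct sum of the sequence $(c_p^n)_{n\ge1}$. $d(X,Y)=\inf\|T\|\,\|T^{-1}\|$, over all surjective isomorphisms $T:X\to Y$, is the Banach–Mazur distance. *)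

(* Defs.v *)
From HB Require Import structures.
From mathcomp Require Import all_boot all_order all_algebra.
From mathcomp Require Import complex.
From mathcomp Require Import all_classical all_reals all_analysis.

Set Implicit Arguments.
Unset Strict Implicit.
Unset Printing Implicit Defensive.

Import Order.TTheory GRing.Theory Num.Theory.
Import numFieldNormedType.Exports.

Local Open Scope classical_set_scope.
Local Open Scope ring_scope.
Local Open Scope sesquilinear_scope.
Local Open Scope complex_scope.

(* Throughout, a normed space is given as a set X of vectors of an ambient
   R[i]-vector space V together with a function N : V -> \bar R whose values on
   the normed space in question are finite and give its norm. *)
Section NormedSubspaces.
Context {R : realType} {V W : lmodType R[i]}.
Variables (NV : V -> \bar R) (X : set V) (NW : W -> \bar R) (Y : set W).

Definition linear_subspace : Prop :=
  X 0 /\ forall (a : R[i]) x y, X x -> X y -> X (a *: x + y).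

Definition closed_subspace (E : set V) : Prop :=
  [/\ X `<=` E, linear_subspace &
    forall (u : nat -> V) x, (forall n, X (u n)) -> E x ->
      NV (u n - x) @[n --> \oo] --> 0%E -> X x].

Definition opnorm (T : V -> W) : \bar R :=
  ereal_sup [set NW (T x) | x in X `&` [set x | (NV x <= 1)%E]].

Definition linear_on (T : V -> W) : Prop :=
  forall (a : R[i]) x y, X x -> X y -> T (a *: x + y) = a *: T x + T y.

End NormedSubspaces.

Section Isomorphisms.
Context {R : realType} {V W : lmodType R[i]}.
Variables (NV : V -> \bar R) (X : set V) (NW : W -> \bar R) (Y : set W).

(* T : X -> Y is a surjective isomorphism with inverse S : Y -> X; the values
   of T outside X and of S outside Y are irrelevant. *)
Definition surjective_isomorphism (T : V -> W) (S : W -> V) : Prop :=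
  [/\ linear_on X T, set_fun X Y T, set_fun Y X S,
      {in X, cancel T S} /\ {in Y, cancel S T} &
      (opnorm NV X NW T < +oo)%E /\ (opnorm NW Y NV S < +oo)%E].

Definition isomorphic : Prop := exists T S, surjective_isomorphism T S.

(* The infimum over the empty set is +oo: d(X, Y) = +oo when X and Y are not
   isomorphic. *)
Definition bm_dist : \bar R :=
  ereal_inf [set (opnorm NV X NW TS.1 * opnorm NW Y NV TS.2)%E
            | TS in [set TS | surjective_isomorphism TS.1 TS.2]].

End Isomorphisms.

Section Lp.
Context {R : realType}.

Definition lp_norm (p : R) (a : nat -> R) : \bar R :=
  Lnorm (counting : {measure set nat -> \bar R}) p%:E (EFin \o a).

Definition l2_norm (x : nat -> R[i]^o) : \bar R :=
  lp_norm 2 (fun n => complex.Re `|x n|).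

Definition l2 : set (nat -> R[i]^o) := [set x | (l2_norm x < +oo)%E].

End Lp.

Section Schatten.
Context {R : realType} {H : completeNormedModType R[i]}.
Variable dot : {dot H for Num.conj}.

Definition infinite_dimensional : Prop :=
  ~ exists s : seq H, forall x, exists a : nat -> R[i],
      x = \sum_(i < size s) a i *: s`_i.

Definition separable_infdim_hilbert : Prop :=
  [/\ forall x : H, `|x| ^+ 2 = dot x x,
      (exists2 D : set H, countable D & dense D) &
      infinite_dimensional].

Definition compact_operator (T : H -> H) : Prop :=
  linear T /\ precompact (T @` [set x | `|x| <= 1]).

(* s lists, in nonincreasing order and with multiplicity, the square roots of
   the eigenvalues of T^*T, completed by zeros when T has finite rank. The
   eigenvector equation T^*T e_n = s_n^2 e_n is written without the adjoint,
   as <T e_n, T x> = s_n^2 <e_n, x> for all x. *)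
Definition is_singular_values (T : H -> H) (s : nat -> R) : Prop :=
  [/\ forall n, 0 <= s n, nonincreasing_seq s &
    exists e : nat -> H,
      [/\ forall m n, dot (e m) (e n) = (m == n)%:R,
          forall n x, dot (T (e n)) (T x) = (s n ^+ 2)%:C * dot (e n) x &
          forall x, (forall n, dot x (e n) = 0) -> T x = 0]].

(* The singular values of a compact operator on an infinite-dimensional
   Hilbert space exist and are unique; otherwise this is a default value. *)
Definition singular_values (T : H -> H) : nat -> R :=
  xget (cst 0) [set s | is_singular_values T s].

Definition cp_norm (p : R) (T : H -> H) : \bar R :=
  lp_norm p (singular_values T).

Definition cp (p : R) : set (H -> H) :=
  [set T | compact_operator T /\ (cp_norm p T < +oo)%E].

End Schatten.

Section MatrixSchatten.
Context {R : realType}.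

Definition mx_singular_value n (A : 'M[R[i]]_n) (i : 'I_n) : R :=
  Num.sqrt (complex.Re (spectral_diag (A ^t* *m A) 0 i)).

Definition cpn_norm (p : R) n (A : 'M[R[i]]_n) : R :=
  (\sum_(i < n) mx_singular_value A i `^ p) `^ p^-1.

End MatrixSchatten.

(* The product of the spaces of n x n matrices, n >= 1, with pointwise vector
   space operations. *)
Definition mxseq (R : realType) : Type := forall n : nat, 'M[R[i]]_n.+1.

Section MxSeq.
Context {R : realType}.

HB.instance Definition _ := gen_eqMixin (mxseq R).
HB.instance Definition _ := gen_choiceMixin (mxseq R).

Let mxseq0 : mxseq R := fun n => 0.
Let mxseqN (A : mxseq R) : mxseq R := fun n => - A n.
Let mxseqD (A B : mxseq R) : mxseq R := fun n => A n + B n.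
Let mxseqZ (a : R[i]) (A : mxseq R) : mxseq R := fun n => a *: A n.

Let mxseq_ext (A B : mxseq R) : (forall n, A n = B n) -> A = B.
Proof. exact: functional_extensionality_dep. Qed.

Let mxseqDA : associative mxseqD.
Proof. by move=> A B C; apply: mxseq_ext => n; exact: addrA. Qed.
Let mxseqDC : commutative mxseqD.
Proof. by move=> A B; apply: mxseq_ext => n; exact: addrC. Qed.
Let mxseq0D : left_id mxseq0 mxseqD.
Proof. by move=> A; apply: mxseq_ext => n; exact: add0r. Qed.
Let mxseqND : left_inverse mxseq0 mxseqN mxseqD.
Proof. by move=> A; apply: mxseq_ext => n; exact: addNr. Qed.

HB.instance Definition _ :=
  GRing.isZmodule.Build (mxseq R) mxseqDA mxseqDC mxseq0D mxseqND.

Let mxseqZA a b A : mxseqZ a (mxseqZ b A) = mxseqZ (a * b) A.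
Proof. by apply: mxseq_ext => n; exact: scalerA. Qed.
Let mxseq1Z : left_id 1 mxseqZ.
Proof. by move=> A; apply: mxseq_ext => n; exact: scale1r. Qed.
Let mxseqZDr : right_distributive mxseqZ +%R.
Proof. by move=> a A B; apply: mxseq_ext => n; exact: scalerDr. Qed.
Let mxseqZDl A : {morph mxseqZ^~ A : a b / a + b}.
Proof. by move=> a b; apply: mxseq_ext => n; exact: scalerDl. Qed.

HB.instance Definition _ :=
  GRing.Zmodule_isLmodule.Build R[i] (mxseq R) mxseqZA mxseq1Z mxseqZDr mxseqZDl.

Definition lp_cpn_norm (p : R) (A : mxseq R) : \bar R :=
  lp_norm p (fun n => cpn_norm p (A n)).

Definition lp_cpn (p : R) : set (mxseq R) :=
  [set A | (lp_cpn_norm p A < +oo)%E].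

End MxSeq.

(* Main.v *)
Require Import Defs.
From HB Require Import structures.
From mathcomp Require Import all_boot all_order all_algebra.
From mathcomp Require Import complex.
From mathcomp Require Import all_classical all_reals all_analysis.
From mathcomp Require Import ring lra zify.

Set Implicit Arguments.
Unset Strict Implicit.
Unset Printing Implicit Defensive.

Import Order.TTheory GRing.Theory Num.Theory.
Import numFieldNormedType.Exports.

Local Open Scope classical_set_scope.
Local Open Scope ring_scope.

(* For p >= 2, a linear map T on H satisfies |T|_p <= M iff
   sum_g w_g |T u_g|^p <= M^p for every finite family of weights w_g >= 0 and
   vectors |u_g| <= 1 with sum_g w_g |<u_g, y>|^2 <= |y|^2 for all y; all norm
   estimates are made with such families.

   (ii) => (i): in l_p(c_p^n) the images of the unit vectors of l_2 tend to 0 in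
   every coordinate, so that sums of N of them have norm O(N^(1/p)), whereas the
   norm in l_2 is N^(1/2).

   (i) => (iii): fix an orthonormal basis of H and consider the matrices of the
   elements of X. If the tails of some row or column were not uniformly small
   on the unit ball of X, a gliding hump would produce a sequence of X equivalent
   to the unit vectors of l_2. Hence the basis can be cut into consecutive
   blocks such that each element of X is, up to a small relative error, block
   tridiagonal. For r < N, cut the sequence of blocks into windows of N
   consecutive blocks, with shift r, and let x_r be the block diagonal part of
   x along these windows. The map sending x to N^(-1/p) (x_0, ..., x_(N-1)) is a
   contraction of X into l_p(c_p^n). As every pair of neighbouring blocks is
   separated by a single r, Minkowski's inequality in l_p shows that x has norm
   at most that of its image plus (2 N^(-1/p) + small) |x|_p. *)

(** * Hilbert space geometry *)

(** Weighted families take the place of the ideal and trace calculus of the Schatten classes: since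
    p / 2 >= 1, the main estimates reduce to Jensen's inequality for squared norms, with weights
    whose sum is at most 1 by a Bessel inequality. The price is an asymmetry. Sums with orthogonal
    ranges (rows) are estimated directly; sums with orthogonal initial spaces (columns) need the
    invariance of the norm under adjoints, taken from the singular value decomposition.

    Humps behave like the unit vectors of l_2 for two reasons: the fixed row or column reads off the
    coefficients in the l_2 norm, and a combination of disjoint strips with coefficients a has norm
    at most |a|_2 times a common bound of the strips. To make humps nearly disjoint, differences of
    two elements with almost equal corners are taken.

    One partition into windows would not do, as the blocks beside a cut may carry a fixed share of
    the norm. Over all N shifts together, however, the lost neighbouring blocks have p-th power sum
    at most twice that of x, whereas x itself is counted N times; this is the origin of 2
    N^(-1/p). *)

Section Modulus.
Context {R : realType}.
Implicit Types (z w : R[i]) (r : R).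

(* Norms take values in [R[i]]; [cn] and [hn] are their real values. *)
Definition cn z : R := complex.Re `|z|.

Lemma cnE z : `|z| = (cn z)%:C%C.
Proof. by rewrite /cn normc_def. Qed.

Lemma cn_ge0 z : 0 <= cn z.
Proof. by rewrite -ler0c -cnE. Qed.

Lemma cn0 : cn 0 = 0.
Proof. by rewrite /cn normr0. Qed.

Lemma cn1 : cn 1 = 1.
Proof. by rewrite /cn normr1. Qed.

Lemma cnM z w : cn (z * w) = cn z * cn w.
Proof. by apply: complexI; rewrite rmorphM/= -!cnE normrM. Qed.

Lemma cnN z : cn (- z) = cn z.
Proof. by rewrite /cn normrN. Qed.

Lemma cnD z w : cn (z + w) <= cn z + cn w.
Proof. by rewrite -lecR rmorphD/= -!cnE ler_normD. Qed.

Lemma cnJ z : cn (Num.conj z) = cn z.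
Proof. by rewrite /cn norm_conjC. Qed.

Lemma cn_eq0 z : (cn z == 0) = (z == 0).
Proof. by rewrite -(inj_eq (@complexI R)) -cnE/= normr_eq0. Qed.

Lemma cnR r : cn (r%:C)%C = `|r|.
Proof. by rewrite /cn normc_def/= expr0n/= addr0 sqrtr_sqr. Qed.

Lemma cnR_ge0 r : 0 <= r -> cn (r%:C)%C = r.
Proof. by move=> r0; rewrite cnR ger0_norm. Qed.

Lemma mulJ z : z * Num.conj z = (cn z ^+ 2)%:C%C.
Proof. by rewrite -normCK cnE rmorphXn. Qed.

Lemma cnV z : cn z^-1 = (cn z)^-1.
Proof.
have [->|z0] := eqVneq z 0; first by rewrite invr0 cn0 invr0.
apply: (mulfI (_ : cn z != 0)); first by rewrite cn_eq0.
by rewrite -cnM !mulfV ?cn1// cn_eq0.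
Qed.

Lemma Re_le_cn z : complex.Re z <= cn z.
Proof.
rewrite /cn normc_def/=; apply: (le_trans (ler_norm _)).
by rewrite -sqrtr_sqr ler_wsqrtr// lerDl sqr_ge0.
Qed.

Lemma conjR r : Num.conj (r%:C%C : R[i]) = r%:C%C.
Proof.
by apply/eqP; rewrite -CrealE; apply/complex_realP; exists r.
Qed.

Lemma sumR I (s : seq I) (P : pred I) (F : I -> R) :
  \sum_(i <- s | P i) (F i)%:C%C = (\sum_(i <- s | P i) F i)%:C%C :> R[i].
Proof. by rewrite rmorph_sum. Qed.

End Modulus.

Section Hilbert.
Context {R : realType} {H : completeNormedModType R[i]}.
Implicit Types (x y : H) (a : R[i]).

Definition hn x : R := complex.Re `|x|.

Lemma hnE x : `|x| = (hn x)%:C%C.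
Proof. by rewrite /hn RRe_real// normr_real. Qed.

Lemma hn_ge0 x : 0 <= hn x.
Proof. by rewrite -ler0c -hnE. Qed.

Lemma hn0 : hn 0 = 0.
Proof. by rewrite /hn normr0. Qed.

Lemma hnZ a x : hn (a *: x) = cn a * hn x.
Proof. by apply: complexI; rewrite rmorphM/= -cnE -!hnE normrZ. Qed.

Lemma hnN x : hn (- x) = hn x.
Proof. by rewrite /hn normrN. Qed.

Lemma hnD x y : hn (x + y) <= hn x + hn y.
Proof. by rewrite -lecR rmorphD/= -!hnE ler_normD. Qed.

Lemma hnB x y : hn (x - y) <= hn x + hn y.
Proof. by rewrite -(hnN y) hnD. Qed.

Lemma hn_eq0 x : (hn x == 0) = (x == 0).
Proof. by rewrite -(inj_eq (@complexI R)) -hnE/= normr_eq0. Qed.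

Lemma hnBC x y : hn (x - y) = hn (y - x).
Proof. by rewrite -hnN opprB. Qed.

Variable dot : {dot H for Num.conj}.
Hypothesis hdot : forall x : H, `|x| ^+ 2 = dot x x.

Lemma dotDl x y z : dot (x + y) z = dot x z + dot y z.
Proof. exact: linearDl. Qed.
Lemma dotDr x y z : dot z (x + y) = dot z x + dot z y.
Proof. exact: linearDr. Qed.
Lemma dotZl a x z : dot (a *: x) z = a * dot x z.
Proof. exact: linearZl_LR. Qed.
Lemma dotZr a x z : dot z (a *: x) = Num.conj a * dot z x.
Proof. exact: linearZr_LR. Qed.
Lemma dotNl x z : dot (- x) z = - dot x z.
Proof. exact: linearNl. Qed.
Lemma dotNr x z : dot z (- x) = - dot z x.
Proof. exact: linearNr. Qed.
Lemma dot0l z : dot 0 z = 0.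
Proof. exact: linear0l. Qed.
Lemma dot0r z : dot z 0 = 0.
Proof. exact: linear0r. Qed.
Lemma dotBl x y z : dot (x - y) z = dot x z - dot y z.
Proof. by rewrite dotDl dotNl. Qed.
Lemma dotBr x y z : dot z (x - y) = dot z x - dot z y.
Proof. by rewrite dotDr dotNr. Qed.
Lemma dotC x y : dot y x = Num.conj (dot x y).
Proof. by rewrite hermC/= expr0 mul1r. Qed.

Lemma dot_suml I (s : seq I) (P : pred I) (F : I -> H) z :
  dot (\sum_(i <- s | P i) F i) z = \sum_(i <- s | P i) dot (F i) z.
Proof.
by elim/big_rec2 : _ => [|i u v _ <-]; rewrite ?dot0l ?dotDl.
Qed.

Lemma dot_sumr I (s : seq I) (P : pred I) (F : I -> H) z :
  dot z (\sum_(i <- s | P i) F i) = \sum_(i <- s | P i) dot z (F i).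
Proof.
by elim/big_rec2 : _ => [|i u v _ <-]; rewrite ?dot0r ?dotDr.
Qed.

Lemma cn_dotC x y : cn (dot x y) = cn (dot y x).
Proof. by rewrite dotC cnJ. Qed.

Lemma dotxx x : dot x x = (hn x ^+ 2)%:C%C.
Proof. by rewrite -hdot hnE rmorphXn. Qed.

Lemma dotC0 x y : dot x y = 0 -> dot y x = 0.
Proof. by move=> h; rewrite dotC h conjC0. Qed.

Lemma hn2D x y : hn (x + y) ^+ 2 = hn x ^+ 2 + hn y ^+ 2 + 2 * complex.Re (dot x y).
Proof.
apply: complexI; rewrite -dotxx dotDl !dotDr !dotxx (dotC x y).
have h : dot x y + Num.conj (dot x y) = (2 * complex.Re (dot x y))%:C%C :> R[i].
  have -> : Num.conj (dot x y) = conjc (dot x y) by [].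
  by rewrite addcJ rmorphM/= rmorph_nat.
by rewrite !rmorphD/= -h; ring.
Qed.

Lemma pyth x y : dot x y = 0 -> hn (x + y) ^+ 2 = hn x ^+ 2 + hn y ^+ 2.
Proof. by move=> h; rewrite hn2D h/= mulr0 addr0. Qed.

Lemma parallelogram x y :
  hn (x + y) ^+ 2 + hn (x - y) ^+ 2 = 2 * (hn x ^+ 2 + hn y ^+ 2).
Proof.
by rewrite !hn2D hnN dotNr; case: (dot x y) => a b /=; ring.
Qed.

Lemma cauchy_schwarz x y : cn (dot x y) <= hn x * hn y.
Proof.
have [->|y0] := eqVneq y 0; first by rewrite dot0r cn0 hn0 mulr0.
have hy : hn y != 0 by rewrite hn_eq0.
have hy0 : 0 < hn y by rewrite lt_def hy hn_ge0.
pose a : R[i] := dot x y / (hn y ^+ 2)%:C%C.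
have h : dot (x - a *: y) (a *: y) = 0.
  rewrite dotZr dotBl dotZl dotxx divfK ?subrr ?mulr0//.
  by rewrite -(rmorph0 (real_complex R)) (inj_eq (@complexI R)) expf_eq0 /= hy.
have := pyth h; rewrite subrK => hx.
have : hn (a *: y) ^+ 2 <= hn x ^+ 2 by rewrite hx lerDr sqr_ge0.
rewrite ler_sqr ?nnegrE ?hn_ge0// hnZ /a cnM cnV cnR_ge0 ?sqr_ge0//.
by rewrite expr2 invfM mulrA divfK// ler_pdivrMr.
Qed.

End Hilbert.

Section Orthosystems.
Context {R : realType} {H : completeNormedModType R[i]}.
Variable dot : {dot H for Num.conj}.
Hypothesis hdot : forall x : H, `|x| ^+ 2 = dot x x.
Implicit Types (x y : H) (e : nat -> H) (A B : pred nat).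

Definition hto (u : nat -> H) (l : H) : Prop :=
  forall eps, 0 < eps -> exists N, forall n, (N <= n)%N -> hn (u n - l) <= eps.

(** Zero members make room for finite families continued by zeros, and for vectors divided by a
    vanishing singular value. *)
Definition orthosystem e : Prop :=
  (forall i j, i != j -> dot (e i) (e j) = 0) /\
  (forall i, e i = 0 \/ hn (e i) = 1).

(** Two cut-offs in one notion: [A] selects coordinates and [n] keeps the sum finite. Corners,
    strips, blocks and windows of a matrix are all obtained by such projections on both sides of an
    operator. *)
Definition oproj e A n x : H := \sum_(i < n | A i) dot x (e i) *: e i.

Lemma hn2_sum n (F : 'I_n -> H) (P : pred 'I_n) :
  (forall i j, i != j -> dot (F i) (F j) = 0) ->
  hn (\sum_(i < n | P i) F i) ^+ 2 = \sum_(i < n | P i) hn (F i) ^+ 2.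
Proof.
move=> h; apply: complexI; rewrite -(dotxx hdot) dot_suml -sumR.
apply: eq_bigr => i Pi; rewrite dot_sumr (bigD1 i)//= big1 ?addr0 ?(dotxx hdot)//.
by move=> j /andP[_ ji]; apply: h; rewrite eq_sym.
Qed.

Lemma projD e A n x y : oproj e A n (x + y) = oproj e A n x + oproj e A n y.
Proof.
by rewrite /oproj -big_split; apply: eq_bigr => i _; rewrite dotDl scalerDl.
Qed.

Lemma projZ e A n a x : oproj e A n (a *: x) = a *: oproj e A n x.
Proof.
by rewrite /oproj scaler_sumr; apply: eq_bigr => i _; rewrite dotZl scalerA.
Qed.

Lemma proj0 e A n : oproj e A n 0 = 0.
Proof. by rewrite /oproj big1// => i _; rewrite dot0l scale0r. Qed.

Lemma projB e A n x y : oproj e A n (x - y) = oproj e A n x - oproj e A n y.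
Proof. by rewrite projD -scaleN1r projZ scaleN1r. Qed.

Lemma proj_lin e A n : linear (oproj e A n).
Proof. by move=> a x y; rewrite projD projZ. Qed.

Lemma eq_proj e A B n : (forall i, (i < n)%N -> A i = B i) ->
  oproj e A n =1 oproj e B n.
Proof. by move=> h x; apply: eq_bigl => i; exact: h. Qed.

Lemma proj_widen e A n m x : (n <= m)%N ->
  oproj e A n x = oproj e (fun i => A i && (i < n)%N) m x.
Proof. by move=> nm; rewrite /oproj (big_ord_widen_cond _ A (fun i => dot x (e i) *: e i) nm). Qed.

Lemma proj_dot e A n x y : dot (oproj e A n x) y = dot x (oproj e A n y).
Proof.
rewrite /oproj dot_suml dot_sumr; apply: eq_bigr => i _.
by rewrite dotZl dotZr -dotC mulrC.
Qed.

Lemma proj_comp_partition e n m (w : nat -> nat) x : (forall i, (i < n)%N -> (w i < m)%N) ->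
  oproj e predT n x = \sum_(t < m) oproj e (fun i => w i == t) n x.
Proof.
move=> h; rewrite /oproj.
pose w' (i : 'I_n) : 'I_m := Ordinal (h i (ltn_ord i)).
by rewrite (partition_big w' predT).
Qed.

Variable e : nat -> H.
Hypothesis he : orthosystem e.

Lemma ortho_scale x i : dot x (e i) * dot (e i) (e i) = dot x (e i).
Proof.
case: he => _ /(_ i)[->|h]; first by rewrite !dot0r mul0r.
by rewrite (dotxx hdot) h expr1n mulr1.
Qed.

Lemma dot_proj A n x j :
  dot (oproj e A n x) (e j) = if A j && (j < n)%N then dot x (e j) else 0.
Proof.
rewrite /oproj dot_suml; case: ifPn => [/andP[Aj jn]|h].
  rewrite (bigD1 (Ordinal jn))//= dotZl ortho_scale big1 ?addr0// => i /andP[_ ij].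
  by rewrite dotZl he.1 ?mulr0//.
rewrite big1// => i Ai; rewrite dotZl he.1 ?mulr0//.
by apply: contraNneq h => <-; rewrite Ai ltn_ord.
Qed.

Lemma proj_proj A B n x : oproj e A n (oproj e B n x) = oproj e (predI A B) n x.
Proof.
rewrite {1}/oproj /oproj [RHS](eq_bigl (fun i : 'I_n => A i && B i))//.
rewrite big_mkcondr/=; apply: eq_bigr => i _.
by rewrite -/(oproj _ _ _ _) dot_proj ltn_ord andbT; case: ifP => //; rewrite scale0r.
Qed.

Lemma proj_idem A n x : oproj e A n (oproj e A n x) = oproj e A n x.
Proof. by rewrite proj_proj; apply: eq_proj => i _ /=; rewrite andbb. Qed.

Lemma proj_disj A B n x : (forall i, (i < n)%N -> ~~ (A i && B i)) ->
  oproj e A n (oproj e B n x) = 0.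
Proof.
move=> h; rewrite proj_proj /oproj big1// => i /=.
by move=> /negPn; rewrite (negbTE (h _ (ltn_ord i))).
Qed.

Lemma hn2_proj A n x :
  hn (oproj e A n x) ^+ 2 = \sum_(i < n | A i) cn (dot x (e i)) ^+ 2.
Proof.
rewrite /oproj hn2_sum => [|i j ij]; last by rewrite dotZl dotZr he.1 ?mulr0.
apply: eq_bigr => i _; rewrite hnZ.
by case: he => _ /(_ i)[->|->]; rewrite ?dot0r ?cn0 ?hn0 ?mulr0 ?mulr1.
Qed.

Lemma hn2_projB A n x :
  hn x ^+ 2 = hn (oproj e A n x) ^+ 2 + hn (x - oproj e A n x) ^+ 2.
Proof.
rewrite -(pyth hdot) ?(addrC (oproj _ _ _ _)) ?subrK//.
by rewrite dotBr !proj_dot proj_idem subrr.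
Qed.

Lemma hn_proj A n x : hn (oproj e A n x) <= hn x.
Proof. by rewrite -ler_sqr ?nnegrE ?hn_ge0// (hn2_projB A n x) lerDl sqr_ge0. Qed.

Lemma hn_subproj A n x : hn (x - oproj e A n x) <= hn x.
Proof. by rewrite -ler_sqr ?nnegrE ?hn_ge0// (hn2_projB A n x) lerDr sqr_ge0. Qed.

Lemma bessel_ineq A n x : \sum_(i < n | A i) cn (dot x (e i)) ^+ 2 <= hn x ^+ 2.
Proof. by rewrite -hn2_proj ler_sqr ?nnegrE ?hn_ge0// hn_proj. Qed.

Lemma hn2_sum_proj m n (w : nat -> nat) (F : 'I_m -> H) :
  hn (\sum_(t < m) oproj e (fun i => w i == t) n (F t)) ^+ 2 =
  \sum_(t < m) hn (oproj e (fun i => w i == t) n (F t)) ^+ 2.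
Proof.
apply: hn2_sum => s t st; rewrite proj_dot proj_disj ?dot0r//.
by move=> i _; apply: contraNN st => /andP[/eqP h1 /eqP h2]; apply/eqP/val_inj; rewrite /= -h1.
Qed.

(** Indices with a label at least [m] are lost, and so is the part of [x] outside the first [n]
    vectors; hence only an inequality. *)
Lemma sum_hn2_proj m n (w : nat -> nat) x :
  \sum_(t < m) hn (oproj e (fun i => w i == t) n x) ^+ 2 <= hn x ^+ 2.
Proof.
rewrite -hn2_sum_proj ler_sqr ?nnegrE ?hn_ge0//.
suff -> : \sum_(t < m) oproj e (fun i => w i == t) n x =
    oproj e (fun i => w i < m)%N n x by exact: hn_proj.
rewrite /oproj (exchange_big_dep (fun i : 'I_n => (w i < m)%N))/=.
  apply: eq_bigr => i wi; rewrite (bigD1 (Ordinal wi))//= big1 ?addr0//.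
  by move=> t /andP[/eqP h]; case/eqP; apply/val_inj.
by move=> t i _ /eqP ->.
Qed.

Lemma hn_cauchy (u : nat -> H) :
  (forall eps, 0 < eps -> exists N, forall m n, (N <= m)%N -> (N <= n)%N ->
     hn (u m - u n) <= eps) ->
  exists l, hto u l.
Proof.
move=> hu.
have cu : cvg (u @ \oo).
  apply/cauchy_cvgP/cauchy_ballP => E E0.
  (* Radii of balls in [H] are elements of [R[i]]; a positive one is real. *)
  have eE : E = (complex.Re E)%:C%C by rewrite RRe_real// gtr0_real.
  have e0 : 0 < complex.Re E by rewrite -ltcR -eE.
  have [N hN] := hu (complex.Re E / 2) (divr_gt0 e0 (ltr0n _ 2)).
  exists (u @` [set n | (N <= n)%N], u @` [set n | (N <= n)%N]).
    by split; exists N => // n Nn; exists n.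
  move=> [_ _] [/= [m Nm <-] [n Nn <-]].
  rewrite -ball_normE/= hnE eE ltcR; apply: (le_lt_trans (hN _ _ Nm Nn)).
  by rewrite ltr_pdivrMr// ltr_pMr// ltr1n.
exists (lim (u @ \oo)) => eps eps0.
have e0 : 0 < eps%:C%C :> R[i] by rewrite -(rmorph0 (real_complex R)) ltcR.
have /cvgrPdist_lt/(_ _ e0)[N _ hN] := cu.
exists N => n Nn; have := hN n Nn; rewrite /= hnE ltcR hnBC.
exact: ltW.
Qed.

(** By Pythagoras, the squared distance of two partial projections is the increment of the Bessel
    sums, which increase and stay below the squared norm of [x]. *)
Lemma proj_cauchy x : exists l, hto (fun n => oproj e predT n x) l.
Proof.
apply: hn_cauchy => eps eps0.
pose S n : R := \sum_(i < n) cn (dot x (e i)) ^+ 2.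
have Smono : nondecreasing_seq S.
  by apply/nondecreasing_seqP => n; rewrite /S big_ord_recr/= lerDl sqr_ge0.
have Sub : has_ubound (range S).
  by exists (hn x ^+ 2) => _ [n _ <-]; exact: (bessel_ineq predT).
have cS := nondecreasing_is_cvgn Smono Sub.
have /cauchy_cvgP/cauchy_ballP/(_ (eps ^+ 2)) := cS.
rewrite exprn_gt0// => /(_ isT)[[/= U V] [[N1 _ hU] [N2 _ hV]] hUV].
have key m n : (N1 <= n)%N -> (N2 <= m)%N -> (n <= m)%N ->
    hn (oproj e predT m x - oproj e predT n x) <= eps.
  move=> Nn Nm nm; rewrite -ler_sqr ?nnegrE ?hn_ge0 ?(ltW eps0)//.
  have := hUV (S n, S m) (conj (hU n Nn) (hV m Nm)).
  rewrite -ball_normE/= distrC ger0_norm ?subr_ge0 ?Smono// => /ltW; apply: le_trans.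
  have -> : oproj e predT n x = oproj e (fun i => i < n)%N m (oproj e predT m x).
    by rewrite proj_proj (proj_widen _ _ _ nm); apply: eq_proj => i _ /=; rewrite andbT.
  have := hn2_projB (fun i => i < n)%N m (oproj e predT m x).
  rewrite (hn2_proj predT) proj_proj => /esym/(canRL (addKr _)) ->.
  rewrite (_ : oproj e _ m x = oproj e predT n x) ?(hn2_proj predT) 1?addrC//.
  by rewrite (proj_widen _ _ _ nm); apply: eq_proj => i _ /=; rewrite andbT.
exists (N1 + N2)%N => m n Nm Nn.
have [nm|/ltnW mn] := leqP n m; last rewrite hnBC; apply: key => //; lia.
Qed.

End Orthosystems.

(** * Jensen and Minkowski inequalities for weighted finite sums *)

Section PowerMeans.
Context {R : realType}.
Implicit Types (p x y M N : R).

Lemma ler_powR2 p x y : 0 < p -> 0 <= x -> 0 <= y -> (x `^ p <= y `^ p) = (x <= y).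
Proof.
move=> p0 x0 y0; apply/idP/idP => [|xy]; last first.
  by apply: ge0_ler_powR; rewrite ?nnegrE// ltW.
apply: contraTT; rewrite -!ltNge => yx.
by apply: gt0_ltr_powR; rewrite ?nnegrE.
Qed.

Lemma powRVK p x : p != 0 -> 0 <= x -> (x `^ p^-1) `^ p = x.
Proof. by move=> p0 x0; rewrite -powRrM mulVf// powRr1. Qed.

(** The graph of the p-th power lies above its tangent at [m]. Young's inequality for the exponents
    p and p / (p - 1) gives this without derivatives. *)
Lemma powR_tangent p x m : 1 <= p -> 0 <= x -> 0 <= m ->
  p * (x * m `^ (p - 1)) <= x `^ p + (p - 1) * m `^ p.
Proof.
move=> p1 x0 m0; have p0 : 0 < p by rewrite (lt_le_trans ltr01).
have [->|pn1] := eqVneq p 1.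
  by rewrite subrr powRr0 mul0r addr0 powRr1// mul1r mulr1.
have p10 : 0 < p - 1 by rewrite subr_gt0 lt_def pn1.
pose q := p / (p - 1).
have q0 : 0 < q by rewrite divr_gt0.
have pq : p^-1 + q^-1 = 1.
  by rewrite /q; field; rewrite !gt_eqF.
have := conjugate_powR x0 (powR_ge0 m (p - 1)) p0 q0 pq.
rewrite -powRrM /q mulrCA mulfV ?gt_eqF// mulr1 => h.
rewrite -(ler_pM2l p0) in h; apply: (le_trans h).
rewrite le_eqVlt; apply/orP; left; apply/eqP.
by field; rewrite !gt_eqF.
Qed.

(** Sum the tangent inequality at the weighted mean [m]. A total weight below 1 is allowed because
    the constant term of the tangent, -(p - 1) m^p, is not positive. *)
Lemma jensen p (T : eqType) (s : seq T) (v t : T -> R) : 1 <= p ->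
  (forall i, i \in s -> 0 <= v i) -> (forall i, i \in s -> 0 <= t i) ->
  \sum_(i <- s) v i <= 1 ->
  (\sum_(i <- s) v i * t i) `^ p <= \sum_(i <- s) v i * t i `^ p.
Proof.
move=> p1 v0 t0 v1; set m := \sum_(i <- s) v i * t i.
have p0 : 0 < p by rewrite (lt_le_trans ltr01).
have m0 : 0 <= m.
  by rewrite /m big_seq sumr_ge0// => i /[dup] /v0 ? /t0 ?; rewrite mulr_ge0.
have h : p * (m * m `^ (p - 1)) <=
   \sum_(i <- s) v i * t i `^ p + (p - 1) * m `^ p * \sum_(i <- s) v i.
  rewrite {1}/m mulr_suml mulr_sumr mulr_sumr -big_split/= !big_seq.
  apply: ler_sum => i si; rewrite -mulrA mulrCA [_ * v i]mulrC -mulrDr.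
  by rewrite ler_wpM2l ?v0// powR_tangent ?t0.
rewrite mulr_powRB1// in h.
have : (p - 1) * m `^ p * \sum_(i <- s) v i <= (p - 1) * m `^ p.
  by rewrite ler_piMr// mulr_ge0 ?powR_ge0// subr_ge0.
move=> /(lerD (lexx (\sum_(i <- s) v i * t i `^ p))) /(le_trans h).
by lra.
Qed.

(** For positive [M] and [N], f + g is M + N times the convex combination of f / M and g / N with
    weights M / (M + N) and N / (M + N), so convexity of the p-th power suffices. If a bound is 0,
    the corresponding function vanishes wherever the weight does not. *)
Lemma minkowski_bound p (T : eqType) (s : seq T) (w f g : T -> R) M N : 1 <= p ->
  0 <= M -> 0 <= N ->
  (forall i, i \in s -> 0 <= w i) -> (forall i, i \in s -> 0 <= f i) ->
  (forall i, i \in s -> 0 <= g i) ->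
  \sum_(i <- s) w i * f i `^ p <= M `^ p ->
  \sum_(i <- s) w i * g i `^ p <= N `^ p ->
  \sum_(i <- s) w i * (f i + g i) `^ p <= (M + N) `^ p.
Proof.
move=> p1; have p0 : 0 < p by rewrite (lt_le_trans ltr01).
have zero (a b : T -> R) : (forall i, i \in s -> 0 <= w i) ->
    (forall i, i \in s -> 0 <= a i) ->
    \sum_(i <- s) w i * a i `^ p <= 0 `^ p ->
    \sum_(i <- s) w i * (a i + b i) `^ p = \sum_(i <- s) w i * b i `^ p.
  move=> w0 a0; rewrite powR0 ?gt_eqF// => h.
  have h0 i : i \in s -> 0 <= w i * a i `^ p.
    by move=> /w0 ?; rewrite mulr_ge0// powR_ge0.
  have : \sum_(i <- s) w i * a i `^ p == 0.
    by rewrite eq_le h/= big_seq sumr_ge0.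
  rewrite big_seq psumr_eq0// => /allP hz.
  rewrite !big_seq; apply: eq_bigr => i si.
  have := hz _ si; rewrite si/= mulf_eq0 => /orP[/eqP->|]; first by rewrite !mul0r.
  by rewrite powR_eq0 => /andP[/eqP ->]; rewrite add0r.
move=> M0 N0 w0 f0 g0 hf hg.
move: M0; rewrite le_eqVlt => /predU1P[M0|M0].
  by move: hf; rewrite -M0 add0r => hf; rewrite zero.
move: N0; rewrite le_eqVlt => /predU1P[N0|N0].
  rewrite -N0 addr0 (eq_bigr (fun i => w i * (g i + f i) `^ p)).
    by move: hg; rewrite -N0 => hg; rewrite zero.
  by move=> i _; rewrite addrC.
have MN0 : 0 < M + N by rewrite addr_gt0.
pose a := M / (M + N); pose b := N / (M + N).
have a0 : 0 < a by rewrite divr_gt0.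
have b0 : 0 < b by rewrite divr_gt0.
have ab : a + b = 1 by rewrite -mulrDl mulfV// gt_eqF.
have key i : i \in s -> w i * (f i + g i) `^ p <=
    (M + N) `^ p * (a / M `^ p * (w i * f i `^ p) + b / N `^ p * (w i * g i `^ p)).
  move=> si.
  have := @jensen p _ [:: true; false] (fun c : bool => if c then a else b)
     (fun c : bool => if c then f i / M else g i / N) p1.
  rewrite !big_cons !big_nil !addr0 ab => /(_ _ _ (lexx _)) h.
  have {}h : (a * (f i / M) + b * (g i / N)) `^ p <= a * (f i / M) `^ p + b * (g i / N) `^ p.
    by apply: h => -[] _; rewrite ?(ltW a0) ?(ltW b0)// divr_ge0 ?f0 ?g0 ?(ltW M0) ?(ltW N0).
  have -> : f i + g i = (M + N) * (a * (f i / M) + b * (g i / N)).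
    by rewrite /a /b; field; rewrite !gt_eqF.
  rewrite powRM ?(ltW MN0)//; last first.
    by rewrite addr_ge0// mulr_ge0 ?(ltW a0) ?(ltW b0)// divr_ge0 ?f0 ?g0 ?(ltW M0) ?(ltW N0).
  rewrite mulrCA ler_wpM2l ?powR_ge0//.
  apply: (le_trans (ler_wpM2l (w0 _ si) h)).
  rewrite !powRM ?invr_ge0 ?f0 ?g0 ?(ltW M0) ?(ltW N0)//.
  have inv x : 0 < x -> x^-1 `^ p = (x `^ p)^-1.
    by move=> x0; rewrite -powR_inv1 ?ltW// powRAC powR_inv1 ?powR_ge0.
  rewrite !inv// le_eqVlt; apply/orP; left; apply/eqP; ring.
rewrite big_seq; apply: (le_trans (ler_sum _ key)).
rewrite -big_seq -mulr_sumr ler_piMr ?powR_ge0// big_split/= -!mulr_sumr.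
rewrite -ab lerD// -mulrA ler_piMr ?(ltW a0) ?(ltW b0)//.
  by rewrite mulrC ler_pdivrMr ?powR_gt0// mul1r.
by rewrite mulrC ler_pdivrMr ?powR_gt0// mul1r.
Qed.

End PowerMeans.

Section LinearMaps.
Context {R : realType} {V W : lmodType R[i]}.
Variable T : V -> W.
Hypothesis linT : linear T.

Lemma linmD x y : T (x + y) = T x + T y.
Proof. by have := linT 1 x y; rewrite !scale1r. Qed.

Lemma linm0 : T 0 = 0.
Proof. by apply: (@addrI _ (T 0)); rewrite -linmD !addr0. Qed.

Lemma linmZ a x : T (a *: x) = a *: T x.
Proof. by have := linT a x 0; rewrite linm0 !addr0. Qed.

Lemma linmB x y : T (x - y) = T x - T y.
Proof. by rewrite linmD -scaleN1r linmZ scaleN1r. Qed.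

Lemma linm_sum I (s : seq I) (P : pred I) (F : I -> V) :
  T (\sum_(i <- s | P i) F i) = \sum_(i <- s | P i) T (F i).
Proof. by elim/big_rec2 : _ => [|i u v _ <-]; rewrite ?linm0 ?linmD. Qed.

End LinearMaps.

(** * A variational description of the Schatten norms *)

Section SchattenBound.
Context {R : realType} {H : completeNormedModType R[i]}.
Variable dot : {dot H for Num.conj}.
Hypothesis hdot : forall x : H, `|x| ^+ 2 = dot x x.
Variable p : R.
Hypothesis p2 : 2 < p.
Implicit Types (T S : H -> H) (s : seq (R * H)) (M N : R).

Let p0 : 0 < p. Proof. by apply: lt_trans p2. Qed.
Let p1 : 1 <= p. Proof. by apply/ltW/(lt_trans _ p2); rewrite ltr1n. Qed.
Let pn0 : p != 0. Proof. by rewrite gt_eqF. Qed.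
Let q1 : 1 <= p / 2. Proof. by rewrite ler_pdivlMr// mul1r ltW. Qed.

Definition bessel s : Prop :=
  (forall g, g \in s -> 0 <= g.1 /\ hn g.2 <= 1) /\
  (forall y, \sum_(g <- s) g.1 * cn (dot g.2 y) ^+ 2 <= hn y ^+ 2).

Definition psum T s : R := \sum_(g <- s) g.1 * hn (T g.2) `^ p.

(* Equivalent to [cp_norm dot p T <= M] for compact [T] since [p >= 2]. *)
Definition bnd T M : Prop :=
  0 <= M /\ forall s, bessel s -> psum T s <= M `^ p.

(** A real infimum, significant only when some [bnd T M] holds: the infimum of the empty set is a
    default value. This is why the lemmas on [nrm] carry a bound as hypothesis. *)
Definition nrm T : R := inf [set M | bnd T M].

Lemma powR_half x : 0 <= x -> x `^ p = (x ^+ 2) `^ (p / 2).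
Proof. by move=> x0; rewrite -powR_mulrn// -powRrM mulrC divfK. Qed.

Lemma psum_ge0 T s : bessel s -> 0 <= psum T s.
Proof.
move=> [h _]; rewrite /psum big_seq sumr_ge0// => g /h[? _].
by rewrite mulr_ge0 ?powR_ge0.
Qed.

Lemma psum_le S T s : bessel s ->
  (forall g, g \in s -> hn (S g.2) <= hn (T g.2)) -> psum S s <= psum T s.
Proof.
move=> [hs _] h; rewrite /psum !big_seq; apply: ler_sum => g gs.
by rewrite ler_wpM2l ?(hs _ gs).1// ler_powR2 ?hn_ge0 ?h.
Qed.

Lemma bessel_nil : bessel [::].
Proof. by split=> // y; rewrite big_nil sqr_ge0. Qed.

Lemma bndW T M N : M <= N -> bnd T M -> bnd T N.
Proof.
move=> MN [M0 h]; split; first exact: le_trans MN.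
by move=> s /h /le_trans; apply; rewrite ler_powR2// (le_trans M0).
Qed.

Lemma bnd_le S T M : (forall u, hn (S u) <= hn (T u)) -> bnd T M -> bnd S M.
Proof.
move=> h [M0 hT]; split=> // s hs; apply: le_trans (hT s hs).
exact: psum_le.
Qed.

Lemma eq_bnd S T M : S =1 T -> bnd T M -> bnd S M.
Proof. by move=> e; apply: bnd_le => u; rewrite e. Qed.

Lemma bnd_le_add V T S M N : (forall u, hn (V u) <= hn (T u) + hn (S u)) ->
  bnd T M -> bnd S N -> bnd V (M + N).
Proof.
move=> h [M0 hT] [N0 hS]; split=> [|s hs]; first by rewrite addr_ge0.
have hm : \sum_(g <- s) g.1 * (hn (T g.2) + hn (S g.2)) `^ p <= (M + N) `^ p.
  apply: (minkowski_bound p1 M0 N0 _ _ _ (hT _ hs) (hS _ hs)) => g.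
  - by move=> /hs.1[].
  - by rewrite hn_ge0.
  - by rewrite hn_ge0.
apply: le_trans hm; rewrite /psum !big_seq; apply: ler_sum => g gs.
by rewrite ler_wpM2l ?(hs.1 _ gs).1// ler_powR2 ?addr_ge0 ?hn_ge0.
Qed.

Lemma bndD T S M N : bnd T M -> bnd S N -> bnd (fun u => T u + S u) (M + N).
Proof. by apply: bnd_le_add => u; exact: hnD. Qed.

Lemma bnd0 : bnd (fun=> 0) 0.
Proof.
split=> // s _; rewrite /psum big1 ?powR_ge0// => g _.
by rewrite hn0 powR0// mulr0.
Qed.

Lemma bndZ a T M : bnd T M -> bnd (fun u => a *: T u) (cn a * M).
Proof.
move=> [M0 h]; split=> [|s hs]; first by rewrite mulr_ge0 ?cn_ge0.
rewrite powRM ?cn_ge0//; apply: le_trans (ler_wpM2l (powR_ge0 _ _) (h s hs)).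
rewrite /psum mulr_sumr le_eqVlt; apply/orP; left; apply/eqP/eq_bigr => g _.
by rewrite hnZ powRM ?cn_ge0 ?hn_ge0// mulrCA.
Qed.

Lemma bndN T M : bnd T M -> bnd (fun u => - T u) M.
Proof. by apply: bnd_le => u; rewrite hnN. Qed.

Lemma bndB T S M N : bnd T M -> bnd S N -> bnd (fun u => T u - S u) (M + N).
Proof. by move=> h /bndN; exact: bndD. Qed.

Lemma bnd_sum I (r : seq I) (P : pred I) (T : I -> H -> H) (M : I -> R) :
  (forall i, P i -> bnd (T i) (M i)) ->
  bnd (fun u => \sum_(i <- r | P i) T i u) (\sum_(i <- r | P i) M i).
Proof.
move=> h; elim: r => [|i r IH].
  by rewrite big_nil; apply: eq_bnd bnd0 => u; rewrite big_nil.
rewrite big_cons; case: ifPn => Pi; last first.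
  by apply: eq_bnd IH => u; rewrite big_cons (negbTE Pi).
by apply: eq_bnd (bndD (h _ Pi) IH) => u; rewrite big_cons Pi.
Qed.

Lemma bessel_map (Q : H -> H) s : (forall u, hn (Q u) <= hn u) ->
  (forall u y, dot (Q u) y = dot u (Q y)) ->
  bessel s -> bessel [seq (g.1, Q g.2) | g <- s].
Proof.
move=> h sa [h1 h2]; split=> [_ /mapP[g /h1[g0 g1] ->]|y].
  by split=> //; exact: le_trans (h _) g1.
rewrite big_map/=; apply: le_trans (_ : hn (Q y) ^+ 2 <= _).
  by apply: le_trans (h2 (Q y)); apply: ler_sum => g _; rewrite sa.
by rewrite ler_sqr ?nnegrE ?hn_ge0.
Qed.

Lemma bnd_comp T Q M : (forall u, hn (Q u) <= hn u) ->
  (forall u y, dot (Q u) y = dot u (Q y)) -> bnd T M -> bnd (T \o Q) M.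
Proof.
move=> h sa [M0 hT]; split=> // s /(bessel_map h sa)/hT.
by rewrite /psum big_map.
Qed.

(** The operator norm is at most the Schatten norm: a single unit vector of weight 1 is a Bessel
    family by Cauchy-Schwarz. *)
Lemma bnd_op T M u : linear T -> bnd T M -> hn (T u) <= M * hn u.
Proof.
move=> linT [M0 h].
have [->|u0] := eqVneq u 0; first by rewrite linm0// hn0 mulr0.
have hu : 0 < hn u by rewrite lt_def hn_eq0 u0 hn_ge0.
pose v := ((hn u)^-1)%:C%C *: u.
have hv : hn v = 1 by rewrite /v hnZ cnR_ge0 ?invr_ge0 ?(ltW hu)// mulVf// gt_eqF.
have := h [:: (1, v)]; rewrite /psum big_seq1 /= mul1r => {}h.
have : hn (T v) <= M.
  rewrite -(ler_powR2 p0)// ?hn_ge0//; apply: h; split=> [g|y].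
    by rewrite inE => /eqP -> /=; rewrite hv.
  rewrite big_seq1 mul1r ler_sqr ?nnegrE ?cn_ge0 ?hn_ge0//.
  by apply: le_trans (cauchy_schwarz hdot _ _) _; rewrite hv mul1r.
rewrite /v linmZ// hnZ cnR_ge0 ?invr_ge0 ?(ltW hu)//.
by rewrite mulrC ler_pdivrMr.
Qed.

(** Write |<g, a>|^p as |<g, a>|^(p - 2) |<g, a>|^2. The first factor is at most |a|^(p - 2) since
    |g| <= 1, and the second is summed by the Bessel inequality of the family at [a]. *)
Lemma bnd_rank1 T a c : 0 <= c -> (forall u, hn (T u) <= cn (dot u a) * c) ->
  bnd T (hn a * c).
Proof.
move=> c0 h; split=> [|s hs]; first by rewrite mulr_ge0 ?hn_ge0.
have key g : g \in s ->
    g.1 * hn (T g.2) `^ p <= (hn a * c) `^ p / hn a ^+ 2 * (g.1 * cn (dot g.2 a) ^+ 2).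
  move=> gs; have [g0 g1] := hs.1 _ gs; rewrite mulrCA ler_wpM2l//.
  apply: le_trans (_ : (cn (dot g.2 a) * c) `^ p <= _).
    by rewrite ler_powR2 ?mulr_ge0 ?hn_ge0 ?cn_ge0.
  rewrite !powRM ?hn_ge0 ?cn_ge0//.
  have [ha|ha] := eqVneq (hn a) 0.
    have -> : a = 0 by apply/eqP; rewrite -hn_eq0 ha.
    by rewrite dot0r cn0 powR0// mul0r expr0n/= mulr0.
  have ha0 : 0 < hn a by rewrite lt_def ha hn_ge0.
  have [->|hc] := eqVneq (cn (dot g.2 a)) 0; first by rewrite powR0// mul0r expr0n/= mulr0.
  have split2 x : 0 < x -> x `^ p = x `^ (p - 2) * x ^+ 2.
    move=> x0; rewrite -powR_mulrn ?(ltW x0)// -powRD ?subrK//.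
    by rewrite (gt_eqF x0) implybT.
  rewrite [leRHS](_ : _ = hn a `^ p / hn a ^+ 2 * cn (dot g.2 a) ^+ 2 * c `^ p); last by ring.
  rewrite ler_wpM2r ?powR_ge0//.
  rewrite (split2 _ ha0) mulfK ?expf_neq0// split2 ?lt_def ?hc ?cn_ge0//.
  rewrite ler_wpM2r ?sqr_ge0// ler_powR2 ?subr_gt0 ?hn_ge0 ?cn_ge0//.
  apply: (le_trans (cauchy_schwarz hdot _ _)); rewrite ler_piMl ?hn_ge0//.
rewrite /psum big_seq; apply: (le_trans (ler_sum _ key)).
rewrite -big_seq -mulr_sumr.
have [ha|ha] := eqVneq (hn a) 0; first by rewrite ha expr0n/= invr0 mulr0 mul0r powR_ge0.
by rewrite -mulrA ler_piMr ?powR_ge0// mulrC ler_pdivrMr ?mul1r ?hs.2// exprn_gt0// lt_def ha hn_ge0.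
Qed.

Lemma le_powR_eps x M : 0 <= M -> (forall eps, 0 < eps -> x <= (M + eps) `^ p) ->
  x <= M `^ p.
Proof.
move=> M0 h; have [x0|x0] := leP x 0; first by rewrite (le_trans x0)// powR_ge0.
rewrite -(powRVK pn0 (ltW x0)) ler_powR2 ?powR_ge0//.
apply/ler_addgt0Pr => eps eps0.
rewrite -(ler_powR2 p0) ?powR_ge0 ?addr_ge0 ?(ltW eps0)//.
by rewrite powRVK ?(ltW x0)// h.
Qed.

Lemma bnd_inf T M : 0 <= M -> (forall eps, 0 < eps -> bnd T (M + eps)) -> bnd T M.
Proof.
move=> M0 h; split=> // s hs; apply: le_powR_eps => // eps eps0.
exact: (h _ eps0).2.
Qed.

(* Lower semicontinuity under pointwise convergence: a family being finite, it
   only tests T on finitely many vectors. *)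
Lemma bnd_lim T M : 0 <= M -> (forall (us : seq H) eps, 0 < eps ->
    exists2 S, bnd S M & forall u, u \in us -> hn (T u) <= hn (S u) + eps) ->
  bnd T M.
Proof.
move=> M0 h; split=> // s hs; apply: le_powR_eps => // eps eps0.
pose w := \sum_(g <- s) g.1.
have w0 : 0 <= w by rewrite /w big_seq sumr_ge0// => g /hs.1[].
(* A uniform error [d] becomes d w^(1/p) in the l_p sum, where [w] is the total weight of the
   family; the summand 1 prevents division by 0. *)
pose d := eps / (w `^ p^-1 + 1).
have d0 : 0 < d by rewrite divr_gt0// ltr_wpDl// powR_ge0.
have [S hS hTS] := h [seq g.2 | g <- s] _ d0.
have dw : d * w `^ p^-1 <= eps.
  by rewrite /d mulrAC ler_pdivrMr ?ltr_wpDl ?powR_ge0// ler_pM2l// lerDl.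
have hd : \sum_(g <- s) g.1 * d `^ p <= eps `^ p.
  rewrite -mulr_suml -/w -[X in X * _](powRVK pn0 w0) -powRM ?powR_ge0 ?(ltW d0)//.
  rewrite mulrC ge0_ler_powR ?nnegrE ?(ltW p0) ?(ltW eps0)//.
  by rewrite mulr_ge0 ?powR_ge0 ?(ltW d0).
have hm : \sum_(g <- s) g.1 * (hn (S g.2) + d) `^ p <= (M + eps) `^ p.
  apply: (minkowski_bound p1 M0 (ltW eps0) _ _ _ (hS.2 _ hs) hd) => g.
  - by move=> /hs.1[].
  - by rewrite hn_ge0.
  - by rewrite (ltW d0).
apply: le_trans hm; rewrite /psum !big_seq; apply: ler_sum => g gs.
rewrite ler_wpM2l ?(hs.1 _ gs).1// ler_powR2 ?addr_ge0 ?hn_ge0 ?(ltW d0)//.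
by apply: hTS; apply/mapP; exists g.
Qed.

(** Jensen with the weights |<g, f_k>|^2, whose sum is at most 1 because [f] is orthonormal up to
    zeros and |g| <= 1. After exchanging the sums, the Bessel inequality of the family is applied at
    each f_k. *)
Lemma bnd_diag_fin T M (f : nat -> H) (sv : nat -> R) K : orthosystem dot f ->
  (forall k, 0 <= sv k) -> 0 <= M -> \sum_(k < K) sv k `^ p <= M `^ p ->
  (forall u, hn (T u) ^+ 2 <= \sum_(k < K) sv k ^+ 2 * cn (dot u (f k)) ^+ 2) ->
  bnd T M.
Proof.
move=> hf sv0 M0 hsv hT; split=> // s hs; apply: le_trans hsv.
have key g : g \in s -> g.1 * hn (T g.2) `^ p <=
    \sum_(k < K) sv k `^ p * (g.1 * cn (dot g.2 (f k)) ^+ 2).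
  move=> gs; have [g0 g1] := hs.1 _ gs.
  rewrite [leRHS](eq_bigr (fun k : 'I_K => g.1 * (cn (dot g.2 (f k)) ^+ 2 * (sv k ^+ 2) `^ (p / 2)))); last first.
    by move=> k _; rewrite -powR_half//; ring.
  rewrite -mulr_sumr ler_wpM2l// powR_half ?hn_ge0//.
  apply: le_trans (jensen q1 _ _ _).
  - rewrite ler_powR2 ?sqr_ge0 ?divr_gt0//.
      by apply: (le_trans (hT _)); apply: ler_sum => k _; rewrite mulrC.
    by rewrite sumr_ge0// => k _; rewrite mulr_ge0 ?sqr_ge0.
  - by move=> k _; rewrite sqr_ge0.
  - by move=> k _; rewrite sqr_ge0.
  - apply: le_trans (bessel_ineq hdot hf predT K g.2) _.
    by rewrite -(expr1n _ 2) ler_sqr ?nnegrE ?hn_ge0.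
rewrite /psum big_seq; apply: (le_trans (ler_sum _ key)); rewrite -big_seq.
rewrite exchange_big/=; apply: ler_sum => k _; rewrite -mulr_sumr.
rewrite ler_piMr ?powR_ge0//; apply: (le_trans (hs.2 _)).
by case: hf => _ /(_ k)[->|->]; rewrite ?hn0 ?expr0n ?expr1n.
Qed.

(** On any finite set of vectors [T] is dominated, up to a small error, by the diagonal operator
    with the first [K] coefficients, so lower semicontinuity reduces to the finite case. *)
Lemma bnd_diag T M (f : nat -> H) (sv : nat -> R) : orthosystem dot f ->
  (forall k, 0 <= sv k) -> 0 <= M ->
  (forall K, \sum_(k < K) sv k `^ p <= M `^ p) ->
  (forall u eps, 0 < eps -> exists K0, forall K, (K0 <= K)%N ->
    hn (T u) ^+ 2 <= \sum_(k < K) sv k ^+ 2 * cn (dot u (f k)) ^+ 2 + eps) ->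
  bnd T M.
Proof.
move=> hf sv0 M0 hsv hT; apply: bnd_lim => // us eps eps0.
have [K hK] : exists K, forall u, u \in us ->
    hn (T u) ^+ 2 <= \sum_(k < K) sv k ^+ 2 * cn (dot u (f k)) ^+ 2 + eps ^+ 2.
  have [K hK] : exists K0, forall K, (K0 <= K)%N -> forall u, u \in us ->
      hn (T u) ^+ 2 <= \sum_(k < K) sv k ^+ 2 * cn (dot u (f k)) ^+ 2 + eps ^+ 2.
    elim: us => [|u us [K1 h1]]; first by exists 0%N.
    have [K2 h2] := hT u (eps ^+ 2) (exprn_gt0 _ eps0).
    exists (K1 + K2)%N => K hK v; rewrite inE => /predU1P[->|]; first by apply: h2; lia.
    by apply: h1; lia.
  by exists K; exact: hK.
pose S u := \sum_(k < K) ((sv k)%:C%C * dot u (f k)) *: f k.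
have hS u : hn (S u) ^+ 2 = \sum_(k < K) sv k ^+ 2 * cn (dot u (f k)) ^+ 2.
  rewrite /S (hn2_sum hdot) => [|i j ij]; last by rewrite dotZl dotZr hf.1 ?mulr0.
  apply: eq_bigr => k _; rewrite hnZ cnM cnR_ge0// -exprMn.
  by case: hf => _ /(_ k)[->|->]; rewrite ?dot0r ?cn0 ?mulr0 ?hn0 ?mul0r ?mulr1.
exists S.
  by apply: (@bnd_diag_fin S M f sv K) => // u; rewrite hS.
move=> u /hK; rewrite -hS => h.
rewrite -ler_sqr ?nnegrE ?addr_ge0 ?hn_ge0 ?(ltW eps0)//.
apply: (le_trans h); rewrite sqrrD lerD2r lerDl mulrn_wge0//.
by rewrite mulr_ge0 ?hn_ge0 ?(ltW eps0).
Qed.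

Lemma bnd_orthosystem T M e K : bnd T M -> orthosystem dot e ->
  \sum_(k < K) hn (T (e k)) `^ p <= M `^ p.
Proof.
move=> [M0 h] he; have := h [seq (1, e k) | k : 'I_K <- enum 'I_K].
rewrite /psum big_map big_enum/= => {}h.
under eq_bigr do rewrite -[_ `^ _]mul1r.
apply: h; split=> [_ /mapP[k _ ->]|y] /=.
  by split=> //; case: he => _ /(_ k)[->|->]; rewrite ?hn0.
rewrite big_map big_enum/=; apply: le_trans (bessel_ineq hdot he predT K y).
by apply: ler_sum => k _; rewrite mul1r cn_dotC.
Qed.

Lemma nrmP T M : bnd T M -> bnd T (nrm T) /\ nrm T <= M.
Proof.
move=> hT; have hi : has_inf [set M | bnd T M].
  by split; [exists M|exists 0 => N []].
split; last exact: ge_inf hi.2 _ hT.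
apply: bnd_inf => [|eps eps0]; first by apply: lb_le_inf hi.1 _ => N [].
have [N hN h] := inf_adherent eps0 hi.
exact: bndW (ltW h) hN.
Qed.

Lemma nrm_ge0 T M : bnd T M -> 0 <= nrm T.
Proof. by move=> /nrmP[[]]. Qed.

(** Without such a nearly extremal family, the p-th root of nrm(T)^p - eps would be a bound below
    the infimum. *)
Lemma nrm_family T M eps : bnd T M -> 0 < eps ->
  exists2 s, bessel s & nrm T `^ p - eps <= psum T s.
Proof.
move=> hT eps0; have [h|h] := leP (nrm T `^ p - eps) 0.
  by exists [::]; [exact: bessel_nil|rewrite (le_trans h)// psum_ge0//; exact: bessel_nil].
apply: contrapT => hn; pose N := (nrm T `^ p - eps) `^ p^-1.
have hN : N `^ p = nrm T `^ p - eps by rewrite powRVK ?(ltW h).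
have : bnd T N.
  split=> [|s hs]; first exact: powR_ge0.
  by rewrite hN leNgt; apply/negP => hlt; apply: hn; exists s => //; exact: ltW.
move=> /nrmP[_]; rewrite -(ler_powR2 p0) ?powR_ge0 ?(nrm_ge0 hT)// hN.
by apply/negP; rewrite -ltNge ltrBlDr ltrDl.
Qed.

(** Nearly extremal families for the blocks [T \o Q j], moved by [Q j] and concatenated, form one
    Bessel family for [T]: the inequalities at the vectors [Q j y] add up to the one at [y]. *)
Lemma bnd_blocks_le T M n (Q : 'I_n -> H -> H) : bnd T M ->
  (forall j u y, dot (Q j u) y = dot u (Q j y)) ->
  (forall y, \sum_j hn (Q j y) ^+ 2 <= hn y ^+ 2) ->
  \sum_j nrm (T \o Q j) `^ p <= M `^ p.
Proof.
move=> hT sa hQ.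
have hQ1 j u : hn (Q j u) <= hn u.
  rewrite -ler_sqr ?nnegrE ?hn_ge0//; apply: le_trans (hQ u).
  by rewrite (bigD1 j)//= lerDl sumr_ge0// => k _; rewrite sqr_ge0.
apply/ler_addgt0Pr => eps eps0.
pose d := eps / n.+1%:R.
have d0 : 0 < d by rewrite divr_gt0.
have hb j : bnd (T \o Q j) M by exact: bnd_comp.
have /choice[s hs] : forall j, exists s, bessel s /\ nrm (T \o Q j) `^ p - d <= psum (T \o Q j) s.
  by move=> j; have [s ? ?] := nrm_family (hb j) d0; exists s.
pose F := flatten [seq [seq (g.1, Q j g.2) | g <- s j] | j : 'I_n <- enum 'I_n].
have bigF (G : R * H -> R) :
    \sum_(g <- F) G g = \sum_j \sum_(g <- s j) G (g.1, Q j g.2).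
  by rewrite big_flatten/= big_map big_enum/=; apply: eq_bigr => j _; rewrite big_map.
have bF : bessel F.
  split=> [g /flattenP[_ /mapP[j _ ->] /mapP[h hj ->]]|y] /=.
    have [h0 h1] := (hs j).1.1 _ hj.
    by split=> //; exact: le_trans (hQ1 _ _) h1.
  rewrite bigF/=; apply: le_trans (hQ y); apply: ler_sum => j _.
  by apply: le_trans ((hs j).1.2 _); apply: ler_sum => g _; rewrite sa.
have := hT.2 _ bF; rewrite /psum bigF => hF.
apply: le_trans (lerD hF (lexx eps)); rewrite -lerBlDr.
apply: le_trans (_ : \sum_j (nrm (T \o Q j) `^ p - d) <= _); last first.
  by apply: ler_sum => j _; exact: (hs j).2.
rewrite sumrB lerB// sumr_const card_ord -[leLHS]mulr_natr /d mulrAC ler_pdivrMr//.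
by rewrite ler_pM2l// ler_nat.
Qed.

(** The converse of the concatenation of families. Each test vector u is split into the normalised
    vectors Q_j u with weights |Q_j u|^2. For fixed j these form a Bessel family testing [S j]; for
    fixed u the weights have sum at most 1, so Jensen applies. *)
Lemma bnd_blocks_ge T M n (Q : 'I_n -> H -> H) (S : 'I_n -> H -> H) (N : 'I_n -> R) :
  (forall j, linear (S j)) -> (forall j, bnd (S j) (N j)) ->
  (forall j u y, dot (Q j u) y = dot u (Q j y)) ->
  (forall y, \sum_j hn (Q j y) ^+ 2 <= hn y ^+ 2) ->
  (forall u, hn (T u) ^+ 2 <= \sum_j hn (S j (Q j u)) ^+ 2) ->
  0 <= M -> \sum_j N j `^ p <= M `^ p -> bnd T M.
Proof.
move=> linS hS sa hQ hT M0 hM; split=> // s hs; apply: le_trans hM.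
have hQ1 j u : hn (Q j u) <= hn u.
  rewrite -ler_sqr ?nnegrE ?hn_ge0//; apply: le_trans (hQ u).
  by rewrite (bigD1 j)//= lerDl sumr_ge0// => k _; rewrite sqr_ge0.
pose v j u := hn (Q j u) ^+ 2.
pose dir j u := ((hn (Q j u))^-1)%:C%C *: Q j u.
pose fam j := [seq (g.1 * v j g.2, dir j g.2) | g <- s].
have dirE j u : ((hn (Q j u))%:C)%C *: dir j u = Q j u.
  rewrite /dir scalerA -rmorphM/=; have [h|h] := eqVneq (hn (Q j u)) 0.
    have /eqP -> : Q j u == 0 by rewrite -hn_eq0 h.
    by rewrite scaler0.
  by rewrite mulfV ?rmorph1 ?scale1r.
have bfam j : bessel (fam j).
  split=> [_ /mapP[g /hs.1[g0 g1] ->]|y] /=.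
    split; first by apply: mulr_ge0 => //; exact: sqr_ge0.
    rewrite /dir hnZ cnR_ge0 ?invr_ge0 ?hn_ge0//.
    have [->|h] := eqVneq (hn (Q j g.2)) 0; first by rewrite mulr0.
    by rewrite mulVf.
  rewrite big_map/=; apply: le_trans (_ : hn (Q j y) ^+ 2 <= _); last first.
    by rewrite ler_sqr ?nnegrE ?hn_ge0.
  apply: le_trans (hs.2 _); apply: ler_sum => g _.
  by rewrite -mulrA -sa -{1}dirE dotZl cnM cnR_ge0 ?hn_ge0// exprMn.
have key g : g \in s -> g.1 * hn (T g.2) `^ p <=
    \sum_j (g.1 * v j g.2) * hn (S j (dir j g.2)) `^ p.
  move=> gs; have [g0 g1] := hs.1 _ gs.
  rewrite [leRHS](eq_bigr (fun j => g.1 * (v j g.2 * (hn (S j (dir j g.2)) ^+ 2) `^ (p / 2)))); last first.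
    by move=> k _; rewrite -powR_half ?hn_ge0// mulrA.
  rewrite -mulr_sumr ler_wpM2l// powR_half ?hn_ge0//.
  apply: le_trans (jensen q1 _ _ _).
  - rewrite ler_powR2 ?sqr_ge0 ?divr_gt0//.
      apply: (le_trans (hT _)); apply: ler_sum => j _.
      by rewrite -{1}dirE linmZ// hnZ cnR_ge0 ?hn_ge0// exprMn.
    by rewrite sumr_ge0// => k _; rewrite mulr_ge0 ?sqr_ge0.
  - by move=> k _; rewrite sqr_ge0.
  - by move=> k _; rewrite sqr_ge0.
  - by apply: le_trans (hQ _) _; rewrite -(expr1n _ 2) ler_sqr ?nnegrE ?hn_ge0.
rewrite /psum big_seq; apply: (le_trans (ler_sum _ key)); rewrite -big_seq.
rewrite exchange_big/=; apply: ler_sum => j _.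
by have := (hS j).2 _ (bfam j); rewrite /psum big_map.
Qed.

(** Jensen with the weights a_j / c^2. With a_j the squared modulus of a coefficient, this bounds a
    combination of operators with orthogonal ranges by the l_2 norm of its coefficients. *)
Lemma bnd_rows T c C n (S : 'I_n -> H -> H) (a : 'I_n -> R) :
  (forall j, bnd (S j) C) -> (forall j, 0 <= a j) -> 0 <= C -> 0 <= c ->
  \sum_j a j <= c ^+ 2 ->
  (forall u, hn (T u) ^+ 2 <= \sum_j a j * hn (S j u) ^+ 2) ->
  bnd T (c * C).
Proof.
move=> hS a0 C0; rewrite le_eqVlt => /predU1P[<-|c0] ha hT.
  have a_0 j : a j = 0.
    apply/eqP; rewrite eq_le a0 andbT; move: ha; rewrite expr0n/=; apply: le_trans.
    by rewrite (bigD1 j)//= lerDl sumr_ge0.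
  rewrite mul0r; apply: bnd_le bnd0 => u; rewrite hn0.
  rewrite -ler_sqr ?nnegrE ?hn_ge0// expr0n/=; apply: (le_trans (hT u)).
  by rewrite big1// => j _; rewrite a_0 mul0r.
split=> [|s hs]; first by rewrite mulr_ge0// ltW.
have cc : 0 < c ^+ 2 by rewrite exprn_gt0.
have key g : g \in s -> g.1 * hn (T g.2) `^ p <=
    \sum_j (c `^ p * (a j / c ^+ 2)) * (g.1 * hn (S j g.2) `^ p).
  move=> gs; have [g0 g1] := hs.1 _ gs.
  rewrite [leRHS](eq_bigr (fun j => g.1 * (c `^ p * (a j / c ^+ 2 * (hn (S j g.2) ^+ 2) `^ (p / 2))))); last first.
    by move=> k _; rewrite -powR_half ?hn_ge0//; ring.
  rewrite -mulr_sumr ler_wpM2l// powR_half ?hn_ge0// -mulr_sumr.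
  apply: le_trans (ler_wpM2l (powR_ge0 _ _) (jensen q1 _ _ _)).
  - have Y0 : 0 <= \sum_j a j / c ^+ 2 * hn (S j g.2) ^+ 2.
      by rewrite sumr_ge0// => j _; rewrite mulr_ge0 ?divr_ge0 ?sqr_ge0.
    rewrite (powR_half (ltW c0)) -powRM ?sqr_ge0//.
    have pp : 0 <= p / 2 by rewrite divr_ge0 ?(ltW p0).
    have cY0 := mulr_ge0 (sqr_ge0 c) Y0.
    apply: ge0_ler_powR; rewrite ?nnegrE ?sqr_ge0//.
    apply: (le_trans (hT _)); rewrite mulr_sumr; apply: ler_sum => j _.
    by rewrite [leRHS]mulrA [c ^+ 2 * _]mulrC divfK ?gt_eqF.
  - by move=> j _; rewrite divr_ge0 ?sqr_ge0.
  - by move=> j _; rewrite sqr_ge0.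
  - by rewrite -mulr_suml ler_pdivrMr ?mul1r.
rewrite /psum big_seq; apply: (le_trans (ler_sum _ key)); rewrite -big_seq.
rewrite exchange_big/= powRM ?(ltW c0)//.
apply: le_trans (_ : \sum_j c `^ p * (a j / c ^+ 2) * C `^ p <= _).
  apply: ler_sum => j _; rewrite -mulr_sumr ler_wpM2l ?mulr_ge0 ?powR_ge0 ?divr_ge0 ?sqr_ge0//.
    by rewrite invr_ge0 sqr_ge0.
  exact: (hS j).2 _ hs.
rewrite -mulr_suml ler_wpM2r ?powR_ge0// -mulr_sumr ler_piMr ?powR_ge0//.
by rewrite -mulr_suml ler_pdivrMr ?mul1r.
Qed.

End SchattenBound.

(** * Singular value decompositions and adjoints *)

Section SingularValues.
Context {R : realType} {H : completeNormedModType R[i]}.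
Variable dot : {dot H for Num.conj}.
Hypothesis hdot : forall x : H, `|x| ^+ 2 = dot x x.
Variable p : R.
Hypothesis p2 : 2 < p.

(* Zero vectors are allowed in [e], so that finite singular value
   decompositions are covered as well. *)
Definition svd (T : H -> H) (sv : nat -> R) (e : nat -> H) : Prop :=
  [/\ orthosystem dot e, forall k, hn (T (e k)) = sv k,
      forall k x, dot (T (e k)) (T x) = (sv k ^+ 2)%:C%C * dot (e k) x &
      forall x, (forall k, dot x (e k) = 0) -> T x = 0].

Variables (T : H -> H) (sv : nat -> R) (e : nat -> H) (C : R).
Hypotheses (linT : linear T) (bT : forall u, hn (T u) <= C * hn u).
Hypothesis hsvd : svd T sv e.

Let he : orthosystem dot e. Proof. by case: hsvd. Qed.
Let hsv k : hn (T (e k)) = sv k. Proof. by case: hsvd. Qed.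
Let hTe k x : dot (T (e k)) (T x) = (sv k ^+ 2)%:C%C * dot (e k) x.
Proof. by case: hsvd. Qed.
Let sv0 k : 0 <= sv k. Proof. by rewrite -hsv hn_ge0. Qed.

(** The partial projections of [u] converge to some v, and u - v is orthogonal to every e_k; the
    last clause of [svd] then gives T u = T v. *)
Lemma svd_approx u eps : 0 < eps -> exists K0, forall K, (K0 <= K)%N ->
  hn (T (u - oproj dot e predT K u)) <= eps.
Proof.
move=> eps0; have [v hv] := proj_cauchy hdot he u.
have uv : T (u - v) = 0.
  case: hsvd => _ _ _; apply => k; apply/eqP; rewrite -cn_eq0 eq_le cn_ge0 andbT.
  apply/ler_addgt0Pr => d d0; rewrite add0r; have [N hN] := hv d d0.
  have -> : dot (u - v) (e k) = dot (oproj dot e predT (N + k.+1) u - v) (e k).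
    by rewrite !dotBl (dot_proj hdot he) ifT// addnS ltnS leq_addl.
  apply: (le_trans (cauchy_schwarz hdot _ _)).
  apply: le_trans (hN (N + k.+1)%N (leq_addr _ _)).
  by rewrite ler_piMr ?hn_ge0//; case: he => _ /(_ k)[->|->]; rewrite ?hn0.
have [N hN] := hv (eps / (`|C| + 1)) (divr_gt0 eps0 (ltr_wpDl (normr_ge0 C) ltr01)).
exists N => K NK.
have -> : T (u - oproj dot e predT K u) = T (v - oproj dot e predT K u).
  by rewrite -(subrK v u) -addrA (linmD linT) uv add0r subrK.
apply: (le_trans (bT _)); apply: le_trans (_ : (`|C| + 1) * (eps / (`|C| + 1)) <= _).
  apply: le_trans (_ : (`|C| + 1) * hn (v - oproj dot e predT K u) <= _).
    by rewrite ler_wpM2r ?hn_ge0// (le_trans (ler_norm C))// lerDl.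
  by rewrite ler_wpM2l ?addr_ge0// hnBC hN.
by rewrite mulrC divfK// gt_eqF// ltr_wpDl.
Qed.

Lemma hn_proj_svd u K : hn (T (oproj dot e predT K u)) ^+ 2 =
  \sum_(k < K) sv k ^+ 2 * cn (dot u (e k)) ^+ 2.
Proof.
rewrite /oproj (linm_sum linT) (hn2_sum hdot) => [|i j ij].
  by apply: eq_bigr => k _; rewrite (linmZ linT) hnZ hsv exprMn mulrC.
by rewrite !(linmZ linT) dotZl dotZr hTe he.1// !mulr0.
Qed.

Lemma svd_pyth u K : hn (T u) ^+ 2 = \sum_(k < K) sv k ^+ 2 * cn (dot u (e k)) ^+ 2
  + hn (T (u - oproj dot e predT K u)) ^+ 2.
Proof.
rewrite -hn_proj_svd -(pyth hdot) -?(linmD linT) ?(addrC (oproj _ _ _ _ _)) ?subrK//.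
rewrite {1}/oproj (linm_sum linT) dot_suml big1// => k _.
rewrite (linmZ linT) dotZl hTe (dotC _ (_ - _)) dotBl (dot_proj hdot he) ltn_ord subrr.
by rewrite conjC0 !mulr0.
Qed.

Lemma svd_bnd M : 0 <= M -> (forall K, \sum_(k < K) sv k `^ p <= M `^ p) ->
  bnd dot p T M.
Proof.
move=> M0 hM; apply: (bnd_diag hdot p2 he sv0 M0 hM) => u eps eps0.
have e0 : 0 < Num.sqrt eps by rewrite sqrtr_gt0.
have [K0 hK0] := svd_approx u e0.
exists K0 => K /hK0 h; rewrite (svd_pyth u K) lerD2l.
by rewrite -[leRHS](sqr_sqrtr (ltW eps0)) ler_sqr ?nnegrE ?hn_ge0 ?sqrtr_ge0.
Qed.

Lemma bnd_svd M K : bnd dot p T M -> \sum_(k < K) sv k `^ p <= M `^ p.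
Proof.
move=> hT; have := bnd_orthosystem hdot K hT he.
by under eq_bigr do rewrite hsv.
Qed.

(** The vectors f_k = T e_k / s_k form an orthosystem with <S u, e_k> = s_k <u, f_k>, so the adjoint
    is diagonal with the same singular values. *)
Lemma bnd_adj S M : (forall x y, dot (T x) y = dot x (S y)) ->
  bnd dot p T M -> bnd dot p S M.
Proof.
move=> hS hT.
pose f k := ((sv k)^-1)%:C%C *: T (e k).
have fE k : (sv k)%:C%C *: f k = T (e k).
  rewrite /f scalerA -rmorphM/=; have [h|h] := eqVneq (sv k) 0.
    by have /eqP -> : T (e k) == 0; rewrite ?scaler0// -hn_eq0 hsv h.
  by rewrite mulfV ?rmorph1 ?scale1r.
have hf : orthosystem dot f.
  split=> [i j ij|k].
    by rewrite /f dotZl dotZr hTe he.1// !mulr0.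
  have [h|h] := eqVneq (sv k) 0; first by left; rewrite /f h invr0 scale0r.
  by right; rewrite /f hnZ cnR_ge0 ?invr_ge0// hsv mulVf.
apply: (bnd_diag hdot p2 hf sv0 hT.1) => [K|u eps eps0]; first exact: bnd_svd.
set v := S u.
have [K0 hK0] := svd_approx v (divr_gt0 eps0 (ltr_wpDl (hn_ge0 u) ltr01)).
exists K0 => K /hK0 h.
have -> : \sum_(k < K) sv k ^+ 2 * cn (dot u (f k)) ^+ 2 = hn (oproj dot e predT K v) ^+ 2.
  rewrite hn2_proj//; apply: eq_bigr => k _; rewrite (cn_dotC _ v) -hS -fE dotZl.
  by rewrite cnM cnR_ge0// exprMn (cn_dotC _ u).
(* Here |S u|^2 = <T v, u> with v = S u. The projected part of v contributes exactly its squared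
   norm, and the residual part is small by the choice of [K0]. *)
have e1 : (hn v ^+ 2)%:C%C = dot (T (oproj dot e predT K v)) u + dot (T (v - oproj dot e predT K v)) u :> R[i].
  by rewrite -dotDl -(linmD linT) (addrC (oproj _ _ _ _ _)) subrK -(dotxx hdot) hS.
have e2 : dot (T (oproj dot e predT K v)) u = (hn (oproj dot e predT K v) ^+ 2)%:C%C.
  by rewrite hS -/v -(dotxx hdot) -{1}(proj_idem hdot he) proj_dot.
have := congr1 (@complex.Re R) e1; rewrite e2 /= => ->.
have -> : forall a b : R[i], complex.Re (a + b) = complex.Re a + complex.Re b.
  by move=> [a1 a2] [b1 b2].
rewrite /= lerD2l (le_trans (Re_le_cn _))//.
apply: (le_trans (cauchy_schwarz hdot _ _)).
apply: (le_trans (ler_wpM2r (hn_ge0 u) h)).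
by rewrite mulrAC ler_pdivrMr ?ltr_wpDl ?hn_ge0// ler_pM2l// lerDl.
Qed.

End SingularValues.

(** * Matrices as operators *)

Section MatrixOperators.
Context {R : realType} {H : completeNormedModType R[i]}.
Variable dot : {dot H for Num.conj}.
Hypothesis hdot : forall x : H, `|x| ^+ 2 = dot x x.
Variable p : R.
Hypothesis p2 : 2 < p.
Variable b : nat -> H.
Hypothesis hb : forall i j, dot (b i) (b j) = (i == j)%:R.

Local Open Scope sesquilinear_scope.

Lemma orthosystem_basis : orthosystem dot b.
Proof.
split=> [i j ij|i]; first by rewrite hb (negbTE ij).
right; apply/eqP; rewrite -(@eqrXn2 _ 2) ?hn_ge0// expr1n.
by rewrite -(inj_eq (@complexI R)) -(dotxx hdot) hb eqxx.
Qed.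

Lemma hn_basis i : hn (b i) = 1.
Proof.
case: orthosystem_basis => _ /(_ i)[h|//].
by have := hb i i; rewrite eqxx h dot0l => /eqP; rewrite eq_sym oner_eq0.
Qed.

Definition coords n (x : H) : 'cV[R[i]]_n := \col_j dot x (b j).
Definition vec n (c : 'cV[R[i]]_n) : H := \sum_(i < n) c i 0 *: b i.
(** Places a matrix in the upper left corner of an operator on [H], so that norms of matrices can be
    estimated by [bnd]. *)
Definition op n (A : 'M[R[i]]_n) (x : H) : H := vec (A *m coords n x).
Definition mxof n (T : H -> H) : 'M[R[i]]_n := \matrix_(i, j) dot (T (b j)) (b i).

Lemma dot_basis_vec n (c : 'cV[R[i]]_n) (j : 'I_n) : dot (vec c) (b j) = c j 0.
Proof.
rewrite /vec dot_suml (bigD1 j)//= dotZl hb eqxx mulr1 big1 ?addr0// => i ij.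
rewrite dotZl hb; have -> : (i == j :> nat) = false by apply/negbTE.
by rewrite mulr0.
Qed.

Lemma coords_vec n (c : 'cV[R[i]]_n) : coords n (vec c) = c.
Proof. by apply/colP => j; rewrite mxE dot_basis_vec. Qed.

Lemma dot_vec n (c : 'cV[R[i]]_n) x : dot (vec c) x = ((coords n x)^t* *m c) 0 0.
Proof.
rewrite /vec dot_suml !mxE; apply: eq_bigr => i _.
by rewrite dotZl !mxE mulrC dotC.
Qed.

Lemma coords_lin n : linear (coords n).
Proof. by move=> a x y; apply/colP => j; rewrite !mxE dotDl dotZl. Qed.

Lemma vec_lin n : linear (@vec n).
Proof.
move=> a c d; rewrite /vec scaler_sumr -big_split; apply: eq_bigr => i _.
by rewrite !mxE scalerDl scalerA.
Qed.

Lemma op_lin n (A : 'M[R[i]]_n) : linear (op A).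
Proof.
by move=> a x y; rewrite /op coords_lin mulmxDr -scalemxAr vec_lin.
Qed.

Lemma adjmxM m n k (A : 'M[R[i]]_(m, n)) (B : 'M[R[i]]_(n, k)) :
  (A *m B)^t* = B^t* *m A^t*.
Proof. by rewrite trmx_mul map_mxM. Qed.

Lemma op_adj n (A : 'M[R[i]]_n) x y : dot (op A x) y = dot x (op (A^t*) y).
Proof.
rewrite (dotC _ (op _ _) x) !dot_vec.
set M := _ *m (_ *m coords n y).
have -> : Num.conj (M 0 0) = (M^t*) 0 0 by rewrite !mxE.
by rewrite /M !adjmxM !trmxCK mulmxA.
Qed.

Lemma op_bnd n (A : 'M[R[i]]_n) :
  bnd dot p (op A) (\sum_(i < n) \sum_(j < n) cn (A i j)).
Proof.
have h : bnd dot p (fun x => \sum_(i < n) \sum_(j < n) (A i j * dot x (b j)) *: b i)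
    (\sum_(i < n) \sum_(j < n) cn (A i j)).
  apply: (bnd_sum p2) => i _; apply: (bnd_sum p2) => j _.
  rewrite -[cn _]mul1r -(hn_basis j); apply: (bnd_rank1 hdot p2) => [|u].
    exact: cn_ge0.
  by rewrite hnZ hn_basis mulr1 cnM mulrC.
apply: (eq_bnd p2 _ h) => x; rewrite /op /vec; apply: eq_bigr => i _.
by rewrite !mxE scaler_suml; apply: eq_bigr => j _; rewrite !mxE.
Qed.

Lemma op_bounded n (A : 'M[R[i]]_n) : exists C, forall u, hn (op A u) <= C * hn u.
Proof.
by exists (\sum_(i < n) \sum_(j < n) cn (A i j)) => u; apply: (bnd_op hdot p2 _ (op_lin A) (op_bnd A)).
Qed.

Lemma proj_vec n x : oproj dot b predT n x = vec (coords n x).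
Proof. by apply: eq_bigr => i _; rewrite mxE. Qed.

Lemma op_mxof n (T : H -> H) : linear T ->
  op (mxof n T) =1 (fun x => oproj dot b predT n (T (oproj dot b predT n x))).
Proof.
move=> linT x; rewrite (proj_vec n (T _)) /op; congr vec; apply/colP => i.
rewrite !mxE /oproj (linm_sum linT) dot_suml; apply: eq_bigr => j _.
by rewrite !mxE (linmZ linT) dotZl mulrC.
Qed.

Definition op_sv n (A : 'M[R[i]]_n) (k : nat) : R :=
  if insub k is Some i then mx_singular_value A i else 0.

(** The right singular vectors are the columns of [U^t*], where [U] diagonalises the normal matrix
    A^* A; from index [n] on, vectors and singular values are continued by zero. *)
Lemma op_svd n (A : 'M[R[i]]_n) : exists e, svd dot (op A) (op_sv A) e.
Proof.
pose D := A^t* *m A; pose U := spectralmx D; pose d := spectral_diag D.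
have hD : D \is normalmx.
  by apply/normalmxP; rewrite /D !adjmxM trmxCK.
have UU : U \is unitarymx by exact: spectral_unitarymx.
have DE : D *m U^t* = U^t* *m diag_mx d.
  have /orthomx_spectralP := hD; rewrite -/U -/d => {1}->.
  rewrite invmx_unitary// -!mulmxA.
  by have /unitarymxP -> := UU; rewrite mulmx1.
pose e k := if insub k is Some i then vec (col (i : 'I_n) (U^t*)) else 0.
have dot_op x y : dot (op A x) (op A y) = ((coords n y)^t* *m D *m coords n x) 0 0.
  by rewrite /op dot_vec coords_vec adjmxM !mulmxA.
have eE (i : 'I_n) : e i = vec (col i (U^t*)) by rewrite /e valK.
have dot_ex (i : 'I_n) x : dot (e i) x = ((coords n x)^t* *m col i (U^t*)) 0 0.
  by rewrite eE dot_vec.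
have Dcol (i : 'I_n) : D *m col i (U^t*) = d 0 i *: col i (U^t*).
  rewrite [in LHS]colE mulmxA DE -colE; apply/colP => k.
    by rewrite mul_mx_diag !mxE mulrC.
have he2 (i : 'I_n) x : dot (op A (e i)) (op A x) = d 0 i * dot (e i) x.
  rewrite dot_op dot_ex eE coords_vec -mulmxA Dcol -scalemxAr.
  by rewrite mxE.
have ortho_e (i j : 'I_n) : dot (e i) (e j) = (i == j)%:R.
  rewrite dot_ex eE coords_vec.
  have -> : (col j (U^t*))^t* = row j U.
    by apply/rowP => k; rewrite !mxE conjCK.
  rewrite colE mulmxA -row_mul.
  have /unitarymxP -> := UU.
  by rewrite -colE !mxE eq_sym.
have he : orthosystem dot e.
  split=> [i j ij|i]; rewrite /e.
    case: insubP => [i' _ ii|_]; last by rewrite dot0l.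
    case: insubP => [j' _ jj|_]; last by rewrite dot0r.
    rewrite -!eE ortho_e; case: eqP => // h; move: ij.
    by rewrite -ii -jj h eqxx.
  case: insubP => [i' _ ii|_]; last by left.
  right; apply/eqP; rewrite -(@eqrXn2 _ 2) ?hn_ge0// expr1n.
  by rewrite -(inj_eq (@complexI R)) -(dotxx hdot) -eE ortho_e eqxx.
have dE (i : 'I_n) : d 0 i = (hn (op A (e i)) ^+ 2)%:C%C.
  by rewrite -(dotxx hdot) he2 ortho_e eqxx mulr1.
have svE (i : 'I_n) : op_sv A i = hn (op A (e i)).
  by rewrite /op_sv valK /mx_singular_value -/D -/d dE/= sqrtr_sqr ger0_norm ?hn_ge0.
exists e; split=> // [k|k x|x hx].
- have [kn|kn] := ltnP k n; first by rewrite (svE (Ordinal kn)).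
  by rewrite /e /op_sv insubN -?leqNgt// (linm0 (op_lin A)) hn0.
- have [kn|kn] := ltnP k n; first by rewrite (svE (Ordinal kn)) -dE -(he2 (Ordinal kn)).
  by rewrite /e insubN -?leqNgt// (linm0 (op_lin A)) !dot0l mulr0.
- suff h : coords n x = 0 by rewrite /op h mulmx0 (linm0 (@vec_lin n)).
  have Ux : U *m coords n x = 0.
    apply/colP => i; rewrite !mxE; have := hx i; rewrite (dotC _ (e i)) dot_ex => /eqP.
    rewrite conjC_eq0 => /eqP/(congr1 Num.conj); rewrite conjC0 !mxE => h.
    rewrite -[RHS]h rmorph_sum; apply: eq_bigr => j _.
    by rewrite !mxE rmorphM/= !conjCK mulrC.
  have /unitarymx_unit Uu := UU.
  by rewrite -[coords n x](mulKmx Uu) Ux mulmx0.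
Qed.

Lemma cpn_normE n (A : 'M[R[i]]_n) :
  cpn_norm p A = (\sum_(k < n) op_sv A k `^ p) `^ p^-1.
Proof.
by rewrite /cpn_norm; congr (_ `^ _); apply: eq_bigr => i _; rewrite /op_sv valK.
Qed.

Let p0 : 0 < p. Proof. by apply: lt_trans p2. Qed.
Let pn0 : p != 0. Proof. by rewrite gt_eqF. Qed.

Lemma cpn_norm_ge0 n (A : 'M[R[i]]_n) : 0 <= cpn_norm p A.
Proof. exact: powR_ge0. Qed.

Lemma cpn_norm_bnd n (A : 'M[R[i]]_n) : bnd dot p (op A) (cpn_norm p A).
Proof.
have [e he] := op_svd A; have [C hC] := op_bounded A.
have op0 k : 0 <= op_sv A k by case: he => _ <- _ _; rewrite hn_ge0.
apply: (svd_bnd hdot p2 (op_lin A) hC he (cpn_norm_ge0 A)) => K.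
rewrite cpn_normE powRVK ?sumr_ge0// => [|k _]; last exact: powR_ge0.
rewrite -2!(big_mkord predT (fun k => op_sv A k `^ p)).
have [nK|/ltnW Kn] := leqP n K; last first.
  rewrite [leRHS](big_cat_nat _ (n := K))//= lerDl sumr_ge0// => k _.
  exact: powR_ge0.
rewrite [leLHS](big_cat_nat _ (n := n))//= gerDl big_nat big1// => k /andP[nk _].
by rewrite /op_sv insubN -?leqNgt// powR0.
Qed.

Lemma cpn_norm_le n (A : 'M[R[i]]_n) M : bnd dot p (op A) M -> cpn_norm p A <= M.
Proof.
move=> hM; have [e he] := op_svd A.
rewrite -(ler_powR2 p0) ?cpn_norm_ge0 ?hM.1// cpn_normE powRVK ?sumr_ge0//.
  exact: (bnd_svd hdot he).
by move=> k _; exact: powR_ge0.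
Qed.

Lemma cpn_norm_nrm n (A : 'M[R[i]]_n) : cpn_norm p A = nrm dot p (op A).
Proof.
have [h1 h2] := nrmP p2 (cpn_norm_bnd A).
by apply/eqP; rewrite eq_le h2 andbT cpn_norm_le.
Qed.

Lemma op_adj_bnd n (A : 'M[R[i]]_n) M : bnd dot p (op A) M -> bnd dot p (op (A^t*)) M.
Proof.
have [e he] := op_svd A; have [C hC] := op_bounded A.
exact: (bnd_adj hdot p2 (op_lin A) hC he (op_adj A)).
Qed.

End MatrixOperators.

(** * l_p norms through partial sums *)

Section LpNorm.
Context {R : realType}.

Lemma lp_norm_le (p : R) (a : nat -> R) (M : R) : 0 < p -> 0 <= M ->
  (lp_norm p a <= M%:E)%E <->
  (forall K, \sum_(k < K) `|a k| `^ p <= M `^ p).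
Proof.
move=> p0 M0; have pn0 : p != 0 by rewrite gt_eqF.
rewrite /lp_norm Lnorm_counting//.
rewrite (eq_eseriesr (g := fun k => (`|a k| `^ p)%:E)) => [|k _]; last by [].
set S := (\sum_(_ <oo) _)%E.
have part K : (\sum_(0 <= k < K) (`|a k| `^ p)%:E)%E = (\sum_(k < K) `|a k| `^ p)%:E.
  by rewrite big_mkord sumEFin.
have S0 : (0 <= S)%E by apply: nneseries_ge0 => n _ _; rewrite lee_fin powR_ge0.
have SK K : ((\sum_(k < K) `|a k| `^ p)%:E <= S)%E.
  by rewrite -part; apply: nneseries_lim_ge => n _ _; rewrite lee_fin powR_ge0.
have key : (S `^ p^-1 <= M%:E)%E <-> (S <= (M `^ p)%:E)%E.
  move: S S0 {SK} => [r| |] // r0.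
  - rewrite poweR_EFin !lee_fin; rewrite lee_fin in r0.
    by rewrite -{2}(powRVK pn0 r0) ler_powR2 ?powR_ge0.
  - by rewrite poweRyr ?invr_neq0// !leye_eq.
rewrite key; split=> [h K|h].
  by rewrite -lee_fin; apply: le_trans (SK K) h.
apply: lime_le; first by apply: is_cvg_nneseries => n _ _; rewrite lee_fin powR_ge0.
by apply: nearW => K; rewrite part lee_fin.
Qed.

Lemma lp_norm_ge0 (p : R) (a : nat -> R) : (0 <= lp_norm p a)%E.
Proof. exact: Lnorm_ge0. Qed.

Lemma ereal_fin_bounds (x : \bar R) (Q : R -> Prop) r : (0 <= x)%E ->
  (forall M, 0 <= M -> (x <= M%:E)%E <-> Q M) -> 0 <= r -> Q r ->
  (forall M, Q M -> r <= M) -> x = r%:E.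
Proof.
move=> x0 h r0 Qr hr; have xr : (x <= r%:E)%E by apply/h.
move: x x0 h xr => [x| |]// x0 h xr; congr EFin; apply/eqP.
by rewrite eq_le -lee_fin xr/=; apply/hr/h.
Qed.

End LpNorm.

Section DependentChoice.

(** The predicate sees the list of all earlier choices, so that a new vector can be required to be
    orthogonal to each of them. *)
Lemma dependent_choice (T : Type) (Q : seq T -> T -> Prop) :
  (forall s, exists x, Q s x) -> exists b : nat -> T, forall n, Q (mkseq b n) (b n).
Proof.
move=> /choice[f hf].
pose l := fix l n := if n is m.+1 then rcons (l m) (f (l m)) else [::].
exists (fun n => f (l n)) => n.
suff -> : mkseq (fun n => f (l n)) n = l n by [].
by elim: n => [//|n IH]; rewrite mkseqS IH.
Qed.

End DependentChoice.

(** * Compact operators *)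

Section Topology.
Context {R : realType} {H : completeNormedModType R[i]}.
Implicit Types (x y z : H) (T : H -> H).

Lemma nbhs_hn z eps : 0 < eps -> nbhs z [set y | hn (y - z) < eps].
Proof.
move=> e0; have e0C : 0 < eps%:C%C :> R[i] by rewrite -(rmorph0 (real_complex R)) ltcR.
apply: filterS (nbhsx_ballx z _ e0C) => y.
by rewrite -ball_normE/= hnE ltcR hnBC.
Qed.

Lemma nbhs_hnP z (A : set H) : nbhs z A ->
  exists2 eps, 0 < eps & forall y, hn (y - z) < eps -> A y.
Proof.
move=> /nbhs_ballP[e e0 h].
have eE : e = (complex.Re e)%:C%C by rewrite RRe_real// gtr0_real.
exists (complex.Re e) => [|y hy]; first by rewrite -ltcR -eE.
by apply: h; rewrite -ball_normE/= hnE eE ltcR hnBC.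
Qed.

Lemma closure_hn (A : set H) y eps : closure A y -> 0 < eps ->
  exists2 x, A x & hn (x - y) < eps.
Proof. by move=> h /(nbhs_hn y)/h[x [? ?]]; exists x. Qed.

(** Compactness through cluster points of the images; no subsequence has to be named. *)
Definition seqcompact T := forall x : nat -> H, (forall n, hn (x n) <= 1) ->
  exists z, forall eps N, 0 < eps -> exists2 n, (N <= n)%N & hn (T (x n) - z) < eps.

Lemma precompact_seqcompact T : precompact (T @` [set x | `|x| <= 1]) -> seqcompact T.
Proof.
rewrite precompactE => hT x hx.
have [|z [_ hz]] := hT ((fun n => T (x n)) @ \oo) _.
  exists 0%N => // n _; apply: subset_closure; exists (x n) => //=.
  by rewrite hnE -(rmorph1 (real_complex R)) lecR.
exists z => eps N eps0.
have [|_ [[n Nn <-] hn]] := hz ((fun n => T (x n)) @` [set n | (N <= n)%N])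
   [set y | hn (y - z) < eps] _ (nbhs_hn z eps0).
  by exists N => // n Nn; exists n.
by exists n.
Qed.

(** An unbounded [T] would have vectors x_n of the unit ball with |T x_n| >= n, and such images have
    no cluster point. *)
Lemma seqcompact_bounded T : linear T -> seqcompact T ->
  exists2 C, 0 <= C & forall u, hn (T u) <= C * hn u.
Proof.
move=> linT hT; apply: contrapT => hn_.
have /choice[x hx] : forall n : nat, exists u : H, hn u <= 1 /\ n%:R <= hn (T u).
  move=> n; apply: contrapT => h; apply: hn_; exists n%:R => // u.
  have [->|u0] := eqVneq u 0; first by rewrite (linm0 linT) !hn0 mulr0.
  have hu : 0 < hn u by rewrite lt_def hn_eq0 u0 hn_ge0.
  rewrite leNgt; apply/negP => hlt; apply: h.
  exists ((hn u)^-1%:C%C *: u); rewrite (linmZ linT) !hnZ cnR_ge0 ?invr_ge0 ?hn_ge0//.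
  by rewrite mulVf ?gt_eqF//; split=> //; rewrite mulrC ler_pdivlMr// ltW.
have [z hz] := hT x (fun n => (hx n).1).
have [n Nn hn1] := hz 1 (Num.truncn (hn z + 1)).+1 ltr01.
have := (hx n).2; apply/negP; rewrite -ltNge.
have -> : T (x n) = (T (x n) - z) + z by rewrite subrK.
apply: (le_lt_trans (hnD _ _)); apply: lt_le_trans (_ : 1 + hn z <= _).
  by rewrite ltrD2r.
rewrite addrC; apply: (le_trans (ltW (truncnS_gt _))).
by rewrite ler_nat.
Qed.

(* Points of an ultrafilter on the closure of [T @` ball] are moved into the
   compact sets given by the approximating operators, where they cluster. *)
Lemma precompact_lim T :
  (forall eps, 0 < eps -> exists2 S, precompact (S @` [set x | `|x| <= 1]) &
     forall u, hn u <= 1 -> hn (T u - S u) <= eps) ->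
  precompact (T @` [set x | `|x| <= 1]).
Proof.
move=> hT; rewrite precompactE compact_ultra => G GU GA.
have cG : cauchy_ex G.
  move=> E E0.
  have eE : E = (complex.Re E)%:C%C by rewrite RRe_real// gtr0_real.
  (* Points are moved by at most [2 * d], and the moved points lie within [d] of the cluster point;
     the total [3 * d] is below the radius. *)
  pose d := complex.Re E / 4.
  have e0 : 0 < complex.Re E by rewrite -ltcR -eE.
  have d0 : 0 < d by rewrite divr_gt0.
  have [S hS hTS] := hT d d0.
  rewrite precompactE in hS; set K := closure (S @` _) in hS.
  have /choice[phi hphi] : forall y, exists k, closure (T @` [set x | `|x| <= 1]) y ->
      K k /\ hn (k - y) <= 2 * d.
    move=> y; have [cy|ncy] := pselect (closure (T @` [set x | `|x| <= 1]) y); last by exists y.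
    have [_ [u u1 <-] hu] := closure_hn cy d0.
    exists (S u) => _; split; first by apply: subset_closure; exists u.
    have -> : S u - y = (T u - y) - (T u - S u) by rewrite opprB [RHS]addrC addrA subrK.
    apply: (le_trans (hnB _ _)); rewrite mulr_natl mulr2n lerD ?(ltW hu)//.
    by apply: hTS; have := u1; rewrite /= hnE -(rmorph1 (real_complex R)) lecR.
  have GK : G (phi @^-1` K) by apply: filterS GA => y hy; exact: (hphi y hy).1.
  have [z [_ hz]] := hS (phi @ G) _ GK.
  exists z; pose B := [set y | hn (phi y - z) < d].
  have GB : G B.
    have [//|GnB] := in_ultra_setVsetC B GU.
    have : (phi @ G) (~` [set k | hn (k - z) < d]) by [].
    by move=> /hz/(_ (nbhs_hn z d0))[k [? ?]].
  apply: filterS (filterI GA GB) => y [/hphi[_ h1] h2].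
  rewrite -ball_normE/= hnE eE ltcR.
  have -> : z - y = (phi y - y) - (phi y - z) by rewrite opprB [RHS]addrC addrA subrK.
  apply: (le_lt_trans (hnB _ _)); apply: (lt_trans (ler_ltD h1 h2)).
  by rewrite /d; lra.
have /cauchy_cvgP cvG : cauchy G by exact: cauchy_exP.
exists (lim G); split=> //.
apply: (@closed_cvg _ _ G _ id (closure (T @` [set x | `|x| <= 1]))) => //.
exact: closed_closure.
Qed.

End Topology.

(** * Orthonormal sequences and bases *)

Section OrthonormalSequences.
Context {R : realType} {H : completeNormedModType R[i]}.
Variable dot : {dot H for Num.conj}.
Hypothesis sepH : separable_infdim_hilbert dot.
Implicit Types (x y z : H) (s : seq H).

Lemma hilbert_dot x : `|x| ^+ 2 = dot x x.
Proof. by case: sepH. Qed.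
Local Notation hdot := hilbert_dot.

Definition orthonormal_list s : Prop := forall i j,
  (i < size s)%N -> (j < size s)%N -> dot s`_i s`_j = (i == j)%:R.

Definition span_proj s x : H := \sum_(i < size s) dot x s`_i *: s`_i.

Lemma hn_eq1 x : dot x x = 1 -> hn x = 1.
Proof.
move=> h; apply/eqP; rewrite -(@eqrXn2 _ 2) ?hn_ge0// expr1n.
by rewrite -(inj_eq (@complexI R)) -(dotxx hdot) h.
Qed.

Lemma orthonormal_listW s : orthonormal_list s -> orthosystem dot (nth 0 s).
Proof.
move=> hs; split=> [i j ij|i].
  have [js|js] := ltnP j (size s); last by rewrite [s`_j]nth_default// dot0r.
  have [is_|is_] := ltnP i (size s); last by rewrite [s`_i]nth_default// dot0l.
  by rewrite hs// (negbTE ij).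
have [is_|is_] := ltnP i (size s); last by left; rewrite nth_default.
by right; apply: hn_eq1; rewrite hs// eqxx.
Qed.

Lemma span_projE s : span_proj s =1 oproj dot (nth 0 s) predT (size s).
Proof. by []. Qed.

Lemma dot_residual s x i : orthonormal_list s -> (i < size s)%N ->
  dot (x - span_proj s x) s`_i = 0.
Proof.
move=> hs si; rewrite dotBl span_projE (dot_proj hdot (orthonormal_listW hs)).
by rewrite si subrr.
Qed.

Lemma hn_residual s x : orthonormal_list s -> hn (x - span_proj s x) <= hn x.
Proof.
by move=> hs; rewrite span_projE; exact: (hn_subproj hdot (orthonormal_listW hs)).
Qed.

Lemma not_span s : exists x, x - span_proj s x != 0.
Proof.
case: sepH => _ _ hinf; apply: contrapT => h; apply: hinf.
exists s => x; exists (fun i => dot x s`_i); apply/eqP; rewrite -subr_eq0.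
by apply: contrapT => /negP h'; apply: h; exists x.
Qed.

Definition normalize x := (hn x)^-1%:C%C *: x.

Lemma hn_normalize x : x != 0 -> hn (normalize x) = 1.
Proof.
move=> x0; rewrite /normalize hnZ cnR_ge0 ?invr_ge0 ?hn_ge0//.
by rewrite mulVf// hn_eq0.
Qed.

Lemma unit_orth s : orthonormal_list s ->
  exists x, hn x = 1 /\ forall i, (i < size s)%N -> dot x s`_i = 0.
Proof.
move=> hs; have [x hx] := not_span s; exists (normalize (x - span_proj s x)).
by split=> [|i si]; [exact: hn_normalize|rewrite dotZl dot_residual ?mulr0].
Qed.

(** The recursion common to Gram-Schmidt and to the successive choice of singular vectors; [Q] is
    the rule that selects the next vector from the earlier ones. *)
Lemma orthonormal_seq (Q : seq H -> H -> Prop) :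
  (forall s, orthonormal_list s -> exists x,
     [/\ hn x = 1, forall i, (i < size s)%N -> dot x s`_i = 0 & Q s x]) ->
  exists b : nat -> H, (forall i j, dot (b i) (b j) = (i == j)%:R) /\
    forall n, Q (mkseq b n) (b n).
Proof.
move=> hQ.
have [s|b hb] := @dependent_choice _ (fun s x => orthonormal_list s ->
    [/\ hn x = 1, forall i, (i < size s)%N -> dot x s`_i = 0 & Q s x]).
  by have [/hQ[x hx]|hs] := pselect (orthonormal_list s); [exists x|exists 0].
have ons n : orthonormal_list (mkseq b n).
  elim: n => [//|n IH] i j; rewrite !size_mkseq !ltnS => iN jN.
  have [hn1 horth _] := hb n IH.
  have horth' k : (k < n)%N -> dot (b n) (b k) = 0.
    by move=> kn; have := horth k; rewrite size_mkseq nth_mkseq//; exact.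
  rewrite !nth_mkseq ?ltnS//; move: iN jN; rewrite leq_eqVlt => /predU1P[->|iN].
    rewrite leq_eqVlt => /predU1P[->|jN].
      by rewrite eqxx (dotxx hdot) hn1 expr1n.
    by rewrite horth'// eq_sym ltn_eqF.
  rewrite leq_eqVlt => /predU1P[->|jN].
    by rewrite (dotC0 (horth' _ iN)) ltn_eqF.
  by have := IH i j; rewrite size_mkseq !nth_mkseq//; exact.
exists b; split=> [i j|n]; last by have [] := hb n (ons n).
have := ons (maxn i j).+1 i j.
by rewrite size_mkseq !ltnS !nth_mkseq ?ltnS ?leq_maxl ?leq_maxr//; exact.
Qed.

Lemma exists_least (P : nat -> Prop) : (exists n, P n) ->
  exists2 n, P n & forall m, (m < n)%N -> ~ P m.
Proof.
move=> [n Pn]; have ex : exists n, `[<P n>] by exists n; apply/asboolP.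
case: (ex_minnP ex) => m /asboolP Pm hm; exists m => // k km /asboolP /hm.
by rewrite leqNgt km.
Qed.

Lemma span_proj_mkseq (b : nat -> H) n x :
  span_proj (mkseq b n) x = oproj dot b predT n x.
Proof.
rewrite /span_proj /oproj size_mkseq; apply: eq_bigr => i _.
by rewrite nth_mkseq.
Qed.

(** Gram-Schmidt along a dense sequence [d]: each step normalises the residual of the first d_k
    outside the current span. Then d_0, ..., d_(n-1) lie in the span of the first n vectors, and
    density gives completeness. *)
Lemma exists_basis : exists b : nat -> H,
  (forall i j, dot (b i) (b j) = (i == j)%:R) /\
  forall x eps, 0 < eps -> exists N, forall n, (N <= n)%N ->
    hn (x - oproj dot b predT n x) <= eps.
Proof.
case: (sepH) => _ [D cD dD] _.
have [d hd] : exists d : nat -> H, forall x eps, 0 < eps ->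
    exists k, hn (d k - x) < eps.
  move/countable_injP : cD => [g ginj].
  exists (fun k => xget 0 [set x | D x /\ g x = k]) => x eps eps0.
  have [y [Dy yx]] : D `&` [set y | hn (y - x) < eps] !=set0.
    have [r r0 hr] := nbhs_hnP (nbhs_hn x eps0).
    have ope : open [set y : H | hn (y - x) < eps].
      rewrite openE => y /= yx; have e0 : 0 < eps - hn (y - x) by rewrite subr_gt0.
      apply: filterS (nbhs_hn y e0) => z /= zy.
      have -> : z - x = (z - y) + (y - x) by rewrite addrA subrK.
      by apply: (le_lt_trans (hnD _ _)); rewrite -ltrBrDr.
    rewrite setIC; apply: dD => //; exists x => /=.
    by rewrite subrr hn0.
  exists (g y).
  have [Dz gz] : [set x | D x /\ g x = g y] (xget 0 [set x | D x /\ g x = g y]).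
    by apply: xgetPex; exists y.
  have -> // : xget 0 [set x | D x /\ g x = g y] = y.
  by apply: ginj => //; rewrite inE.
have [|b [hb hQ]] := @orthonormal_seq (fun s x => exists k,
    [/\ d k - span_proj s (d k) != 0, forall j, (j < k)%N -> d j = span_proj s (d j)
      & d k = span_proj s (d k) + dot (d k) x *: x]).
  move=> s hs.
  have [|k hk hmin] := @exists_least (fun k => d k - span_proj s (d k) != 0).
    have [x hx] := not_span s; apply: contrapT => hall.
    have {}hall k : d k - span_proj s (d k) = 0.
      by apply/eqP; apply: contrapT => /negP h; apply: hall; exists k.
    move: hx; rewrite -hn_eq0 eq_le hn_ge0 andbT => /negP; apply.
    apply/ler_addgt0Pr => eps eps0; rewrite add0r.
    have [k hkx] := hd x eps eps0.
    have -> : x - span_proj s x = (x - d k) - span_proj s (x - d k).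
      by rewrite [in RHS]span_projE projB -!span_projE opprD opprK addrACA [- d k + _]addrC -(opprB (d k)) hall oppr0 addr0.
    by apply: (le_trans (hn_residual _ hs)); rewrite hnBC ltW.
  set r := d k - span_proj s (d k) in hk *.
  exists (normalize r); split; first exact: hn_normalize.
    by move=> i si; rewrite dotZl dot_residual ?mulr0.
  exists k; split=> // [j /hmin /negP|].
    by rewrite negbK subr_eq0 => /eqP.
  have rr : dot (d k) r = (hn r ^+ 2)%:C%C.
    rewrite -{1}(subrK (span_proj s (d k)) (d k)) -/r dotDl (dotxx hdot).
    suff -> : dot (span_proj s (d k)) r = 0 by rewrite addr0.
    rewrite /span_proj dot_suml big1// => i _; rewrite dotZl.
    by rewrite (@dotC0 _ _ dot r) ?mulr0// dot_residual.
  rewrite /normalize dotZr rr scalerA conjR -!rmorphM/=.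
  have hr : hn r != 0 by rewrite hn_eq0.
  rewrite (_ : _ * _ * _ = 1) ?rmorph1 ?scale1r; last by field.
  by rewrite /r addrC subrK.
exists b; split=> // x eps eps0.
have hbo : orthosystem dot b by have := orthosystem_basis hdot hb.
have widen n y : y = oproj dot b predT n y -> y = oproj dot b predT n.+1 y.
  move=> yE; rewrite {2}yE (proj_widen _ _ _ _ (leqnSn n)) (proj_proj hdot hbo).
  rewrite {1}yE (proj_widen _ _ _ _ (leqnSn n)).
  by apply: eq_proj.
have fixd n j : (j < n)%N -> d j = oproj dot b predT n (d j).
  elim: n j => [//|n IH] j; rewrite ltnS => jn.
  have [k] := hQ n; rewrite span_proj_mkseq => -[k1 k2 k3].
  (* The vector treated at step [n] has index at least [n], since by induction the earlier ones
     already lie in the span. *)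
  have nk : (n <= k)%N.
    rewrite leqNgt; apply/negP => /IH kE.
    by move: k1; rewrite -kE subrr eqxx.
  move: (leq_trans jn nk); rewrite leq_eqVlt => /predU1P[->|jk].
    by rewrite {1}k3 [in RHS]/oproj big_ord_recr.
  by apply: widen; rewrite {1}k2// span_proj_mkseq.
have [k hk] := hd x eps eps0.
exists k.+1 => n kn.
have -> : x - oproj dot b predT n x = (x - d k) - oproj dot b predT n (x - d k).
  by rewrite projB -fixd// opprD opprK addrACA addNr addr0.
by apply: (le_trans (hn_subproj hdot hbo _ _ _)); rewrite hnBC ltW.
Qed.

End OrthonormalSequences.

(** * Existence of singular values *)

Section CompactOperators.
Context {R : realType} {H : completeNormedModType R[i]}.
Variable dot : {dot H for Num.conj}.
Hypothesis sepH : separable_infdim_hilbert dot.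
Implicit Types (x y z : H) (T S : H -> H).
Local Notation hdot := (hilbert_dot sepH).

Lemma hn_small_eq0 x : (forall eps, 0 < eps -> hn x <= eps) -> x = 0.
Proof.
move=> h; apply/eqP; rewrite -hn_eq0 eq_le hn_ge0 andbT.
by apply/ler_addgt0Pr => eps eps0; rewrite add0r h.
Qed.

Lemma invn_le (d : R) : 0 < d -> exists N, forall n, (N <= n)%N -> n.+1%:R^-1 <= d.
Proof.
move=> d0; exists (Num.truncn d^-1) => n Nn.
rewrite -[leRHS]invrK lef_pV2 ?posrE ?invr_gt0//.
by apply: (le_trans (ltW (truncnS_gt _))); rewrite ler_nat ltnS.
Qed.

(* By the parallelogram law, a sequence of unit vectors along which [|T x|]
   tends to its supremum is Cauchy as soon as its image converges. *)
Lemma norm_attained T (E : set H) C : linear T -> seqcompact T ->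
  (forall u, hn (T u) <= C * hn u) ->
  (forall a x y, E x -> E y -> E (a *: x + y)) ->
  (forall u l, (forall n, E (u n)) -> hto u l -> E l) ->
  (exists2 x, E x & hn x = 1) ->
  exists x, [/\ E x, hn x = 1 & forall y, E y -> hn (T y) <= hn (T x) * hn y].
Proof.
move=> linT cT bT linE clE [x0 Ex0 x01].
have E0 : E 0 by have := linE (-1) x0 x0 Ex0 Ex0; rewrite scaleN1r addNr.
have EZ a x : E x -> E (a *: x) by move=> Ex; rewrite -[_ *: _]addr0; exact: linE.
pose V := [set hn (T x) | x in E `&` [set x | hn x <= 1]].
have C0 : 0 <= C by have := bT x0; rewrite x01 mulr1; apply: le_trans; exact: hn_ge0.
have V0 : V !=set0 by exists (hn (T x0)), x0 => //=; rewrite x01.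
have ubV : has_ubound V.
  exists C => _ [x [_ /= x1] <-]; apply: (le_trans (bT x)).
  by rewrite ler_piMr.
pose M := sup V.
have leM x : E x -> hn (T x) <= M * hn x.
  move=> Ex; have [->|xn0] := eqVneq x 0; first by rewrite (linm0 linT) !hn0 mulr0.
  have hx : 0 < hn x by rewrite lt_def hn_eq0 xn0 hn_ge0.
  have : V (hn (T (normalize x))).
    by exists (normalize x) => //; split; [exact: EZ|rewrite /= hn_normalize].
  move/(ub_le_sup ubV); rewrite -/M (linmZ linT) hnZ cnR_ge0 ?invr_ge0 ?hn_ge0//.
  by rewrite mulrC ler_pdivrMr.
have M0 : 0 <= M by have := leM _ Ex0; rewrite x01 mulr1; apply: le_trans; exact: hn_ge0.
(* If the supremum is 0, [T] vanishes on [E] and any unit vector of [E] will do. *)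
move: M0; rewrite le_eqVlt => /predU1P[M0|M0].
  exists x0; split=> // y /leM; rewrite -M0 mul0r => /le_trans; apply.
  by rewrite mulr_ge0 ?hn_ge0.
have inv0 n : 0 < n.+1%:R^-1 :> R by rewrite invr_gt0.
have /choice[x hx] : forall n : nat, exists x, [/\ E x, hn x <= 1 & M - n.+1%:R^-1 < hn (T x)].
  move=> n; have [_ [x [Ex x1] <-] h] := sup_adherent (inv0 n) (conj V0 ubV).
  by exists x.
have x1 n : hn (x n) <= 1 by have [] := hx n.
have [z hz] := cT x x1.
have /choice[k hk] : forall n : nat, exists k, (n <= k)%N /\ hn (T (x k) - z) < n.+1%:R^-1.
  by move=> n; have [k ? ?] := hz n.+1%:R^-1 n (inv0 n); exists k.
pose y n := x (k n).
have Ey n : E (y n) by have [] := hx (k n).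
have My n : M - n.+1%:R^-1 <= hn (T (y n)).
  have [_ _ /ltW] := hx (k n); apply: le_trans; rewrite lerD2l lerN2.
  by rewrite lef_pV2 ?posrE// ler_nat ltnS (hk n).1.
have [l hl] : exists l, hto y l.
  apply: hn_cauchy => eps eps0.
  (* Let s = |y_m + y_n|. Near-maximality gives M (2 - s) <= 4 d, and the parallelogram law gives
     |y_m - y_n|^2 <= 4 - s^2 <= 4 (2 - s). Hence M |y_m - y_n|^2 <= 16 d, which fixes the
     constant. *)
  have d0 : 0 < eps ^+ 2 * M / 16 by rewrite divr_gt0// mulr_gt0// exprn_gt0.
  have [N hN] := invn_le d0; exists N => m n Nm Nn.
  set d := eps ^+ 2 * M / 16 in d0 hN.
  have h1 : 2 * M - 4 * d <= M * hn (y m + y n).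
    have t1 : hn (T (y m) - T (y n)) <= 2 * d.
      have -> : T (y m) - T (y n) = (T (y m) - z) - (T (y n) - z).
        by rewrite opprB addrA subrK.
      have ym : hn (T (y m) - z) <= d by exact: (ltW (lt_le_trans (hk m).2 (hN _ Nm))).
      have yn : hn (T (y n) - z) <= d by exact: (ltW (lt_le_trans (hk n).2 (hN _ Nn))).
      by apply: (le_trans (hnB _ _)); lra.
    have t2 : 2 * hn (T (y m)) <= hn (T (y m + y n)) + hn (T (y m) - T (y n)).
      have -> : 2 * hn (T (y m)) = hn (T (y m + y n) + (T (y m) - T (y n))).
        rewrite (linmD linT) addrACA subrr addr0.
        have -> : T (y m) + T (y m) = (2 : R)%:C%C *: T (y m).
          by rewrite (rmorph_nat (real_complex R)) scaler_nat mulr2n.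
        by rewrite hnZ cnR_ge0.
      exact: hnD.
    have := leM _ (linE 1 _ _ (Ey m) (Ey n)); rewrite scale1r.
    have Md : M - d <= hn (T (y m)) by apply: le_trans (My m); rewrite lerD2l lerN2 hN.
    by lra.
  have h2 := parallelogram hdot (y m) (y n).
  have h3 : hn (y m) <= 1 by exact: x1.
  have h4 : hn (y n) <= 1 by exact: x1.
  set s := hn (y m + y n) in h1 h2.
  have s0 : 0 <= s by exact: hn_ge0.
  have s2 : s <= 2 by apply: (le_trans (hnD _ _)); lra.
  rewrite -ler_sqr ?nnegrE ?hn_ge0 ?(ltW eps0)//.
  have h5 : hn (y m - y n) ^+ 2 <= 4 * (2 - s).
    have : hn (y m) ^+ 2 <= 1 by rewrite -(expr1n _ 2) ler_sqr ?nnegrE ?hn_ge0.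
    have : hn (y n) ^+ 2 <= 1 by rewrite -(expr1n _ 2) ler_sqr ?nnegrE ?hn_ge0.
    by nra.
  apply: (le_trans h5); rewrite -(ler_pM2l M0).
  have dE : 16 * d = M * eps ^+ 2 by rewrite /d; lra.
  by rewrite -dE; lra.
exists l.
have El : E l by exact: clE hl.
have l1 : hn l <= 1.
  apply/ler_addgt0Pr => eps eps0; have [N hN] := hl eps eps0.
  rewrite -(subrK (y N) l); apply: (le_trans (hnD _ _)).
  by rewrite hnBC addrC lerD ?hN// x1.
have Ml : M <= hn (T l).
  apply/ler_addgt0Pr => eps eps0.
  have e0 : 0 < eps / (2 * (C + 1)) by rewrite divr_gt0// mulr_gt0// ltr_wpDl.
  have [N1 hN1] := hl _ e0.
  have [N2 hN2] := invn_le (divr_gt0 eps0 (ltr0n R 2)).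
  pose n := maxn N1 N2.
  have : hn (T (y n)) <= hn (T l) + eps / 2.
    rewrite -(subrK (T l) (T (y n))) addrC; apply: (le_trans (hnD _ _)).
    rewrite lerD2l -(linmB linT); apply: (le_trans (bT _)).
    apply: (le_trans (ler_wpM2l C0 (hN1 n (leq_maxl _ _)))).
    rewrite mulrA ler_pdivrMr ?mulr_gt0 ?ltr_wpDl//.
    have -> : eps / 2 * (2 * (C + 1)) = eps * (C + 1) by field.
    by rewrite mulrC ler_pM2l// lerDl.
  have : M - eps / 2 <= hn (T (y n)) by apply: le_trans (My n); rewrite lerD2l lerN2 hN2// leq_maxr.
  by lra.
have l1' : hn l = 1.
  apply/eqP; rewrite eq_le l1/= -(ler_pM2l M0) mulr1.
  exact: le_trans (leM _ El).
split=> // u Eu; apply: (le_trans (leM _ Eu)).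
by rewrite ler_wpM2r ?hn_ge0.
Qed.

(** Each e_n maximises |T x| over the unit vectors orthogonal to its predecessors. The first
    variation at the maximum yields the eigenvector equation, the decreasing maxima are the singular
    values, and compactness makes them tend to 0. *)
Lemma exists_singular_values T : linear T -> seqcompact T ->
  exists s, is_singular_values dot T s.
Proof.
move=> linT cT; have [C C0 bT] := seqcompact_bounded linT cT.
have [|e [he hmax]] := @orthonormal_seq _ _ _ sepH (fun s x => forall y,
    (forall i, (i < size s)%N -> dot y s`_i = 0) -> hn (T y) <= hn (T x) * hn y).
  move=> s hs; have [x0 [x01 hx0]] := unit_orth sepH hs.
  have [|||x [h1 h2 h3]] := @norm_attained T
      [set x | forall i, (i < size s)%N -> dot x s`_i = 0] C linT cT bT.
  - by move=> a x y hx hy i si; rewrite dotDl dotZl hx// hy// mulr0 addr0.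
  - move=> u l hu hl i si; apply/eqP; rewrite -cn_eq0 eq_le cn_ge0 andbT.
    apply/ler_addgt0Pr => eps eps0; rewrite add0r.
    have [N hN] := hl (eps / (hn s`_i + 1)) (divr_gt0 eps0 (ltr_wpDl (hn_ge0 _) ltr01)).
    have -> : dot l s`_i = - dot (u N - l) s`_i by rewrite dotBl hu// sub0r opprK.
    rewrite cnN; apply: (le_trans (cauchy_schwarz hdot _ _)).
    apply: (le_trans (ler_wpM2r (hn_ge0 _) (hN N (leqnn N)))).
    by rewrite mulrAC ler_pdivrMr ?ltr_wpDl ?hn_ge0// ler_pM2l// lerDl.
  - by exists x0.
  - by exists x.
have {}hmax n y : (forall i, (i < n)%N -> dot y (e i) = 0) -> hn (T y) <= hn (T (e n)) * hn y.
  move=> hy; apply: hmax => i; rewrite size_mkseq => i_n.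
  by rewrite nth_mkseq// hy.
have he1 n : hn (e n) = 1 by apply: (hn_eq1 sepH); rewrite he eqxx.
have heo : orthosystem dot e by have := orthosystem_basis hdot he.
pose s n := hn (T (e n)).
have orth n x : (forall i, (i <= n)%N -> dot x (e i) = 0) -> dot (T (e n)) (T x) = 0.
  move=> hx; set w := dot (T (e n)) (T x).
  apply/eqP; apply: contrapT => /negP w0.
  have cw : 0 < cn w by rewrite lt_def cn_eq0 w0 cn_ge0.
  pose K := s n ^+ 2 * hn x ^+ 2.
  have K0 : 0 <= K by rewrite mulr_ge0 ?sqr_ge0.
  (* First variation: e_n + t w x stays orthogonal to the earlier vectors. Comparing squared norms
     with the maximal ratio leaves a linear term that must be dominated by a quadratic one, which is
     false for small t. *)
  have key t : 0 < t -> 2 <= t * K.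
    move=> t0; pose c : R[i] := t%:C%C * w.
    have h1 : hn (e n + c *: x) ^+ 2 = 1 + (t * cn w) ^+ 2 * hn x ^+ 2.
      rewrite (pyth hdot); first by rewrite he1 expr1n hnZ exprMn /c cnM cnR_ge0 ?ltW.
      by rewrite dotZr (dotC0 (hx n (leqnn n))) mulr0.
    have h2 : hn (T (e n + c *: x)) ^+ 2 <= s n ^+ 2 * hn (e n + c *: x) ^+ 2.
      rewrite -exprMn ler_sqr ?nnegrE ?mulr_ge0 ?hn_ge0//; apply: hmax => i i_n.
      by rewrite dotDl dotZl hx 1?ltnW// mulr0 he gtn_eqF// addr0.
    rewrite h1 (linmD linT) (linmZ linT) (hn2D hdot) dotZr -/w in h2.
    have h3 : Num.conj c * w = (t * cn w ^+ 2)%:C%C.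
      by rewrite /c rmorphM/= conjR -mulrA (mulrC (Num.conj w)) mulJ -rmorphM.
    rewrite h3/= mulrDr mulr1 -/(s n) in h2.
    have h4 := sqr_ge0 (hn (c *: T x)).
    have : 2 * (t * cn w ^+ 2) <= t * K * (t * cn w ^+ 2).
      by rewrite /K; move: h2 h4; set a := hn (c *: T x) ^+ 2; nra.
    by rewrite ler_pM2r// mulr_gt0// exprn_gt0.
  have : 2 <= (K + 1)^-1 * K by apply: key; rewrite invr_gt0 ltr_wpDl.
  rewrite mulrC ler_pdivlMr ?ltr_wpDl//; lra.
have Tee i j : (i < j)%N -> dot (T (e i)) (T (e j)) = 0.
  move=> ij; apply: orth => k ki; rewrite he; case: eqP => // jk; move: ki ij; lia.
have eigen n x : dot (T (e n)) (T x) = (s n ^+ 2)%:C%C * dot (e n) x.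
  rewrite -{1}(subrK (oproj dot e predT n.+1 x) x) (linmD linT) dotDr orth ?add0r.
    rewrite /oproj big_ord_recr/= (linmD linT) (linmZ linT) dotDr dotZr (dotxx hdot).
    rewrite (linm_sum linT) dot_sumr big1 ?add0r.
      by rewrite -dotC mulrC.
    by move=> i _; rewrite (linmZ linT) dotZr (dotC0 (Tee i n _)) ?mulr0.
  by move=> i i_n; rewrite dotBl (dot_proj hdot heo) ltnS i_n subrr.
have smono : nonincreasing_seq s.
  apply/nonincreasing_seqP => n; rewrite /s -[leRHS]mulr1 -(he1 n.+1); apply: hmax.
  by move=> i i_n; rewrite he; case: eqP => // h; move: i_n; rewrite -h; lia.
exists s; split=> //; first by move=> n; exact: hn_ge0.
exists e; split=> // x hx; apply: hn_small_eq0 => eps eps0.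
have [z hz] := cT e (fun n => eq_ind_r (fun r => r <= 1) (lexx _) (he1 n)).
have d0 : 0 < eps / (2 * (hn x + 1)) by rewrite divr_gt0// mulr_gt0// ltr_wpDl ?hn_ge0.
set d := eps / (2 * (hn x + 1)) in d0.
have [m _ hm] := hz d 0%N d0; have [n mn hn_] := hz d m.+1 d0.
have sm : s m <= 2 * d.
  have dd : 0 <= 2 * d by lra.
  rewrite -ler_sqr ?nnegrE ?hn_ge0//.
  (* The images T e_m and T e_n are orthogonal, and both lie near the cluster point [z]; hence each
     of them is small. *)
  apply: (@le_trans _ _ (hn (T (e m) - T (e n)) ^+ 2)).
    by rewrite (pyth hdot) ?dotNr ?Tee ?oppr0// hnN lerDl sqr_ge0.
  rewrite ler_sqr ?nnegrE ?hn_ge0//.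
  have -> : T (e m) - T (e n) = (T (e m) - z) - (T (e n) - z) by rewrite opprB addrA subrK.
  by apply: (le_trans (hnB _ _)); lra.
apply: (le_trans (hmax m x (fun i _ => hx i))).
apply: le_trans (ler_wpM2r (hn_ge0 x) sm) _.
rewrite /d; have h := hn_ge0 x.
have -> : 2 * (eps / (2 * (hn x + 1))) * hn x = eps * (hn x / (hn x + 1)).
  by field; rewrite gt_eqF// ltr_wpDl.
by rewrite ler_piMr ?(ltW eps0)// ler_pdivrMr ?ltr_wpDl// mul1r lerDl.
Qed.

End CompactOperators.

Section EReal.
Context {R : realType}.

Lemma cvge0P (a : nat -> \bar R) :
  a n @[n --> \oo] --> 0%E ->
  forall eps, 0 < eps -> exists N, forall n, (N <= n)%N -> (a n <= eps%:E)%E.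
Proof.
move=> ha eps eps0.
have : nbhs (0%:E : \bar R) [set x | (x < eps%:E)%E].
  apply: open_nbhs_nbhs; split; first exact: open_ereal_lt_ereal.
  by rewrite /= lte_fin.
move=> /ha[N _ hN]; exists N => n Nn; exact/ltW/hN.
Qed.

Lemma cvge0 (a : nat -> R) : (forall n, 0 <= a n) ->
  (forall eps, 0 < eps -> exists N, forall n, (N <= n)%N -> a n <= eps) ->
  (a n)%:E @[n --> \oo] --> 0%E.
Proof.
move=> a0 h; apply: cvg_EFin; first by near=> n.
apply/cvgrPdist_le => eps /h[N hN]; exists N => // n Nn /=.
by rewrite sub0r normrN ger0_norm// hN.
Unshelve. all: by end_near. Qed.

End EReal.

Section Limits.
Context {R : realType} {H : completeNormedModType R[i]}.
Implicit Types (u v : nat -> H) (l m : H).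

Lemma eq_hto u v l : u =1 v -> hto u l -> hto v l.
Proof. by move=> e h eps /h[N hN]; exists N => n /hN; rewrite e. Qed.

Lemma hto_uniq u l m : hto u l -> hto u m -> l = m.
Proof.
move=> hl hm; apply/eqP; rewrite -subr_eq0; apply/eqP/hn_small_eq0 => eps eps0.
have [N1 h1] := hl _ (divr_gt0 eps0 (ltr0n R 2)).
have [N2 h2] := hm _ (divr_gt0 eps0 (ltr0n R 2)).
have -> : l - m = (u (N1 + N2)%N - m) - (u (N1 + N2)%N - l).
  by rewrite opprB [RHS]addrC addrA subrK.
apply: (le_trans (hnB _ _)); rewrite (splitr eps) lerD//.
  by rewrite h2 ?leq_addl.
by rewrite h1 ?leq_addr.
Qed.

Lemma hto_lin a u v l m : hto u l -> hto v m -> hto (fun n => a *: u n + v n) (a *: l + m).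
Proof.
move=> hl hm eps eps0.
have e0 : 0 < eps / (cn a + 1) by rewrite divr_gt0// ltr_wpDl ?cn_ge0.
have [N1 h1] := hl _ (divr_gt0 e0 (ltr0n R 2)).
have [N2 h2] := hm _ (divr_gt0 eps0 (ltr0n R 2)).
exists (N1 + N2)%N => n Nn.
rewrite opprD addrACA -scalerBr; apply: (le_trans (hnD _ _)).
rewrite (splitr eps) lerD ?h2//; last by lia.
rewrite hnZ; apply: (le_trans (ler_wpM2l (cn_ge0 a) (h1 n _))); first by lia.
rewrite mulrA ler_wpM2r ?invr_ge0// mulrA ler_pdivrMr ?ltr_wpDl ?cn_ge0//.
by rewrite mulrC ler_pM2l// lerDl.
Qed.

End Limits.

(** * The space c_p *)

Section SchattenClass.
Context {R : realType} {H : completeNormedModType R[i]}.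
Variable dot : {dot H for Num.conj}.
Hypothesis sepH : separable_infdim_hilbert dot.
Variable p : R.
Hypothesis p2 : 2 < p.
Implicit Types (T S : H -> H) (M : R).
Local Notation hdot := (hilbert_dot sepH).
Local Notation bnd := (bnd dot p).
Local Notation nrm := (nrm dot p).

Let p0 : 0 < p. Proof. by apply: lt_trans p2. Qed.

(** Existence guarantees that [xget] returns genuine singular values here and not its default. *)
Lemma compact_svd T : compact_operator T ->
  exists2 e, svd dot T (singular_values dot T) e & forall k, 0 <= singular_values dot T k.
Proof.
move=> [linT cT].
have : [set s | is_singular_values dot T s] (singular_values dot T).
  apply: xgetPex; apply: (exists_singular_values sepH linT).
  exact: precompact_seqcompact.
set s := singular_values dot T => -[s0 _ [e [he eig ker]]].
exists e => //; split=> // [|k].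
  by have := orthosystem_basis hdot he.
apply/eqP; rewrite -(@eqrXn2 _ 2) ?hn_ge0//.
by rewrite -(inj_eq (@complexI R)) -(dotxx hdot) eig he eqxx mulr1.
Qed.

Lemma compact_bounded T : compact_operator T ->
  exists C, forall u, hn (T u) <= C * hn u.
Proof.
move=> [linT /precompact_seqcompact cT].
by have [C _ ?] := seqcompact_bounded linT cT; exists C.
Qed.

Lemma cp_norm_le T M : compact_operator T -> 0 <= M ->
  (cp_norm dot p T <= M%:E)%E <-> bnd T M.
Proof.
move=> cT M0; have [e hs s0] := compact_svd cT.
have [C hC] := compact_bounded cT; have [linT _] := cT.
rewrite /cp_norm (lp_norm_le _ p0 M0); split=> [h|h K].
  apply: (svd_bnd hdot p2 linT hC hs M0) => K.
  by apply: le_trans (h K); apply: ler_sum => k _; rewrite ger0_norm.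
have hh := bnd_svd hdot hs K h.
apply: le_trans hh.
by apply: ler_sum => k _; rewrite ger0_norm.
Qed.

Lemma cp_linear T : cp dot p T -> linear T.
Proof. by case=> -[]. Qed.

Lemma cp_bnd T : cp dot p T -> bnd T (nrm T).
Proof.
move=> [cT]; have := lp_norm_ge0 p (singular_values dot T).
rewrite -/(cp_norm dot p T); case E : (cp_norm dot p T) => [r| |]// r0 _.
by have [] : bnd T (nrm T) /\ nrm T <= r;
  first by apply: (nrmP p2); apply/cp_norm_le; rewrite ?E.
Qed.

Lemma cp_normE T : cp dot p T -> cp_norm dot p T = (nrm T)%:E.
Proof.
move=> hT; have hb := cp_bnd hT; have [cT _] := hT.
apply: (@ereal_fin_bounds _ _ (fun M => bnd T M)) => //.
- exact: lp_norm_ge0.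
- by move=> M M0; exact: cp_norm_le.
- exact: hb.1.
- by move=> M hM; exact: (nrmP p2 hM).2.
Qed.

Lemma cp_nrm_le T M : bnd T M -> nrm T <= M.
Proof. by move=> /(nrmP p2)[]. Qed.

Lemma cp_of_bnd T M : compact_operator T -> bnd T M -> cp dot p T.
Proof.
move=> cT hT; split=> //; apply: le_lt_trans (ltry M).
by apply/cp_norm_le => //; exact: hT.1.
Qed.

Lemma compact_lim T : linear T ->
  (forall eps, 0 < eps -> exists2 S, cp dot p S & bnd (fun u => T u - S u) eps) ->
  compact_operator T.
Proof.
move=> linT h; split=> //; apply: precompact_lim => eps eps0.
have [S hS hb] := h _ eps0; have [[linS cS] _] := hS.
exists S => // u u1.
have lin : linear (fun u => T u - S u).
  by move=> a x y; rewrite linT linS scalerBr opprD addrACA.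
by apply: (le_trans (bnd_op hdot p2 _ lin hb)); rewrite ler_piMr// ltW.
Qed.

(** The limit is taken pointwise. Membership of the differences in c_p is assumed because in the
    application they belong to a given linear subspace of it. *)
Lemma cp_complete (u : nat -> H -> H) :
  (forall n, cp dot p (u n)) -> (forall m n, cp dot p (u m - u n)) ->
  (forall eps, 0 < eps -> exists N, forall m n, (N <= m)%N -> (N <= n)%N ->
     nrm (u m - u n) <= eps) ->
  exists T, [/\ cp dot p T, forall n, cp dot p (u n - T) &
    forall eps, 0 < eps -> exists N, forall n, (N <= n)%N -> nrm (u n - T) <= eps].
Proof.
move=> cu cuu hu.
have bu m n x : hn (u m x - u n x) <= nrm (u m - u n) * hn x.
  exact: (bnd_op hdot p2 _ (cp_linear (cuu m n)) (cp_bnd (cuu m n))).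
have /choice[T hT] : forall x, exists l, hto (fun n => u n x) l.
  move=> x; apply: hn_cauchy => eps eps0.
  have e0 : 0 < eps / (hn x + 1) by rewrite divr_gt0// ltr_wpDl ?hn_ge0.
  have [N hN] := hu _ e0; exists N => m n Nm Nn; apply: (le_trans (bu _ _ _)).
  apply: (le_trans (ler_wpM2r (hn_ge0 x) (hN _ _ Nm Nn))).
  by rewrite mulrAC ler_pdivrMr ?ltr_wpDl ?hn_ge0// ler_pM2l// lerDl.
have linT : linear T.
  move=> a x y; apply: hto_uniq (hT (a *: x + y)) _.
  have := hto_lin a (hT x) (hT y); apply: eq_hto => n.
  by rewrite (cp_linear (cu n)).
have bT eps : 0 < eps -> exists N, forall n, (N <= n)%N -> bnd (u n - T) eps.
  move=> eps0; have [N hN] := hu _ eps0; exists N => n Nn.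
  (* On finitely many vectors u_n - T is close to u_n - u_m for large m, and the latter obeys the
     bound. *)
  apply: (bnd_lim p2 (ltW eps0)) => us d d0.
  have [m Nm hm] : exists2 m, (N <= m)%N & forall x, x \in us -> hn (u m x - T x) <= d.
    have [K0 hM] : exists K0, forall m, (K0 <= m)%N -> forall x, x \in us -> hn (u m x - T x) <= d.
      elim: us => [|x us [M1 h1]]; first by exists 0%N.
      have [M2 h2] := hT x d d0.
      exists (M1 + M2)%N => m hm v; rewrite inE => /predU1P[->|]; first by apply: h2; lia.
      by apply: h1; lia.
    by exists (N + K0)%N; [exact: leq_addr|apply: hM; exact: leq_addl].
  exists (u n - u m); first by apply: (bndW p2 (hN n m Nn Nm)); exact: cp_bnd.
  move=> x /hm h; have -> : (u n - T) x = (u n - u m) x + (u m x - T x).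
    by rewrite !fctE addrA subrK.
  by apply: (le_trans (hnD _ _)); rewrite lerD2l.
have cT : compact_operator T.
  apply: compact_lim => // eps eps0; have [N hN] := bT _ eps0.
  exists (u N) => //; apply: (bnd_le p2 _ (hN N (leqnn N))) => x.
  by rewrite hnBC.
have cuT n : cp dot p (u n - T).
  have [N hN] := bT 1 ltr01.
  have bn : bnd (u n - T) (nrm (u n - u N) + 1).
    apply: (eq_bnd p2 _ (bndD p2 (cp_bnd (cuu n N)) (hN N (leqnn N)))) => x.
    by rewrite !fctE addrA subrK.
  apply: (cp_of_bnd _ bn); apply: compact_lim => [a x y|eps eps0].
    by rewrite !fctE linT (cp_linear (cu n)) scalerBr opprD addrACA.
  have [N' hN'] := bT _ eps0; exists (u n - u N') => //.
  apply: (bnd_le p2 _ (hN' N' (leqnn _))) => x; rewrite !fctE.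
  by rewrite opprB [X in hn X <= _]addrC addrA subrK.
have [N hN] := bT 1 ltr01.
exists T; split=> //.
  apply: (@cp_of_bnd _ (nrm (u N) + 1)) => //.
  apply: (bnd_le_add p2 _ (cp_bnd (cu N)) (hN N (leqnn N))) => x.
  by rewrite -{1}(subrK (u N x) (T x)) addrC hnBC; exact: hnD.
move=> eps /bT[N' hN']; exists N' => n /hN'; exact: cp_nrm_le.
Qed.

End SchattenClass.

(** * Isomorphisms and l_2 *)

Section BoundedSums.
Context {R : realType}.

Lemma bounded_sum_tail (a : nat -> R) (B : R) : (forall n, 0 <= a n) ->
  (forall K, \sum_(n < K) a n <= B) ->
  forall eps, 0 < eps -> exists m, forall K, (m <= K)%N ->
    \sum_(m <= n < K) a n <= eps.
Proof.
move=> a0 hB eps eps0; pose V := range (fun K => \sum_(n < K) a n).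
have V0 : V !=set0 by exists (\sum_(n < 0) a n), 0%N.
have ubV : has_ubound V by exists B => _ [K _ <-].
have [_ [m _ <-] hm] := sup_adherent eps0 (conj V0 ubV).
exists m => K mK; have : \sum_(n < K) a n <= sup V by apply: ub_le_sup => //; exists K.
move: hm; rewrite -!(big_mkord predT a).
by rewrite [X in _ -> X <= _ -> _](big_cat_nat _ (n := m))//=; lra.
Qed.

Lemma powR_continuity (p x eps : R) : 0 < p -> 0 <= x -> 0 < eps ->
  exists2 eta, 0 < eta & (x + eta) `^ p <= x `^ p + eps.
Proof.
move=> p0 x0 eps0; have pn0 : p != 0 by rewrite gt_eqF.
pose y := (x `^ p + eps) `^ p^-1.
have yp : y `^ p = x `^ p + eps by rewrite powRVK// addr_ge0 ?powR_ge0 ?ltW.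
exists (y - x); last by rewrite addrC subrK yp.
rewrite subr_gt0 ltNge -(ler_powR2 p0) ?powR_ge0// yp -ltNge.
by rewrite ltrDl.
Qed.

End BoundedSums.

Section Isomorphisms.
Context {R : realType} {V W : lmodType R[i]}.
Variables (NV : V -> \bar R) (X : set V) (NW : W -> \bar R) (Y : set W).
Implicit Types (T : V -> W).

(** Only positive real factors and finite bounds are considered: this is what rescaling to the unit
    ball requires, and it avoids multiplication of extended reals. *)
Definition homogeneous (U : lmodType R[i]) (N : U -> \bar R) (Z : set U) : Prop :=
  forall (c M : R) x, Z x -> 0 < c -> 0 <= M ->
    (N x <= M%:E)%E -> (N (c%:C%C *: x) <= (c * M)%:E)%E.

Lemma subspaceZ (U : lmodType R[i]) (Z : set U) a x :
  linear_subspace Z -> Z x -> Z (a *: x).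
Proof. by move=> [Z0 ZD] Zx; rewrite -[_ *: _]addr0; exact: ZD. Qed.

Lemma subspaceD (U : lmodType R[i]) (Z : set U) x y :
  linear_subspace Z -> Z x -> Z y -> Z (x + y).
Proof. by move=> [Z0 ZD] Zx Zy; rewrite -[x]scale1r; exact: ZD. Qed.

Lemma subspaceB (U : lmodType R[i]) (Z : set U) x y :
  linear_subspace Z -> Z x -> Z y -> Z (x - y).
Proof. by move=> h Zx Zy; rewrite -scaleN1r; apply: subspaceD => //; exact: subspaceZ. Qed.

Lemma subspace_sum (U : lmodType R[i]) (Z : set U) I (r : seq I) (P : pred I) (F : I -> U) :
  linear_subspace Z -> (forall i, P i -> Z (F i)) -> Z (\sum_(i <- r | P i) F i).
Proof.
move=> h hF; elim/big_ind : _ => //; first by case: h.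
by move=> x y; exact: subspaceD.
Qed.

Lemma linear_onZ T a x : linear_subspace X -> linear_on X T -> X x ->
  T (a *: x) = a *: T x.
Proof.
move=> [X0 _] linT Xx.
have T0 : T 0 = 0.
  have := linT 1 0 0 X0 X0; rewrite !scale1r addr0 => h.
  by apply: (@addrI _ (T 0)); rewrite -h addr0.
by rewrite -[a *: x]addr0 linT// T0 addr0.
Qed.

Lemma linear_onD T x y : linear_on X T -> X x -> X y -> T (x + y) = T x + T y.
Proof. by move=> linT Xx Xy; rewrite -{1}[x]scale1r linT// scale1r. Qed.

Lemma linear_onB T x y : linear_subspace X -> linear_on X T -> X x -> X y ->
  T (x - y) = T x - T y.
Proof.
move=> sX linT Xx Xy.
have XNy : X (-1 *: y) by exact: subspaceZ.
have := linear_onD linT Xx XNy.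
by rewrite (linear_onZ _ sX linT Xy) !scaleN1r.
Qed.

Lemma opnorm_bound T : linear_subspace X -> linear_on X T -> set_fun X Y T ->
  homogeneous NV X -> homogeneous NW Y -> (opnorm NV X NW T < +oo)%E ->
  exists2 C, 0 < C & forall x M, X x -> 0 < M -> (NV x <= M%:E)%E ->
    (NW (T x) <= (C * M)%:E)%E.
Proof.
move=> sX linT XY hV hW hT; pose C := `|fine (opnorm NV X NW T)| + 1.
have C0 : 0 < C by rewrite ltr_wpDl.
have hC : (opnorm NV X NW T <= C%:E)%E.
  move: hT; rewrite /C; case: (opnorm _ _ _ _) => [r| |]//= _.
    by rewrite lee_fin (le_trans (ler_norm r))// lerDl.
  exact: leNye.
exists C => // x M Xx M0 xM.
have M1 : 0 < M^-1 by rewrite invr_gt0.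
have Xy : X (M^-1%:C%C *: x) by exact: subspaceZ.
have yM : (NV (M^-1%:C%C *: x) <= 1)%E.
  by have := hV M^-1 M x Xx M1 (ltW M0) xM; rewrite mulVf// gt_eqF.
have xE : x = M%:C%C *: (M^-1%:C%C *: x).
  by rewrite scalerA -rmorphM/= mulfV ?gt_eqF// rmorph1 scale1r.
have hy : (NW (T (M^-1%:C%C *: x)) <= C%:E)%E.
  by apply: le_trans hC; apply: ereal_sup_ubound; exists (M^-1%:C%C *: x).
by rewrite xE (linear_onZ _ sX linT Xy) mulrC; apply: hW => //; [exact: XY|exact: ltW].
Qed.

Lemma opnorm_le T C : (forall x, X x -> (NV x <= 1)%E -> (NW (T x) <= C%:E)%E) ->
  (opnorm NV X NW T <= C%:E)%E.
Proof. by move=> h; apply: ge_ereal_sup => _ [x [Xx /= x1] <-]; exact: h. Qed.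

End Isomorphisms.

Section Embeddings.
Context {R : realType} {V W : lmodType R[i]}.
Variables (NV : V -> \bar R) (X : set V) (NW : W -> \bar R).

(** Both directions are returned: a near-isometric copy of [X] needs the map out of [X], whereas for
    an embedding of l_2 the isomorphism sought goes from the image back to l_2. *)
Lemma embedding_isomorphism (T : V -> W) (C D : R) :
  linear_subspace X -> linear_on X T ->
  (forall x, X x -> (NV x <= 1)%E -> (NW (T x) <= C%:E)%E) ->
  (forall x, X x -> (NW (T x) <= 1)%E -> (NV x <= D%:E)%E) ->
  (forall x, X x -> T x = 0 -> x = 0) ->
  exists S, [/\ surjective_isomorphism NV X NW (T @` X) T S,
    surjective_isomorphism NW (T @` X) NV X S T,
    (opnorm NV X NW T <= C%:E)%E & (opnorm NW (T @` X) NV S <= D%:E)%E].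
Proof.
move=> sX linT hC hD inj.
have injT x y : X x -> X y -> T x = T y -> x = y.
  move=> Xx Xy e; apply/eqP; rewrite -subr_eq0; apply/eqP/inj; first exact: subspaceB.
  by rewrite (linear_onB sX linT Xx Xy) e subrr.
have /choice[S hS] : forall y, exists x, (T @` X) y -> X x /\ T x = y.
  move=> y; have [[x Xx <-]|ny] := pselect ((T @` X) y); first by exists x.
  by exists 0.
have ST x : X x -> S (T x) = x.
  move=> Xx; have [XS TS] := hS (T x) (ex_intro2 _ _ x Xx erefl).
  exact: injT.
have nT : (opnorm NV X NW T <= C%:E)%E by exact: opnorm_le.
have nS : (opnorm NW (T @` X) NV S <= D%:E)%E.
  by apply: opnorm_le => _ [x Xx <-]; rewrite ST//; exact: hD.
have linS : linear_on (T @` X) S.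
  by move=> a _ _ [x Xx <-] [y Xy <-]; rewrite -linT// !ST//; exact: sX.2.
have fT : set_fun X (T @` X) T by move=> x Xx; exists x.
have fS : set_fun (T @` X) X S by move=> _ [x Xx <-]; rewrite ST.
have cT : {in X, cancel T S} by move=> x /set_mem; exact: ST.
have cS : {in T @` X, cancel S T} by move=> y /set_mem /hS[].
have oT := le_lt_trans nT (ltry C); have oS := le_lt_trans nS (ltry D).
by exists S.
Qed.

Lemma image_subspace (T : V -> W) : linear_subspace X -> linear_on X T ->
  linear_subspace (T @` X).
Proof.
move=> sX linT; split.
  exists 0; first by case: sX.
  have X0 := sX.1; have h := @linear_onZ _ _ _ X T 0 0 sX linT X0.
  by rewrite scale0r in h; rewrite h scale0r.
move=> a _ _ [x Xx <-] [y Xy <-]; exists (a *: x + y); first exact: sX.2.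
by rewrite linT.
Qed.

End Embeddings.

Section LittleL2.
Context {R : realType}.
Implicit Types (x y : nat -> R[i]^o).

Lemma l2_norm_le x M : 0 <= M ->
  (l2_norm x <= M%:E)%E <-> (forall K, \sum_(k < K) cn (x k) ^+ 2 <= M ^+ 2).
Proof.
move=> M0; rewrite /l2_norm (lp_norm_le _ (ltr0n R 2) M0).
rewrite -(powR_mulrn _ M0).
split=> h K; last by under eq_bigr do rewrite ger0_norm ?cn_ge0// powR_mulrn ?cn_ge0//; exact: h.
by have := h K; under eq_bigr do rewrite ger0_norm ?cn_ge0// powR_mulrn ?cn_ge0//.
Qed.

Lemma l2P x : l2 x <-> exists2 M, 0 <= M & forall K, \sum_(k < K) cn (x k) ^+ 2 <= M ^+ 2.
Proof.
rewrite /l2 /=; split=> [h|[M M0 h]]; last first.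
  by apply: le_lt_trans (ltry M); apply/l2_norm_le.
have := lp_norm_ge0 2 (fun n => complex.Re `|x n|); move: h.
rewrite /l2_norm; case E : (lp_norm _ _) => [r| |]// _ r0.
by exists r => //; apply/l2_norm_le => //; rewrite /l2_norm E.
Qed.

Lemma l2_minkowski x y M N : 0 <= M -> 0 <= N ->
  (forall K, \sum_(k < K) cn (x k) ^+ 2 <= M ^+ 2) ->
  (forall K, \sum_(k < K) cn (y k) ^+ 2 <= N ^+ 2) ->
  forall K, \sum_(k < K) cn (x k + y k) ^+ 2 <= (M + N) ^+ 2.
Proof.
move=> M0 N0 hx hy K.
have h12 : (1 : R) <= 2 by rewrite ler1n.
have := @minkowski_bound R 2 _ (index_enum 'I_K) (fun=> 1) (fun k => cn (x k))
  (fun k => cn (y k)) M N h12 M0 N0.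
rewrite !powR_mulrn ?addr_ge0// => h.
have {}h : \sum_(k < K) 1 * (cn (x k) + cn (y k)) `^ 2 <= (M + N) ^+ 2.
  apply: h => // [i _|i _||].
  - exact: cn_ge0.
  - exact: cn_ge0.
  - by under eq_bigr do rewrite mul1r powR_mulrn ?cn_ge0//; exact: hx.
  - by under eq_bigr do rewrite mul1r powR_mulrn ?cn_ge0//; exact: hy.
apply: le_trans h; apply: ler_sum => k _.
rewrite mul1r powR_mulrn ?addr_ge0 ?cn_ge0//.
by rewrite ler_sqr ?nnegrE ?addr_ge0 ?cn_ge0// cnD.
Qed.

Lemma l2_scale a x M : 0 <= M ->
  (forall K, \sum_(k < K) cn (x k) ^+ 2 <= M ^+ 2) ->
  forall K, \sum_(k < K) cn ((a *: x) k) ^+ 2 <= (cn a * M) ^+ 2.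
Proof.
move=> M0 hx K; under eq_bigr do rewrite cnM exprMn.
by rewrite -mulr_sumr exprMn ler_wpM2l ?sqr_ge0.
Qed.

Lemma l2_subspace : linear_subspace (@l2 R).
Proof.
split.
  by apply/l2P; exists 0 => // K; rewrite big1 ?expr0n// => k _; rewrite cn0 expr0n.
move=> a x y /l2P[M M0 hx] /l2P[N N0 hy]; apply/l2P.
exists (cn a * M + N); first by rewrite addr_ge0 ?mulr_ge0 ?cn_ge0.
apply: l2_minkowski => //; first by rewrite mulr_ge0 ?cn_ge0.
exact: l2_scale.
Qed.

Lemma l2_homogeneous : homogeneous (@l2_norm R) (@l2 R).
Proof.
move=> c M x _ c0 M0 /(l2_norm_le x M0) h.
have cM : 0 <= c * M by rewrite mulr_ge0// ltW.
by apply/(l2_norm_le _ cM) => K; have := l2_scale c%:C%C M0 h K; rewrite cnR_ge0 ?(ltW c0).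
Qed.

Definition l2_unit (k : nat) : nat -> R[i]^o := fun n => (n == k)%:R.

Lemma l2_units_coord (s : seq nat) (c : nat -> R[i]) n : uniq s ->
  (\sum_(k <- s) c k *: l2_unit k) n = if n \in s then c n else 0.
Proof.
move=> us; rewrite fct_sumE.
rewrite (eq_bigr (fun k => if k == n then c k else 0)); last first.
  move=> k _; rewrite /l2_unit; change ((c k * (n == k)%:R) = if k == n then c k else 0).
  by rewrite eq_sym; case: eqP => _; rewrite ?mulr1 ?mulr0.
rewrite -big_mkcond/=; case: ifPn => ns.
  by rewrite -big_filter (filter_pred1_uniq us ns) big_seq1.
by rewrite big_seq_cond big1// => k /andP[ks /eqP kn]; rewrite -kn ks in ns.
Qed.

Lemma l2_units_sum (s : seq nat) (c : nat -> R[i]) : uniq s ->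
  exists K0, forall K, (K0 <= K)%N ->
  \sum_(n < K) cn ((\sum_(k <- s) c k *: l2_unit k) n) ^+ 2 = \sum_(k <- s) cn (c k) ^+ 2.
Proof.
move=> us; exists (\max_(k <- s) k.+1) => K hK.
under eq_bigr do rewrite l2_units_coord//.
rewrite (eq_bigr (fun n : 'I_K => if (n : nat) \in s then cn (c n) ^+ 2 else 0)); last first.
  by move=> n _; case: ifP => // _; rewrite cn0 expr0n.
rewrite -(big_mkord predT (fun n => if n \in s then cn (c n) ^+ 2 else 0)).
rewrite -big_mkcond/= -big_filter; apply: perm_big; apply: uniq_perm => //.
  by rewrite filter_uniq// iota_uniq.
move=> n; rewrite mem_filter mem_index_iota /=.
case ns : (n \in s) => //=; apply: leq_trans hK.
by rewrite (big_rem n)//= leq_maxl.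
Qed.

Lemma l2_units_le (s : seq nat) (c : nat -> R[i]) K : uniq s ->
  \sum_(n < K) cn ((\sum_(k <- s) c k *: l2_unit k) n) ^+ 2 <= \sum_(k <- s) cn (c k) ^+ 2.
Proof.
move=> us; have [K0 h] := l2_units_sum c us.
rewrite -(h (maxn K0 K) (leq_maxl _ _)).
rewrite -!(big_mkord predT (fun n => cn ((\sum_(k <- s) c k *: l2_unit k) n) ^+ 2)).
rewrite [leRHS](big_cat_nat _ (n := K)) ?leq_maxr//= lerDl sumr_ge0// => n _.
exact: sqr_ge0.
Qed.

Lemma l2_unit_l2 k : l2 (l2_unit k).
Proof.
apply/l2P; exists 1 => // K; have := @l2_units_le [:: k] (fun=> 1) K isT.
by rewrite !big_seq1 cn1 scale1r.
Qed.

End LittleL2.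

(** * The space l_p(c_p^n) and the absence of l_2 in it *)

Section MatrixSequences.
Context {R : realType} {H : completeNormedModType R[i]}.
Variable dot : {dot H for Num.conj}.
Hypothesis hdot : forall x : H, `|x| ^+ 2 = dot x x.
Variable p : R.
Hypothesis p2 : 2 < p.
Variable b : nat -> H.
Hypothesis hb : forall i j, dot (b i) (b j) = (i == j)%:R.
Local Notation op := (op dot b).

Let p0 : 0 < p. Proof. by apply: lt_trans p2. Qed.
Let p1 : 1 <= p. Proof. by apply/ltW/(lt_trans _ p2); rewrite ltr1n. Qed.

Lemma op_D n (A B : 'M[R[i]]_n) x : op (A + B) x = op A x + op B x.
Proof. by rewrite /op mulmxDl (linmD (vec_lin b (n := n))). Qed.

Lemma op_Z n a (A : 'M[R[i]]_n) x : op (a *: A) x = a *: op A x.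
Proof. by rewrite /op -scalemxAl (linmZ (vec_lin b (n := n))). Qed.

Lemma cpn_normD n (A B : 'M[R[i]]_n) : cpn_norm p (A + B) <= cpn_norm p A + cpn_norm p B.
Proof.
apply: (cpn_norm_le hdot p2 hb); apply: (eq_bnd p2 _ (bndD p2 _ _)) => [x| |].
- exact: op_D.
- exact: (cpn_norm_bnd hdot p2 hb).
- exact: (cpn_norm_bnd hdot p2 hb).
Qed.

Lemma cpn_normZ n a (A : 'M[R[i]]_n) : cpn_norm p (a *: A) <= cn a * cpn_norm p A.
Proof.
apply: (cpn_norm_le hdot p2 hb); apply: (eq_bnd p2 _ (bndZ _ _)) => [x|].
- exact: op_Z.
- exact: (cpn_norm_bnd hdot p2 hb).
Qed.

Lemma cpn_norm_entries n (A : 'M[R[i]]_n) :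
  cpn_norm p A <= \sum_(i < n) \sum_(j < n) cn (A i j).
Proof. by apply: (cpn_norm_le hdot p2 hb); exact: (op_bnd hdot p2 hb). Qed.

Lemma cpn_norm0 n : cpn_norm p (0 : 'M[R[i]]_n) = 0.
Proof.
apply/eqP; rewrite eq_le cpn_norm_ge0 andbT.
apply: (le_trans (cpn_norm_entries _)); rewrite big1// => i _.
by rewrite big1// => j _; rewrite mxE cn0.
Qed.

Lemma entry_cpn_norm n (A : 'M[R[i]]_n) i j : cn (A i j) <= cpn_norm p A.
Proof.
have -> : A i j = dot (op A (b j)) (b i).
  rewrite (dot_basis_vec hb) !mxE (bigD1 j)//= big1 => [|k kj].
    by rewrite !mxE hb eqxx mulr1 addr0.
  rewrite !mxE hb; have -> : (j == k :> nat) = false by rewrite eq_sym; exact/negbTE.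
  by rewrite mulr0.
apply: (le_trans (cauchy_schwarz hdot _ _)); rewrite (hn_basis hdot hb) mulr1.
have := bnd_op hdot p2 (b j) (op_lin dot b A) (cpn_norm_bnd hdot p2 hb A).
by rewrite (hn_basis hdot hb) mulr1.
Qed.

Lemma lp_cpn_norm_le (A : mxseq R) M : 0 <= M ->
  (lp_cpn_norm p A <= M%:E)%E <-> (forall K, \sum_(k < K) cpn_norm p (A k) `^ p <= M `^ p).
Proof.
move=> M0; rewrite /lp_cpn_norm (lp_norm_le _ p0 M0).
split=> h K; last by under eq_bigr do rewrite ger0_norm ?cpn_norm_ge0//; exact: h.
by have := h K; under eq_bigr do rewrite ger0_norm ?cpn_norm_ge0//.
Qed.

Lemma lp_cpn_homogeneous (Y : set (mxseq R)) : homogeneous (@lp_cpn_norm R p) Y.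
Proof.
move=> c M x _ c0 M0 /(lp_cpn_norm_le x M0) h.
have cM : 0 <= c * M by rewrite mulr_ge0// ltW.
apply/(lp_cpn_norm_le _ cM) => K; rewrite (powRM p (ltW c0) M0).
apply: (le_trans _ (ler_wpM2l (powR_ge0 _ _) (h K))); rewrite mulr_sumr.
apply: ler_sum => k _; rewrite -(powRM p (ltW c0) (cpn_norm_ge0 p (x k))).
rewrite ler_powR2 ?cpn_norm_ge0//; last by apply: mulr_ge0; [exact: ltW|exact: cpn_norm_ge0].
by apply: (le_trans (cpn_normZ _ _)); rewrite cnR_ge0// ltW.
Qed.

Lemma lp_cpn_minkowski (A B : mxseq R) M N (s : seq nat) : 0 <= M -> 0 <= N ->
  \sum_(k <- s) cpn_norm p (A k) `^ p <= M `^ p ->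
  \sum_(k <- s) cpn_norm p (B k) `^ p <= N `^ p ->
  \sum_(k <- s) cpn_norm p ((A + B) k) `^ p <= (M + N) `^ p.
Proof.
move=> M0 N0 hA hB.
have := @minkowski_bound R p _ s (fun=> 1) (fun k => cpn_norm p (A k))
  (fun k => cpn_norm p (B k)) M N p1 M0 N0.
move=> h; have {}h : \sum_(k <- s) 1 * (cpn_norm p (A k) + cpn_norm p (B k)) `^ p <= (M + N) `^ p.
  apply: h => // [i _|i _||].
  - exact: cpn_norm_ge0.
  - exact: cpn_norm_ge0.
  - by under eq_bigr do rewrite mul1r.
  - by under eq_bigr do rewrite mul1r.
apply: le_trans h; apply: ler_sum => k _.
rewrite mul1r ler_powR2 ?addr_ge0 ?cpn_norm_ge0//.
exact: cpn_normD.
Qed.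

(* Unit vectors are coordinatewise null under [F], so new ones can be chosen
   almost disjointly from a given [z]; sums of [N] of them then have norm
   of order [N^(1/p)], while they have norm [N^(1/2)] in [l2]. *)
Section NoL2.
Variables (F : (nat -> R[i]^o) -> mxseq R) (C : R).
Hypotheses (linF : linear_on (@l2 R) F) (C0 : 0 < C).
Hypothesis hF : forall x M, l2 x -> 0 < M -> (l2_norm x <= M%:E)%E ->
  (lp_cpn_norm p (F x) <= (C * M)%:E)%E.

Let wE k : @l2 R (l2_unit k) := l2_unit_l2 k.

Lemma image_unit_le k K : \sum_(n < K) cpn_norm p (F (l2_unit k) n) `^ p <= C `^ p.
Proof.
have h : (l2_norm (l2_unit k) <= 1%:E :> \bar R)%E.
  apply/l2_norm_le => // L; have := @l2_units_le R [:: k] (fun=> 1) L isT.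
  by rewrite !big_seq1 cn1 scale1r.
have := hF (wE k) ltr01 h; rewrite mulr1 => /lp_cpn_norm_le; apply.
exact: ltW.
Qed.

Lemma image_sum (s : seq nat) (c : nat -> R[i]) :
  F (\sum_(k <- s) c k *: l2_unit k) = \sum_(k <- s) c k *: F (l2_unit k).
Proof.
elim: s => [|k s IH].
  rewrite !big_nil; have := linear_onZ 0 l2_subspace linF (wE 0).
  by rewrite !scale0r.
have hs : @l2 R (\sum_(k <- s) c k *: l2_unit k).
  apply: subspace_sum => [|j _]; first exact: l2_subspace.
  by apply: subspaceZ; [exact: l2_subspace|exact: wE].
by rewrite !big_cons (linF _ (wE k) hs) IH.
Qed.

Lemma mxseqZE a (A : mxseq R) n : (a *: A) n = a *: A n.
Proof. by []. Qed.

Lemma mxseq_sum I (r : seq I) (G : I -> mxseq R) n :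
  (\sum_(k <- r) G k) n = \sum_(k <- r) G k n.
Proof. by elim/big_rec2 : _ => // k A B _ <-. Qed.

(** An entry of [F] is a bounded functional on l_2, so its values on the unit vectors are square
    summable. *)
Lemma image_unit_entry n i j eps : 0 < eps ->
  exists K0, forall k, (K0 <= k)%N -> cn (F (l2_unit k) n i j) <= eps.
Proof.
move=> eps0; pose phi k := F (l2_unit k) n i j.
have hS K : \sum_(k < K) cn (phi k) ^+ 2 <= C ^+ 2.
  rewrite -(big_mkord predT (fun k => cn (phi k) ^+ 2)).
  set S := \sum_(0 <= k < K) _.
  have S0 : 0 <= S by rewrite sumr_ge0// => k _; exact: sqr_ge0.
  have [->|Sn0] := eqVneq S 0; first exact: sqr_ge0.
  have Sgt0 : 0 < S by rewrite lt_def Sn0.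
  (* Conjugate coefficients make the entry of [F v] equal to [S] while |v| is at most the root of
     [S]; boundedness then gives S <= C^2. *)
  pose v := \sum_(0 <= k < K) Num.conj (phi k) *: l2_unit k : nat -> R[i]^o.
  have vl2 : l2 v.
    apply: subspace_sum => [|k _]; first exact: l2_subspace.
    by apply: subspaceZ; [exact: l2_subspace|exact: wE].
  have r0 : 0 < Num.sqrt S by rewrite sqrtr_gt0.
  have hv : (l2_norm v <= (Num.sqrt S)%:E)%E.
    apply/(l2_norm_le _ (ltW r0)) => L; rewrite sqr_sqrtr//.
    apply: (le_trans (l2_units_le _ _ (iota_uniq _ _))).
    by under eq_bigr do rewrite cnJ.
  have Fv : F v n i j = S%:C%C.
    rewrite /v image_sum mxseq_sum summxE /S -sumR; apply: eq_bigr => k _.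
    by rewrite mxseqZE mxE -/(phi k) mulrC mulJ.
  have : S <= C * Num.sqrt S.
    have h := hF vl2 r0 hv.
    have CS : 0 <= C * Num.sqrt S by rewrite mulr_ge0 ?ltW.
    have := (lp_cpn_norm_le _ CS).1 h n.+1; rewrite big_ord_recr/= => h2.
    have : cpn_norm p (F v n) `^ p <= (C * Num.sqrt S) `^ p.
      by apply: le_trans h2; rewrite lerDr sumr_ge0// => k _; exact: powR_ge0.
    rewrite ler_powR2 ?cpn_norm_ge0//; apply: le_trans.
    by apply: le_trans (entry_cpn_norm _ i j); rewrite Fv cnR_ge0.
  rewrite -{1}(sqr_sqrtr S0) expr2 ler_pM2r// => h.
  by rewrite -(sqr_sqrtr S0) ler_sqr ?nnegrE ?sqrtr_ge0// ltW.
have [m hm] := bounded_sum_tail (fun k => sqr_ge0 (cn (phi k))) hS (exprn_gt0 2 eps0).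
exists m => k mk; have := hm k.+1 (leqW mk); rewrite big_nat_recr//= => h.
rewrite -ler_sqr ?nnegrE ?cn_ge0 ?(ltW eps0)//; apply: le_trans h.
by rewrite lerDr sumr_ge0// => l _; exact: sqr_ge0.
Qed.

Lemma image_unit_head m eps : 0 < eps ->
  exists K0, forall k, (K0 <= k)%N -> \sum_(n < m) cpn_norm p (F (l2_unit k) n) `^ p <= eps.
Proof.
elim: m eps => [|m IH] eps eps0.
  by exists 0%N => k _; rewrite big_ord0 ltW.
have e2 : 0 < eps / 2 by rewrite divr_gt0.
have [K1 h1] := IH _ e2.
pose d := (eps / 2) `^ p^-1.
have d0 : 0 < d by rewrite powR_gt0.
pose d' := d / (m.+1 * m.+1)%:R.
have d'0 : 0 < d' by rewrite divr_gt0.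
have [K2 h2] : exists K0, forall k, (K0 <= k)%N -> forall i j, cn (F (l2_unit k) m i j) <= d'.
  have /choice[f hf] : forall ij : 'I_m.+1 * 'I_m.+1, exists K0, forall k, (K0 <= k)%N ->
      cn (F (l2_unit k) m ij.1 ij.2) <= d'.
    by move=> ij; exact: image_unit_entry.
  exists (\max_ij f ij) => k hk i j; apply: (hf (i, j)).
  by apply: leq_trans hk; exact: leq_bigmax.
exists (maxn K1 K2) => k; rewrite geq_max => /andP[k1 k2].
rewrite big_ord_recr/= (splitr eps) lerD ?h1//.
rewrite -[leRHS](powRVK (lt0r_neq0 p0) (ltW e2)) ler_powR2 ?cpn_norm_ge0 ?powR_ge0//.
apply: (le_trans (cpn_norm_entries _)).
apply: (@le_trans _ _ (\sum_(i < m.+1) \sum_(j < m.+1) d')).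
  by apply: ler_sum => i _; apply: ler_sum => j _; exact: h2.
rewrite !sumr_const !card_ord -mulrnA -[leLHS]mulr_natr /d' divfK//.
Qed.

(** Beyond some index m the tail of [z] is negligible, and a late unit vector has a negligible image
    before m. The p-th powers of the norms therefore add, up to 1/2 on either side of m. *)
Lemma add_image_unit (z : mxseq R) B L : 0 <= B ->
  (forall K, \sum_(n < K) cpn_norm p (z n) `^ p <= B) ->
  exists2 k, (L <= k)%N & forall K,
    \sum_(n < K) cpn_norm p ((z + F (l2_unit k)) n) `^ p <= B + (C `^ p + 1).
Proof.
move=> B0 hz; have pn0 := lt0r_neq0 p0.
have h2 : 0 < 2^-1 :> R by rewrite invr_gt0.
have [e1 e10 he1] := powR_continuity p0 (powR_ge0 B p^-1) h2.
have [e2 e20 he2] := powR_continuity p0 (ltW C0) h2.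
rewrite powRVK// in he1.
have [m hm] := bounded_sum_tail (fun n => powR_ge0 (cpn_norm p (z n)) p) hz (powR_gt0 p e20).
have [K0 hK0] := image_unit_head m (powR_gt0 p e10).
exists (maxn L K0) => [|K]; first exact: leq_maxl.
set k := maxn L K0; have {}hK0 := hK0 k (leq_maxr _ _).
set w := F (l2_unit k) in hK0 *.
have mono K1 K2 : (K1 <= K2)%N -> \sum_(n < K1) cpn_norm p ((z + w) n) `^ p <=
    \sum_(n < K2) cpn_norm p ((z + w) n) `^ p.
  move=> h; rewrite -!(big_mkord predT (fun n => cpn_norm p ((z + w) n) `^ p)).
  rewrite [leRHS](big_cat_nat _ (n := K1))//= lerDl sumr_ge0// => n _.
  exact: powR_ge0.
apply: (le_trans (mono _ _ (leq_maxr m K))).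
rewrite -(big_mkord predT (fun n => cpn_norm p ((z + w) n) `^ p)).
rewrite (big_cat_nat _ (n := m)) ?leq_maxl//=.
have t1 : \sum_(0 <= n < m) cpn_norm p ((z + w) n) `^ p <= B + 2^-1.
  apply: le_trans he1; apply: lp_cpn_minkowski; rewrite ?powR_ge0 ?(ltW e10)//.
    by rewrite powRVK// big_mkord.
  by rewrite big_mkord.
have t2 : \sum_(m <= n < maxn m K) cpn_norm p ((z + w) n) `^ p <= C `^ p + 2^-1.
  apply: le_trans he2; rewrite [C + e2]addrC; apply: lp_cpn_minkowski; rewrite ?(ltW C0) ?(ltW e20)//.
    by apply: hm; exact: leq_maxl.
  apply: le_trans (image_unit_le k (maxn m K)).
  rewrite -(big_mkord predT (fun n => cpn_norm p (w n) `^ p)).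
  rewrite [leRHS](big_cat_nat _ (n := m)) ?leq_maxl//= lerDr sumr_ge0// => n _.
  exact: powR_ge0.
by lra.
Qed.

Lemma image_units N : exists s : seq nat, [/\ uniq s, size s = N & forall K,
  \sum_(n < K) cpn_norm p ((\sum_(k <- s) F (l2_unit k)) n) `^ p <= N%:R * (C `^ p + 1)].
Proof.
elim: N => [|N [s [us ss hs]]].
  exists [::]; split=> // K; rewrite big_nil mul0r big1// => n _.
  rewrite (_ : cpn_norm p _ = 0) ?powR0 ?gt_eqF//; apply/eqP; rewrite eq_le cpn_norm_ge0 andbT.
  apply: (le_trans (cpn_norm_entries _)); rewrite big1// => i _; rewrite big1// => j _.
  by rewrite mxE cn0.
have B0 : 0 <= N%:R * (C `^ p + 1) by rewrite mulr_ge0// addr_ge0 ?powR_ge0.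
have [k kL hk] := add_image_unit (\max_(k <- s) k.+1) B0 hs.
exists (k :: s); split=> [||K] /=; rewrite ?ss//.
  rewrite us andbT; apply/negP => ks; move: kL; rewrite (big_rem k)//= geq_max.
  by rewrite ltnn.
have -> : N.+1%:R * (C `^ p + 1) = N%:R * (C `^ p + 1) + (C `^ p + 1).
  by rewrite -natr1 mulrDl mul1r.
have e : \sum_(j <- k :: s) F (l2_unit j) = \sum_(j <- s) F (l2_unit j) + F (l2_unit k).
  by rewrite big_cons; exact: addrC.
rewrite e; exact: hk.
Qed.

(** The sum of the [N] selected unit vectors has norm N^(1/2) in l_2 and image of norm at most (N
    E)^(1/p). A lower bound would keep N^(1 - 2/p) bounded, contrary to p > 2. *)
Lemma no_l2_embedding (D : R) : 0 < D ->
  ~ (forall x M, l2 x -> 0 < M -> (lp_cpn_norm p (F x) <= M%:E)%E ->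
      (l2_norm x <= (D * M)%:E)%E).
Proof.
move=> D0 hD; have pn0 := lt0r_neq0 p0.
pose E := C `^ p + 1; have E0 : 0 < E by rewrite ltr_wpDl ?powR_ge0.
have key N : (0 < N)%N -> N%:R <= (D * E `^ p^-1 * N%:R `^ p^-1) ^+ 2.
  move=> N0; have [s [us ss hs]] := image_units N.
  have NR : 0 < N%:R :> R by rewrite ltr0n.
  have M0 : 0 < (N%:R * E) `^ p^-1 by rewrite powR_gt0 ?mulr_gt0.
  pose x : nat -> R[i]^o := \sum_(k <- s) (1 : R[i]) *: l2_unit k.
  have xl2 : l2 x.
    apply: subspace_sum => [|k _]; first exact: l2_subspace.
    by apply: subspaceZ; [exact: l2_subspace|exact: wE].
  have Fx : (lp_cpn_norm p (F x) <= ((N%:R * E) `^ p^-1)%:E)%E.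
    have -> : F x = \sum_(k <- s) F (l2_unit k).
      by rewrite /x image_sum; apply: eq_bigr => k _; rewrite scale1r.
    apply/(lp_cpn_norm_le _ (ltW M0)) => K.
    have NE : 0 <= N%:R * E by rewrite mulr_ge0 ?(ltW NR) ?(ltW E0).
    by rewrite (powRVK pn0 NE).
  have DM : 0 <= D * (N%:R * E) `^ p^-1 by rewrite mulr_ge0 ?(ltW D0) ?(ltW M0).
  have := (l2_norm_le _ DM).1 (hD x _ xl2 M0 Fx).
  have [K0 hK0] := @l2_units_sum R s (fun=> 1) us.
  move=> /(_ K0); rewrite /x hK0// cn1 expr1n big_const_seq count_predT ss iter_addr addr0.
  by rewrite (powRM _ (ltW NR) (ltW E0)) [_ `^ _ * _ `^ _]mulrC mulrA.
pose A := (D * E `^ p^-1) ^+ 2.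
have A0 : 0 < A by rewrite exprn_gt0// mulr_gt0// powR_gt0.
pose q := 1 - p^-1 * 2.
have q0 : 0 < q by rewrite subr_gt0 mulrC ltr_pdivrMr ?mul1r.
have key2 N : (0 < N)%N -> N%:R `^ q <= A.
  move=> N0; have NR : 0 < N%:R :> R by rewrite ltr0n.
  have := key N N0; rewrite exprMn -/A => h.
  have e2 : (N%:R `^ p^-1) ^+ 2 = N%:R `^ (p^-1 * 2) by rewrite powRrM powR_mulrn ?powR_ge0.
  rewrite e2 in h.
  rewrite /q powRB ?(gt_eqF NR) ?implybT// powRr1 ?(ltW NR)//.
  by rewrite ler_pdivrMr ?powR_gt0.
have := key2 (Num.truncn (A `^ q^-1)).+1 isT; apply/negP; rewrite -ltNge.
rewrite -[ltLHS](powRVK (lt0r_neq0 q0) (ltW A0)).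
by apply: gt0_ltr_powR; rewrite ?nnegrE ?powR_ge0// truncnS_gt.
Qed.

End NoL2.
End MatrixSequences.

(** * Ultrafilter limits and sums over blocks *)

Section RealSums.
Context {R : realType}.

(** Limits along one ultrafilter replace successive extractions of subsequences, so that finitely
    many matrix entries converge simultaneously. *)
Lemma ultra_bounded_real (U : set_system nat) (g : nat -> R) B : UltraFilter U ->
  (forall k, `|g k| <= B) -> exists c, forall eta, 0 < eta -> U [set k | `|g k - c| < eta].
Proof.
move=> UU hg; have := @segment_compact R (- B) B; set K := [set` _] => cK.
have UK : U (g @^-1` K).
  by apply: filterE => k; rewrite /K /= in_itv/= -ler_norml hg.
have [c [_ hc]] := cK (g @ U) _ (UK : (g @ U) K).
exists c => eta eta0; have [//|hn] := in_ultra_setVsetC [set k | `|g k - c| < eta] UU.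
have : (g @ U) (~` [set y | `|y - c| < eta]) by [].
have nc : nbhs c [set y | `|y - c| < eta].
  by apply: filterS (nbhsx_ballx c eta eta0) => y; rewrite -ball_normE/= distrC.
by move=> /hc/(_ nc)[y [? ?]].
Qed.

Lemma cn_le_ReIm (z : R[i]) : cn z <= `|complex.Re z| + `|complex.Im z|.
Proof.
rewrite /cn normc_def/=; set x := complex.Re z; set y := complex.Im z.
rewrite -[leRHS]ger0_norm ?addr_ge0// -sqrtr_sqr ler_wsqrtr// sqrrD !real_normK ?num_real//.
by rewrite addrAC lerDl mulrn_wge0// mulr_ge0.
Qed.

Lemma ReIm_le_cn (z : R[i]) : `|complex.Re z| <= cn z /\ `|complex.Im z| <= cn z.
Proof.
rewrite /cn normc_def/=.
by split; rewrite -sqrtr_sqr ler_wsqrtr// ?lerDl ?lerDr sqr_ge0.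
Qed.

Lemma ultra_bounded (U : set_system nat) (g : nat -> R[i]) B : UltraFilter U ->
  (forall k, cn (g k) <= B) -> exists c, forall eta, 0 < eta -> U [set k | cn (g k - c) < eta].
Proof.
move=> UU hg.
have [x hx] := ultra_bounded_real UU (fun k => le_trans (ReIm_le_cn (g k)).1 (hg k)).
have [y hy] := ultra_bounded_real UU (fun k => le_trans (ReIm_le_cn (g k)).2 (hg k)).
exists (x +i* y)%C => eta eta0; have e2 : 0 < eta / 2 by rewrite divr_gt0.
apply: filterS (filterI (hx _ e2) (hy _ e2)) => k /= [h1 h2].
apply: (le_lt_trans (cn_le_ReIm _)); rewrite (splitr eta).
by move: h1 h2; case: (g k) => s t /= h1 h2; apply: ltrD.
Qed.

Lemma sum_sqr_minkowski (s : seq nat) (f g : nat -> R[i]) M N : 0 <= M -> 0 <= N ->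
  \sum_(k <- s) cn (f k) ^+ 2 <= M ^+ 2 -> \sum_(k <- s) cn (g k) ^+ 2 <= N ^+ 2 ->
  \sum_(k <- s) cn (f k + g k) ^+ 2 <= (M + N) ^+ 2.
Proof.
move=> M0 N0 hf hg; have h12 : (1 : R) <= 2 by rewrite ler1n.
have := @minkowski_bound R 2 _ s (fun=> 1) (fun k => cn (f k)) (fun k => cn (g k)) M N h12 M0 N0.
rewrite !powR_mulrn ?addr_ge0// => h.
have {}h : \sum_(k <- s) 1 * (cn (f k) + cn (g k)) `^ 2 <= (M + N) ^+ 2.
  apply: h => // [i _|i _||].
  - exact: cn_ge0.
  - exact: cn_ge0.
  - by under eq_bigr do rewrite mul1r powR_mulrn ?cn_ge0//; exact: hf.
  - by under eq_bigr do rewrite mul1r powR_mulrn ?cn_ge0//; exact: hg.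
apply: le_trans h; apply: ler_sum => k _.
rewrite mul1r powR_mulrn ?addr_ge0 ?cn_ge0//.
by rewrite ler_sqr ?nnegrE ?addr_ge0 ?cn_ge0// cnD.
Qed.

Lemma sum_geometric (N : nat) : \sum_(n < N) (2 ^+ n.+1)^-1 <= 1 :> R.
Proof.
have : \sum_(n < N) (2 ^+ n.+1)^-1 = 1 - (2 ^+ N)^-1 :> R.
  elim: N => [|N IH]; first by rewrite big_ord0 expr0 invr1 subrr.
  by rewrite big_ord_recr/= IH exprS invfM; field.
by move=> ->; rewrite lerBlDr lerDl invr_ge0 exprn_ge0.
Qed.

Lemma sum_blocks (m : nat -> nat) (F : nat -> R) N : (forall n, (m n <= m n.+1)%N) ->
  \sum_(m 0%N <= j < m N) F j = \sum_(n < N) \sum_(m n <= j < m n.+1) F j.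
Proof.
move=> hm; elim: N => [|N IH]; first by rewrite big_geq// big_ord0.
rewrite big_ord_recr/= -IH (big_cat_nat _ (n := m N))//=.
by elim: N {IH} => // N IH; exact: leq_trans IH (hm N).
Qed.

End RealSums.

(** * Blocks, windows and cuts *)

Section BlockLabels.
Variable m : nat -> nat.
Hypotheses (m0 : m 0%N = 0%N) (hm : forall q, (m q < m q.+1)%N).

Let mle k l : (k <= l)%N -> (m k <= m l)%N.
Proof. by apply: homo_leq leqnn leq_trans _ k l => n; exact: ltnW. Qed.

Lemma block_self k : (k <= m k)%N.
Proof. by elim: k => // k IH; exact: leq_ltn_trans IH (hm k). Qed.

(** The q with m q <= i < m q.+1. Searching up to [i] is enough because q <= m q. *)
Definition block (i : nat) : nat := \max_(q < i.+1 | (m q <= i)%N) q.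

Lemma blockP i : (m (block i) <= i < m (block i).+1)%N.
Proof.
have [q mq qE] : exists2 q : 'I_i.+1, (m q <= i)%N & block i = q.
  have P0 : (m (@ord0 i) <= i)%N by rewrite m0.
  rewrite /block; have [|q mq ->] := @eq_bigmax_cond _ [pred q : 'I_i.+1 | (m q <= i)%N] (fun q => q : nat).
    by apply/card_gt0P; exists ord0; rewrite inE.
  by exists q.
rewrite qE mq/= ltnNge; apply/negP => h.
have qi : (q.+1 < i.+1)%N by rewrite ltnS (leq_trans (block_self _) h).
have := @leq_bigmax_cond _ [pred q : 'I_i.+1 | (m q <= i)%N] (fun q => q : nat) (Ordinal qi) h.
by rewrite -/(block i) qE ltnn.
Qed.

Lemma block_lt i k : (block i < k)%N = (i < m k)%N.
Proof.
have /andP[h1 h2] := blockP i; apply/idP/idP => [h|h].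
  exact: leq_trans h2 (mle h).
rewrite ltnNge; apply/negP => /mle h3.
by have := leq_trans (leq_trans h h3) h1; rewrite ltnn.
Qed.

Lemma block_ge i k : (k <= block i)%N = (m k <= i)%N.
Proof. by rewrite leqNgt block_lt -leqNgt. Qed.

Lemma block_le_self i : (block i <= i)%N.
Proof. by rewrite -ltnS block_lt block_self. Qed.

End BlockLabels.

Section WindowCuts.
Context {R : realType}.

(** A cut between the blocks j and j + 1 at shift r means that N divides j + 1 + r, which determines
    r modulo N. *)
Lemma cut_unique N j r s : (r < N)%N -> (s < N)%N ->
  ((j.+1 + r) %/ N != (j + r) %/ N)%N -> ((j.+1 + s) %/ N != (j + s) %/ N)%N -> r = s.
Proof.
have cut k : (0 < N)%N -> ((j.+1 + k) %/ N != (j + k) %/ N)%N -> ((j.+1 + k) %% N = 0)%N.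
  move=> N0 h; apply/eqP; apply: contraNT h => h; apply/eqP.
  have h1 := divn_eq (j.+1 + k) N; have h2 := ltn_pmod (j.+1 + k) N0.
  have -> : (j + k = (j.+1 + k) %/ N * N + ((j.+1 + k) %% N).-1)%N.
    by move: h h1 h2; set Q := (_ %/ _)%N; set o := (_ %% _)%N; lia.
  rewrite divnMDl// (@divn_small _.-1) ?addn0//; exact: leq_ltn_trans (leq_pred _) h2.
move=> rN sN hr hs; have N0 := leq_ltn_trans (leq0n r) rN.
have /eqP : (j.+1 + r = j.+1 + s %[mod N])%N by rewrite !cut.
by rewrite eqn_modDl !modn_small// => /eqP.
Qed.

Lemma cut_sum N j (c : R) : 0 <= c ->
  \sum_(0 <= r < N) (if ((j.+1 + r) %/ N != (j + r) %/ N)%N then c else 0) <= c.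
Proof.
move=> c0; rewrite big_mkord.
have [[r hr]|h] := pselect (exists r : 'I_N, ((j.+1 + r) %/ N != (j + r) %/ N)%N).
  rewrite (bigD1 r)//= hr big1 ?addr0// => s sr; case: ifP => // hs.
  by move: sr; rewrite -(inj_eq val_inj)/= (cut_unique (ltn_ord s) (ltn_ord r) hs hr) eqxx.
by rewrite big1// => r _; case: ifP => // hr; exfalso; apply: h; exists r.
Qed.

End WindowCuts.

Lemma far_neighbour_split (V : zmodType) (v : V) (k j : nat) : k != j ->
  v = (if k == j.+1 then v else 0) + (if k.+1 == j then v else 0)
    + (if (j.+2 <= k)%N then v else 0) + (if (k.+2 <= j)%N then v else 0).
Proof.
move=> kj; case: (eqVneq k j.+1) => h1; case: (eqVneq k.+1 j) => h2;
  case: (leqP j.+2 k) => h3; case: (leqP k.+2 j) => h4; rewrite ?addr0 ?add0r //; exfalso; lia.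
Qed.

Section Enumeration.
Context {R : realType}.

Lemma sum_range (psi : nat -> nat) (F : nat -> R) Q : (forall q, (psi q < psi q.+1)%N) ->
  (forall n, (forall q, psi q != n) -> F n = 0) ->
  \sum_(n < psi Q) F n = \sum_(q < Q) F (psi q).
Proof.
move=> hpsi F0; have mono k l : (k <= l)%N -> (psi k <= psi l)%N.
  by apply: homo_leq leqnn leq_trans _ k l => n; exact: ltnW.
rewrite -(big_mkord predT F); elim: Q => [|Q IH].
  rewrite big_ord0 big_nat big1// => n /andP[_ hn]; apply: F0 => q.
  by have := mono _ _ (leq0n q); case: eqP => // ->; rewrite leqNgt hn.
rewrite (big_cat_nat _ (n := psi Q)) ?(ltnW (hpsi Q))//= IH big_ord_recr/=; congr (_ + _).
rewrite (big_ltn (hpsi Q)) [X in _ + X]big_nat [X in _ + X]big1 ?addr0// => n /andP[h1 h2].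
apply: F0 => q; have [/mono|/mono] := leqP q Q; case: eqP => // ->.
  by rewrite leqNgt h1.
by rewrite leqNgt h2.
Qed.

Lemma sum_grid (F : nat -> R) N T :
  \sum_(q < T * N) F q = \sum_(0 <= r < N) \sum_(t < T) F (t * N + r)%N.
Proof.
rewrite exchange_big/= -(big_mkord predT F) -(mul0n N).
rewrite (sum_blocks (m := fun t => t * N)%N) => [|t]; last by rewrite leq_mul2r leqnSn orbT.
apply: eq_bigr => t _; rewrite mulSn -[X in \sum_(X <= _ < _) _]add0n big_addn addnK.
by apply: eq_bigr => r _; rewrite addnC.
Qed.

End Enumeration.

Section InverseLinear.
Context {R : realType} {V W : lmodType R[i]}.
Variables (NV : V -> \bar R) (X : set V) (NW : W -> \bar R) (Y : set W).

Lemma inverse_linear T S : linear_subspace X ->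
  surjective_isomorphism NV X NW Y T S -> linear_on Y S.
Proof.
move=> sX [linT XY YX [ST TS] _] a x y Yx Yy.
have Xx := YX _ Yx; have Xy := YX _ Yy; have Xz := sX.2 a _ _ Xx Xy.
rewrite -[LHS](_ : S (T (a *: S x + S y)) = _); first by rewrite ST//; exact/mem_set.
by rewrite linT// !TS//; exact/mem_set.
Qed.

Lemma opnorm_ge0 T : X 0 -> (NV 0 <= 1)%E -> (forall y, 0 <= NW y)%E ->
  (0 <= opnorm NV X NW T)%E.
Proof.
move=> X0 N0 NW0; apply: le_trans (NW0 (T 0)) _.
by apply: ereal_sup_ubound; exists 0.
Qed.

Lemma bm_dist_isomorphic : (bm_dist NV X NW Y < +oo)%E -> isomorphic NV X NW Y.
Proof.
move=> h; apply: contrapT => niso; move: h.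
rewrite /bm_dist (_ : [set TS | _] = set0) ?image_set0 ?ereal_inf0 ?ltxx//.
by rewrite -subset0 => -[T S] /= iso; apply: niso; exists T, S.
Qed.

End InverseLinear.

(** * Closed subspaces of c_p *)

Section ClosedSubspaces.
Context {R : realType} {H : completeNormedModType R[i]}.
Variable dot : {dot H for Num.conj}.
Hypothesis sepH : separable_infdim_hilbert dot.
Variable p : R.
Hypothesis p2 : 2 < p.
Variable b : nat -> H.
Hypothesis hb : forall i j, dot (b i) (b j) = (i == j)%:R.
Hypothesis cb : forall x eps, 0 < eps -> exists N, forall n, (N <= n)%N ->
  hn (x - oproj dot b predT n x) <= eps.
Implicit Types (T S : H -> H).
Local Notation hdot := (hilbert_dot sepH).
Local Notation bnd := (bnd dot p).
Local Notation nrm := (nrm dot p).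
Local Notation proj := (oproj dot b).
Local Notation P := (proj predT).

Let p0 : 0 < p. Proof. by apply: lt_trans p2. Qed.
Let p1 : 1 <= p. Proof. by apply/ltW/(lt_trans _ p2); rewrite ltr1n. Qed.
Let pn0 : p != 0. Proof. by rewrite gt_eqF. Qed.
Let hbo : orthosystem dot b. Proof. by have := orthosystem_basis hdot hb. Qed.

Lemma bnd_projr A n T M : bnd T M -> bnd (fun u => T (proj A n u)) M.
Proof.
apply: (bnd_comp (Q := proj A n)) => [u|u y]; first exact: (hn_proj hdot hbo).
exact: proj_dot.
Qed.

Lemma bnd_projl A n T M : bnd T M -> bnd (fun u => proj A n (T u)) M.
Proof. by apply: (bnd_le p2) => u; exact: (hn_proj hdot hbo). Qed.

(** Removing the first [K] singular vectors leaves a diagonal operator whose first [K] coefficients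
    are replaced by 0. *)
Lemma svd_tail T e (C : R) K eta : linear T -> (forall u, hn (T u) <= C * hn u) ->
  svd dot T (singular_values dot T) e -> 0 <= eta ->
  (forall K', (K <= K')%N -> \sum_(K <= k < K') singular_values dot T k `^ p <= eta `^ p) ->
  bnd (fun u => T (u - oproj dot e predT K u)) eta.
Proof.
move=> linT bT hs eta0 htail; pose sv := singular_values dot T.
have [he hsv _ _] := hs.
have sv0 k : 0 <= sv k by rewrite /sv -hsv hn_ge0.
pose sv' k := if (k < K)%N then 0 else sv k.
have sv'0 k : 0 <= sv' k by rewrite /sv'; case: ifP.
have split_sum (F : R -> nat -> R) K' : (forall k, F 0 k = 0) -> (K <= K')%N ->
    \sum_(k < K') F (sv' k) k = \sum_(K <= k < K') F (sv k) k.
  move=> F0 KK; rewrite -(big_mkord predT (fun k => F (sv' k) k)).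
  rewrite (big_cat_nat _ (n := K))//= big_nat big1 ?add0r => [|k /andP[_ kK]]; last first.
    by rewrite /sv' kK F0.
  by apply: eq_big_nat => k /andP[Kk _]; rewrite /sv' ltnNge Kk.
apply: (bnd_diag hdot p2 he sv'0 eta0) => [K'|u eps eps0].
  have [KK|/ltnW KK] := leqP K K'.
    rewrite (split_sum (fun r _ => r `^ p))//; last by move=> _; rewrite powR0.
    exact: htail.
  rewrite big1 ?powR_ge0// => k _; rewrite /sv' (leq_trans (ltn_ord k) KK).
  by rewrite powR0.
have e0 : 0 < Num.sqrt eps by rewrite sqrtr_gt0.
have [K1 hK1] := svd_approx hdot linT bT hs u e0.
exists (maxn K K1) => K'; rewrite geq_max => /andP[KK K1K].
rewrite (split_sum (fun r k => r ^+ 2 * cn (dot u (e k)) ^+ 2))//; last first.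
  by move=> k; rewrite expr0n mul0r.
have e1 := svd_pyth hdot linT hs u K; have e2 := svd_pyth hdot linT hs u K'.
have h := hK1 K' K1K.
have h2 : hn (T (u - oproj dot e predT K' u)) ^+ 2 <= eps.
  by rewrite -[leRHS](sqr_sqrtr (ltW eps0)) ler_sqr ?nnegrE ?hn_ge0 ?sqrtr_ge0.
move: e2; rewrite e1.
rewrite -!(big_mkord predT (fun k => sv k ^+ 2 * cn (dot u (e k)) ^+ 2)).
rewrite [X in _ = X + _ -> _](big_cat_nat _ (n := K))//= -addrA => /addrI ->.
by rewrite lerD2l.
Qed.

Lemma corner_rank1 a c eps : 0 < eps -> exists m0, forall m, (m0 <= m)%N ->
  bnd (fun u => dot u a *: c - P m (dot (P m u) a *: c)) eps.
Proof.
move=> eps0.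
have e1 : 0 < eps / 2 / (hn c + 1) by rewrite !divr_gt0// ltr_wpDl ?hn_ge0.
have e2 : 0 < eps / 2 / (hn a + 1) by rewrite !divr_gt0// ltr_wpDl ?hn_ge0.
have [m1 h1] := cb a e1; have [m2 h2] := cb c e2.
exists (maxn m1 m2) => m; rewrite geq_max => /andP[/h1 {}h1 /h2 {}h2].
have b1 : bnd (fun u => dot u (a - P m a) *: c) (hn (a - P m a) * hn c).
  by apply: (bnd_rank1 hdot p2) => [|u]; rewrite ?hn_ge0// hnZ.
have b2 : bnd (fun u => dot u (P m a) *: (c - P m c)) (hn (P m a) * hn (c - P m c)).
  by apply: (bnd_rank1 hdot p2) => [|u]; rewrite ?hn_ge0// hnZ.
have b3 := bndD p2 b1 b2.
apply: (bndW p2 _ (eq_bnd p2 _ b3)) => [|u]; last first.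
  rewrite projZ (proj_dot _ _ _ _ u) dotBr scalerBl scalerBr addrA subrK.
  by [].
have t1 : hn (a - P m a) * hn c <= eps / 2.
  apply: (le_trans (ler_wpM2r (hn_ge0 c) h1)).
  by rewrite mulrAC ler_pdivrMr ?ltr_wpDl ?hn_ge0// ler_pM2l ?divr_gt0// lerDl.
have t2 : hn (P m a) * hn (c - P m c) <= eps / 2.
  apply: (le_trans (ler_wpM2l (hn_ge0 _) h2)).
  apply: (le_trans (ler_wpM2r (ltW e2) (hn_proj hdot hbo _ _ _))).
  by rewrite mulrC mulrAC ler_pdivrMr ?ltr_wpDl ?hn_ge0// ler_pM2l ?divr_gt0// lerDl.
by rewrite (splitr eps) lerD.
Qed.

(** [T] is a finite sum of rank one operators, each well approximated by its corners, plus a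
    remainder with small singular values. One third of [eps] goes to the finite part, one to the
    remainder and one to its corner. *)
Lemma corner_approx T eps : cp dot p T -> 0 < eps -> exists m0, forall m, (m0 <= m)%N ->
  bnd (fun u => T u - P m (T (P m u))) eps.
Proof.
move=> hT eps0; have linT := cp_linear hT; have [cT _] := hT.
have [e hs sv0] := compact_svd sepH cT; have [C hC] := compact_bounded cT.
have e3 : 0 < eps / 3 by rewrite divr_gt0.
have hsum K : \sum_(k < K) singular_values dot T k `^ p <= nrm T `^ p.
  exact: (bnd_svd hdot hs K (cp_bnd sepH p2 hT)).
have [K hK] := bounded_sum_tail (fun k => powR_ge0 (singular_values dot T k) p) hsum (powR_gt0 p e3).
pose F u := T (oproj dot e predT K u).
pose Q u := T (u - oproj dot e predT K u).
have bQ : bnd Q (eps / 3) by exact: svd_tail linT hC hs (ltW e3) hK.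
have TE u : T u = F u + Q u by rewrite /F /Q -(linmD linT) [_ + (u - _)]addrC subrK.
have [m0 hm0] : exists m0, forall m, (m0 <= m)%N -> bnd (fun u => F u - P m (F (P m u))) (eps / 3).
  have dK : 0 < eps / 3 / K.+1%:R by rewrite divr_gt0.
  have /choice[f hf] : forall k, exists m0, forall m, (m0 <= m)%N ->
      bnd (fun u => dot u (e k) *: T (e k) - P m (dot (P m u) (e k) *: T (e k))) (eps / 3 / K.+1%:R).
    by move=> k; exact: corner_rank1.
  exists (\max_(k < K) f k) => m hm.
  have hF u : F u = \sum_(k < K) dot u (e k) *: T (e k).
    rewrite /F /oproj (linm_sum linT); apply: eq_bigr => k _.
    by rewrite (linmZ linT).
  have bs : bnd (fun u => \sum_(k < K) (dot u (e k) *: T (e k) - P m (dot (P m u) (e k) *: T (e k))))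
      (\sum_(k < K) eps / 3 / K.+1%:R).
    apply: (bnd_sum p2) => k _; apply: hf; apply: leq_trans hm.
    exact: (leq_bigmax (F := fun k : 'I_K => f k)).
  apply: (bndW p2 _ (eq_bnd p2 _ bs)) => [|u].
    rewrite sumr_const card_ord -[leLHS]mulr_natr mulrAC ler_pdivrMr//.
    by rewrite ler_pM2l// ler_nat.
  by rewrite !hF (linm_sum (proj_lin dot b predT m)) sumrB.
exists m0 => m /hm0 bF.
have bQ2 := bndB p2 bQ (bnd_projl predT m (bnd_projr predT m bQ)).
apply: (bndW p2 _ (eq_bnd p2 _ (bndD p2 bF bQ2))) => [|u]; first by lra.
by rewrite !TE projD opprD addrACA.
Qed.

Lemma bnd_corner_entries T m : linear T ->
  bnd (fun u => P m (T (P m u))) (\sum_(i < m) \sum_(j < m) cn (dot (T (b j)) (b i))).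
Proof.
move=> linT.
have := op_bnd hdot p2 hb (mxof dot b m T).
rewrite (eq_bigr (fun i : 'I_m => \sum_(j < m) cn (dot (T (b j)) (b i)))).
  by apply: (eq_bnd p2) => u; rewrite (op_mxof dot b m linT).
by move=> i _; apply: eq_bigr => j _; rewrite mxE.
Qed.

(* [line r i T] is the [i]-th row of the matrix of [T] if [r] holds, and its
   [i]-th column otherwise. *)
Definition line (r : bool) (i : nat) T (j : nat) : R[i] :=
  if r then dot (T (b j)) (b i) else dot (T (b i)) (b j).

(** A column is the image of a basis vector, so Bessel applies. For a row, [T] is tested on the
    vector whose coordinates are the conjugate entries of that row. *)
Lemma line_bnd r i T M K : linear T -> bnd T M ->
  \sum_(j < K) cn (line r i T j) ^+ 2 <= M ^+ 2.
Proof.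
move=> linT hT; have hop u : hn (T u) <= M * hn u by exact: (bnd_op hdot p2).
case: r => /=; last first.
  apply: (le_trans (bessel_ineq hdot hbo predT K _)).
  rewrite ler_sqr ?nnegrE ?hn_ge0 ?hT.1//.
  by have := hop (b i); rewrite (hn_basis hdot hb) mulr1.
set S := \sum_(j < K) _; have S0 : 0 <= S by rewrite sumr_ge0// => j _; exact: sqr_ge0.
pose v := \sum_(j < K) Num.conj (dot (T (b j)) (b i)) *: b j.
have hv : hn v ^+ 2 = S.
  rewrite /v (hn2_sum hdot) => [|j k jk]; last first.
    by rewrite dotZl dotZr hb; have /negbTE -> : (j != k :> nat) by []; rewrite !mulr0.
  by apply: eq_bigr => j _; rewrite hnZ cnJ (hn_basis hdot hb) mulr1.
have Sv : S <= M * hn v.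
  apply: le_trans (hop v); apply: le_trans (_ : cn (dot (T v) (b i)) <= _); last first.
    by apply: (le_trans (cauchy_schwarz hdot _ _)); rewrite (hn_basis hdot hb) mulr1.
  have -> : dot (T v) (b i) = S%:C%C.
    rewrite /v (linm_sum linT) dot_suml -sumR; apply: eq_bigr => j _.
    by rewrite (linmZ linT) dotZl mulrC mulJ.
  by rewrite cnR_ge0.
rewrite -hv; move: Sv; rewrite -hv expr2.
have [->|hv0] := eqVneq (hn v) 0; first by rewrite mulr0 sqr_ge0.
rewrite ler_pM2r ?lt_def ?hv0 ?hn_ge0// => h.
by rewrite -expr2 ler_sqr ?nnegrE ?hn_ge0 ?hT.1.
Qed.

(* The adjoint of a sum of operators with pairwise orthogonal initial spaces
   is a sum of operators with pairwise orthogonal ranges. *)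
Lemma bnd_cols m N (S : 'I_N -> H -> H) (A : 'I_N -> pred nat) (a : 'I_N -> R[i]) c C :
  (forall n, linear (S n)) -> (forall n, bnd (S n) C) -> 0 <= C -> 0 <= c ->
  (forall n k i, n != k -> ~~ (A n i && A k i)) ->
  \sum_n cn (a n) ^+ 2 <= c ^+ 2 ->
  bnd (fun u => \sum_n a n *: P m (S n (proj (A n) m u))) (c * C).
Proof.
move=> linS hS C0 c0 disj hc.
set T := fun u => _.
have PP A0 x : proj A0 m (P m x) = proj A0 m x.
  by rewrite (proj_proj hdot hbo); apply: eq_proj => i _ /=; rewrite andbT.
have PP' A0 x : P m (proj A0 m x) = proj A0 m x.
  by rewrite (proj_proj hdot hbo); apply: eq_proj.
have linT : linear T.
  move=> al x y; rewrite /T scaler_sumr -big_split/=; apply: eq_bigr => n _.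
  by rewrite proj_lin linS proj_lin scalerDr !scalerA mulrC.
(* [T] lives on the first [m] coordinates, hence is the operator of a matrix, for which invariance
   under adjoints is available. *)
pose B := mxof dot b m T.
have TB : op dot b B =1 T.
  move=> u; rewrite (op_mxof dot b m linT) /T (linm_sum (proj_lin dot b predT m)).
  apply: eq_bigr => n _; rewrite projZ PP' PP.
  by [].
pose Bn n := mxof dot b m (S n).
pose T' y := \sum_n Num.conj (a n) *: proj (A n) m (op dot b ((Bn n) ^t*)%sesqui y).
have adj x y : dot (T x) y = dot x (T' y).
  rewrite /T /T' dot_suml dot_sumr; apply: eq_bigr => n _.
  rewrite dotZl dotZr conjCK -(proj_dot dot b (A n) m x) -op_adj//.
  by rewrite (op_mxof dot b m (linS n)) PP'.
have T'E : op dot b (B ^t*)%sesqui =1 T'.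
  move=> y; apply/eqP; rewrite -subr_eq0 -hn_eq0 -sqrf_eq0 -(inj_eq (@complexI R)).
  by rewrite -(dotxx hdot) dotBr -op_adj// -adj TB subrr.
have bB : bnd (op dot b (B ^t*)%sesqui) (c * C).
  apply: (eq_bnd p2 T'E).
  apply: (bnd_rows p2 (S := fun n => op dot b ((Bn n) ^t*)%sesqui)
    (a := fun n => cn (a n) ^+ 2) _ _ C0 c0 hc) => [n|n|u].
  - apply: (op_adj_bnd hdot p2 hb); apply: (eq_bnd p2 (op_mxof dot b m (linS n))).
    by apply: bnd_projl; exact: bnd_projr.
  - exact: sqr_ge0.
  rewrite /T' (hn2_sum hdot) => [|n k nk]; last first.
    rewrite dotZl dotZr proj_dot (proj_disj hdot hbo) ?dot0r ?mulr0// => i _.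
    by rewrite andbC; apply: disj; rewrite eq_sym.
  apply: ler_sum => n _; rewrite hnZ cnJ exprMn ler_wpM2l ?sqr_ge0//.
  by rewrite ler_sqr ?nnegrE ?hn_ge0// (hn_proj hdot hbo).
apply: (eq_bnd p2 (fun u => esym (TB u))).
by have := op_adj_bnd hdot p2 hb bB; rewrite trmxCK.
Qed.

(** * Upper and lower l_2 estimates for humps *)

Section GlidingHump.
Variables (r : bool) (i : nat).

Lemma proj_basis A q j : proj A q (b j) = if A j && (j < q)%N then b j else 0.
Proof.
rewrite /oproj; case: ifPn => [/andP[Aj jq]|h].
  rewrite (bigD1 (Ordinal jq))//= hb eqxx scale1r big1 ?addr0// => k /andP[_ kj].
  have /negbTE jk : (j != k :> nat) by rewrite eq_sym.
  by rewrite hb jk scale0r.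
rewrite big1// => k Ak; rewrite hb; case: eqP => [jk|]; last by rewrite scale0r.
by move: h; rewrite jk Ak ltn_ord.
Qed.

Lemma line_corner T q j : linear T ->
  line r i (fun x => P q (T (P q x))) j = if (i < q)%N && (j < q)%N then line r i T j else 0.
Proof.
move=> linT; rewrite /line; case: r; rewrite (dot_proj hdot hbo) proj_basis /=.
  by case: (ltnP i q) => //= iq; case: ifP => //; rewrite (linm0 linT) dot0l.
by case: (ltnP i q) => iq; case: (ltnP j q) => jq//=; rewrite (linm0 linT) dot0l.
Qed.

Lemma line_sum I (s : seq I) (a : I -> R[i]) (S : I -> H -> H) j :
  line r i (fun x => \sum_(k <- s) a k *: S k x) j = \sum_(k <- s) a k * line r i (S k) j.
Proof.
by rewrite /line; case: r; rewrite dot_suml; apply: eq_bigr => k _; rewrite dotZl.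
Qed.

Lemma lineB S T j : line r i (fun x => S x - T x) j = line r i S j - line r i T j.
Proof. by rewrite /line; case: r; rewrite dotBl. Qed.

(* [v] is the difference of two nested corners of [u]; on a vector this is an
   orthogonal sum of rows plus a sum acting on orthogonal columns. *)
Lemma bnd_humps (m : nat -> nat) (u : nat -> H -> H) N (a : nat -> R[i]) c C :
  (forall n, (m n <= m n.+1)%N) -> (forall n, linear (u n)) -> (forall n, bnd (u n) C) ->
  0 <= C -> 0 <= c -> \sum_(n < N) cn (a n) ^+ 2 <= c ^+ 2 ->
  bnd (fun x => \sum_(n < N) a n *: (P (m n.+1) (u n (P (m n.+1) x)) - P (m n) (u n (P (m n) x))))
    (c * C + c * C).
Proof.
move=> hm linu hu C0 c0 hc.
have mle k l : (k <= l)%N -> (m k <= m l)%N by move=> kl; exact: homo_leq leqnn leq_trans hm k l kl.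
pose M := m N; pose L k := fun j => (j < m k)%N.
pose D n := fun j => (m n <= j < m n.+1)%N.
have PL k x : (k <= N)%N -> P (m k) x = proj (L k) M x.
  by move=> kN; rewrite (proj_widen _ _ _ _ (mle _ _ kN)).
have LD k x : proj (L k.+1) M x = proj (L k) M x + proj (D k) M x.
  rewrite /oproj (bigID (fun j : 'I_M => (j < m k)%N))/=; congr (_ + _); apply: eq_bigl => j.
    by rewrite /L; case: (ltnP j (m k)) => //= h; rewrite ?andbT ?andbF// (leq_trans h).
  by rewrite /L /D -leqNgt andbC.
have disj n k j : n != k -> ~~ (D n j && D k j).
  rewrite /D; apply: contraNN => /andP[/andP[n1 n2] /andP[k1 k2]].
  rewrite eqn_leq; apply/andP; split; rewrite leqNgt; apply/negP => h.
    by have := leq_trans k2 (leq_trans (mle _ _ h) n1); rewrite ltnn.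
  by have := leq_trans n2 (leq_trans (mle _ _ h) k1); rewrite ltnn.
have b1 : bnd (fun x => \sum_(n < N) a n *: proj (D n) M (u n (proj (L n.+1) M x))) (c * C).
  apply: (bnd_rows p2 (S := fun (n : 'I_N) x => u n (proj (L n.+1) M x))
    (a := fun n : 'I_N => cn (a n) ^+ 2) _ _ C0 c0 hc) => [n|n|x].
  - exact: bnd_projr.
  - exact: sqr_ge0.
  rewrite (hn2_sum hdot) => [|n k nk]; last first.
    by rewrite dotZl dotZr proj_dot (proj_disj hdot hbo) ?dot0r ?mulr0// => j _; exact: disj.
  apply: ler_sum => n _; rewrite hnZ exprMn ler_wpM2l ?sqr_ge0//.
  by rewrite ler_sqr ?nnegrE ?hn_ge0// (hn_proj hdot hbo).
have b2 : bnd (fun x => \sum_(n < N) a n *: P M (proj (L n) M (u n (proj (D n) M x)))) (c * C).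
  apply: (bnd_cols M (S := fun (n : 'I_N) x => proj (L n) M (u n x))
    (A := fun n : 'I_N => D n) (a := fun n : 'I_N => a n) _ _ C0 c0 _ hc).
  - by move=> n al x y; rewrite linu proj_lin.
  - by move=> n; exact: bnd_projl.
  - by move=> n k j nk; exact: disj.
apply: (eq_bnd p2 _ (bndD p2 b1 b2)) => x; rewrite -big_split/=; apply: eq_bigr => n _.
rewrite -scalerDr; congr (_ *: _).
have -> y : P M (proj (L n) M y) = proj (L n) M y.
  by rewrite (proj_proj hdot hbo); apply: eq_proj.
rewrite !PL ?(ltnW (ltn_ord n))//; have -> : proj (D n) M x = proj (L n.+1) M x - proj (L n) M x.
  by rewrite LD addrAC subrr add0r.
rewrite (linmB (linu n)) projB (LD n (u n _)); set y1 := proj (D n) M _.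
set y2 := proj (L n) M (u n (proj (L n.+1) M x)).
by rewrite addrA [y1 + y2]addrC.
Qed.

(** Between m n and m n.+1 only the n-th hump meets the line: earlier humps end before m n, and for
    later ones both nested corners contain the entry, so that it cancels. The line contains i < m 0
    and thus meets every corner. *)
Lemma line_humps (m : nat -> nat) (u : nat -> H -> H) N (a : nat -> R[i]) delta B :
  (forall n, (m n <= m n.+1)%N) -> (i < m 0%N)%N -> (forall n, linear (u n)) ->
  (forall n, delta ^+ 2 <= \sum_(m n <= j < m n.+1) cn (line r i (u n) j) ^+ 2) ->
  bnd (fun x => \sum_(n < N) a n *: (P (m n.+1) (u n (P (m n.+1) x)) - P (m n) (u n (P (m n) x)))) B ->
  delta ^+ 2 * \sum_(n < N) cn (a n) ^+ 2 <= B ^+ 2.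
Proof.
move=> hm im linu hu; set V := fun x => _ => hV.
have mle k l : (k <= l)%N -> (m k <= m l)%N by move=> kl; exact: homo_leq leqnn leq_trans hm k l kl.
have linV : linear V.
  move=> al x y; rewrite /V scaler_sumr -big_split/=; apply: eq_bigr => n _.
  by rewrite !(proj_lin, linu); rewrite opprD addrACA scalerDr -scalerBr scalerA mulrC -scalerA.
apply: le_trans (line_bnd r i (m N) linV hV).
rewrite -(big_mkord predT (fun j => cn (line r i V j) ^+ 2)).
apply: le_trans (_ : \sum_(m 0%N <= j < m N) cn (line r i V j) ^+ 2 <= _); last first.
  by rewrite [leRHS](big_cat_nat _ (n := m 0%N)) ?mle//= lerDr sumr_ge0// => j _; exact: sqr_ge0.
rewrite sum_blocks// mulr_sumr; apply: ler_sum => n _.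
rewrite mulrC; apply: le_trans (ler_wpM2l (sqr_ge0 (cn (a n))) (hu n)) _.
rewrite mulr_sumr big_nat [leRHS]big_nat; apply: ler_sum => j /andP[j1 j2].
suff -> : line r i V j = a n * line r i (u n) j by rewrite cnM exprMn.
rewrite /V line_sum (bigD1 n)//= big1 ?addr0 => [|k kn].
  rewrite lineB !line_corner// j2 (ltnNge j (m n)) j1 andbF subr0.
  by rewrite (leq_trans im (mle 0%N n.+1 (leq0n _))).
rewrite lineB !line_corner// !(leq_trans im (mle 0%N _ (leq0n _)))/=.
have [kn'|nk] := ltnP k n.
  have h1 := leq_trans (mle k.+1 n kn') j1.
  by rewrite !ltnNge h1 (leq_trans (hm k) h1) subrr mulr0.
have {}nk : (n < k)%N by rewrite ltn_neqAle nk andbT eq_sym.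
have h1 := leq_trans j2 (mle n.+1 k nk).
by rewrite h1 (leq_trans h1 (hm k)) subrr mulr0.
Qed.
End GlidingHump.

(** * Window decomposition of almost block tridiagonal operators *)

Section Windows.
Implicit Types (A B : pred nat).

(** The right-hand side refers to labels only through [y (lab i)]; this allows a sum over blocks to
    be regrouped as a sum over windows. *)
Lemma label_sum K L (lab : nat -> nat) (y : nat -> H) :
  (forall i, (i < K)%N -> (lab i < L)%N) ->
  \sum_(t < L) proj (fun i => lab i == t) K (y t) = \sum_(i < K) dot (y (lab i)) (b i) *: b i.
Proof.
move=> h; rewrite /oproj (exchange_big_dep predT)//=; apply: eq_bigr => i _.
rewrite (bigD1 (Ordinal (h i (ltn_ord i))))//= big1 ?addr0// => t /andP[/eqP ht tn].
by move: tn; rewrite -(inj_eq val_inj)/= ht eqxx.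
Qed.

Variables (T : H -> H) (a : R).
Hypotheses (linT : linear T) (hT : bnd T a).
Variable m : nat -> nat.
Hypotheses (m0 : m 0%N = 0%N) (hm : forall q, (m q < m q.+1)%N).
Variables (delta : nat -> R) (eps : R).
Hypotheses (delta0 : forall q, 0 < delta q) (hdelta : forall Q, \sum_(q < Q) delta q <= eps).
Hypothesis tails : forall q K A B, (forall j, A j -> (j < m q)%N) ->
  (forall j, B j -> (m q.+1 <= j)%N) ->
  bnd (fun u => proj A K (T (proj B K u))) (delta q * a) /\
  bnd (fun u => proj B K (T (proj A K u))) (delta q * a).
Variable N : nat.
Hypothesis N0 : (0 < N)%N.
Variable K : nat.

Local Notation blk := (block m).
(* Shifted by [r], windows consist of [N] consecutive blocks; for [r > 0] the
   first one is shorter. *)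
Definition window (r i : nat) : nat := ((blk i + r) %/ N)%N.
Local Notation cutp r j := (((j.+1 + r) %/ N)%N != ((j + r) %/ N)%N).
Local Notation E A := (proj A K).

Let a0 : 0 <= a. Proof. by case: hT. Qed.
Let blkK i : (i < K)%N -> (blk i < K)%N.
Proof. by move=> iK; apply: leq_ltn_trans (block_le_self m0 hm i) iK. Qed.

Let in_window r j i := window r i == ((j + r) %/ N)%N.
Let right1 r j i := (blk i == j.+1) && ~~ in_window r j i.
Let left1 r j i := ((blk i).+1 == j) && ~~ in_window r j i.
Let far_right r j i := (j.+2 <= blk i)%N && ~~ in_window r j i.
Let far_left r j i := ((blk i).+2 <= j)%N && ~~ in_window r j i.

(** Seen from block [j], a column lies in the same window, or across a cut in the next or previous
    block, or at least two blocks away on either side. *)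
Lemma split_row r j u : E predT u = E (in_window r j) u + E (right1 r j) u + E (left1 r j) u
  + E (far_right r j) u + E (far_left r j) u.
Proof.
rewrite /oproj !(big_mkcond (fun i : 'I_K => _ (i : nat)))/= -!big_split/=.
apply: eq_bigr => i _; rewrite /right1 /left1 /far_right /far_left.
case iw : (in_window r j i); first by rewrite !andbF !addr0.
rewrite !andbT add0r; apply: far_neighbour_split.
by apply/eqP => e; move: iw; rewrite /in_window /window e eqxx.
Qed.

Local Notation row_sum A r := (fun u => \sum_(j < K) E (fun i => blk i == j) (T (E (A r (j : nat)) u))).

Lemma window_split r u : E predT (T (E predT u)) =
  row_sum in_window r u + row_sum right1 r u + row_sum left1 r u
  + row_sum far_right r u + row_sum far_left r u.
Proof.
rewrite -!big_split/= (proj_comp_partition dot b _ blkK); apply: eq_bigr => j _.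
by rewrite {1}(split_row r j) !(linmD linT) !projD.
Qed.

Lemma hn2_row_sum (A : nat -> nat -> pred nat) r u :
  hn (row_sum A r u) ^+ 2 = \sum_(j < K) hn (E (fun i => blk i == j) (T (E (A r j) u))) ^+ 2.
Proof. exact: (hn2_sum_proj hdot hbo). Qed.

(** Regrouped by windows, the part inside the windows is block diagonal. [K + N] exceeds every
    window label of an index below [K]. *)
Lemma row_sum_windows r (g : nat -> R) : (r < N)%N ->
  (forall t, 0 <= g t) ->
  (forall t, bnd (fun u => E (fun i => window r i == t) (T (E (fun i => window r i == t) u))) (g t)) ->
  bnd (row_sum in_window r) ((\sum_(t < K + N) g t `^ p) `^ p^-1).
Proof.
move=> rN g0 hg; pose W t := fun i => window r i == t.
have wlt i : (i < K)%N -> (window r i < K + N)%N.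
  move=> iK; apply: leq_ltn_trans (leq_div _ _) _.
  by have := blkK iK; lia.
have eqG u : row_sum in_window r u = \sum_(t < K + N) E (W t) (T (E (W t) u)).
  rewrite (label_sum (fun j => T (E (in_window r j) u)) blkK).
  by rewrite (label_sum (fun t => T (E (W t) u)) wlt).
apply: (eq_bnd p2 eqG).
apply: (bnd_blocks_ge p2 (Q := fun t : 'I_(K + N) => E (W t))
  (S := fun (t : 'I_(K + N)) y => E (W t) (T (E (W t) y))) (N := fun t : 'I_(K + N) => g t)).
- by move=> t al x y; rewrite proj_lin linT proj_lin.
- by move=> t; exact: hg.
- by move=> t x y; exact: proj_dot.
- by move=> y; exact: (sum_hn2_proj hdot hbo).
- move=> u; rewrite (hn2_sum_proj hdot hbo); apply: ler_sum => t _.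
  by rewrite (proj_idem hdot hbo).
- exact: powR_ge0.
- by rewrite powRVK ?sumr_ge0// => t _; exact: powR_ge0.
Qed.

(* Both neighbouring diagonals are block sums whose initial spaces [Q j] are
   orthogonal; only the blocks meeting a cut contribute. *)
Lemma row_sum_diagonal (A : nat -> nat -> pred nat) (B : nat -> pred nat) (k : nat -> nat) r :
  (forall j i, A r j i = B j i && cutp r (k j)) ->
  (forall y, \sum_(j < K) hn (E (B j) y) ^+ 2 <= hn y ^+ 2) ->
  bnd (row_sum A r) ((\sum_(j < K) (if cutp r (k j) then nrm (T \o E (B j)) `^ p else 0)) `^ p^-1).
Proof.
move=> hA hB; pose c j : R := nrm (T \o E (B j)).
have hc j : bnd (T \o E (B j)) (c j).
  exact: (nrmP p2 (bnd_projr (B j) K hT)).1.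
have c0 j : 0 <= c j by case: (hc j).
have EA j u : E (A r j) u = if cutp r (k j) then E (B j) u else 0.
  case: ifP => hcut.
    by apply: eq_proj => i _; rewrite hA hcut andbT.
  by rewrite /oproj big1// => i; rewrite hA hcut andbF.
apply: (bnd_blocks_ge p2 (Q := fun j : 'I_K => E (B j))
  (S := fun (j : 'I_K) y => if cutp r (k j) then E (fun i => blk i == j) (T (E (B j) y)) else 0)
  (N := fun j : 'I_K => if cutp r (k j) then c j else 0)).
- move=> j al x y; case: ifP => _; last by rewrite scaler0 addr0.
  by rewrite proj_lin linT proj_lin.
- move=> j; case: ifP => _; last exact: (bnd0 dot p2).
  by apply: bnd_projl; exact: hc.
- by move=> j x y; exact: proj_dot.
- exact: hB.
- move=> u; rewrite hn2_row_sum; apply: ler_sum => j _.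
  rewrite EA; case: ifP => _; first by rewrite (proj_idem hdot hbo).
  by rewrite (linm0 linT) proj0.
- exact: powR_ge0.
- rewrite powRVK//; last by rewrite sumr_ge0// => j _; case: ifP => // _; exact: powR_ge0.
  by apply: ler_sum => j _; case: ifP => // _; rewrite powR0.
Qed.

(** Each pair of neighbouring blocks is cut for at most one shift, so the sum over all shifts counts
    every block of the diagonal at most once. *)
Lemma diagonal_sum (B : nat -> pred nat) (k : nat -> nat) :
  (forall y, \sum_(j < K) hn (E (B j) y) ^+ 2 <= hn y ^+ 2) ->
  \sum_(0 <= r < N) \sum_(j < K) (if cutp r (k j) then nrm (T \o E (B j)) `^ p else 0) <= a `^ p.
Proof.
move=> hB; rewrite exchange_big/=.
apply: le_trans (bnd_blocks_le p2 (Q := fun j : 'I_K => E (B j)) hT _ hB).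
  by apply: ler_sum => j _; apply: cut_sum; exact: powR_ge0.
by move=> j u y; exact: proj_dot.
Qed.

Lemma row_sum_far_right r : bnd (row_sum far_right r) (eps * a).
Proof.
(* Rows of block j end before m j.+1 and the columns start at m j.+2, whence the index j + 1. *)
have h j : bnd (fun u => E (fun i => blk i == j) (T (E (far_right r j) u))) (delta j.+1 * a).
  apply: (tails _ _ _).1 => i; first by move=> /eqP e; rewrite -(block_lt m0 hm) e.
  by rewrite /far_right => /andP[h _]; rewrite -(block_ge m0 hm).
apply: (bndW p2 _ (bnd_sum p2 (index_enum 'I_K) (fun (j : 'I_K) (_ : xpredT j) => h j))).
rewrite -mulr_suml ler_wpM2r//; apply: le_trans (hdelta K.+1).
by rewrite big_ord_recl/= lerDr ltW.
Qed.

Lemma row_sum_far_left r : bnd (row_sum far_left r) (eps * a).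
Proof.
(* For row block k + 1 the columns end before m k and the rows start at m k.+1; row block 0 has
   nothing to its left. *)
pose d j := if j is k.+1 then delta k * a else 0.
have h j : bnd (fun u => E (fun i => blk i == j) (T (E (far_left r j) u))) (d j).
  case: j => [|k] /=.
    apply: (eq_bnd p2 _ (bnd0 dot p2)) => u.
    rewrite (_ : E (far_left r 0) u = 0) ?(linm0 linT) ?proj0//.
    by rewrite /oproj big1.
  apply: (tails _ _ _).2 => i; last by move=> /eqP e; rewrite -(block_ge m0 hm) e.
  by rewrite /far_left ltnS => /andP[h _]; rewrite -(block_lt m0 hm).
apply: (bndW p2 _ (bnd_sum p2 (index_enum 'I_K) (fun (j : 'I_K) (_ : xpredT j) => h j))).
case: (K) => [|K']; first by rewrite big_ord0 mulr_ge0//; have := hdelta 0; rewrite big_ord0.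
rewrite big_ord_recl/= add0r -mulr_suml ler_wpM2r//.
exact: hdelta.
Qed.

(** For each shift the corner is bounded by its windows, two cut diagonals and two far parts. In the
    l_p norm over the shifts the constant terms acquire a factor N^(1/p) and the diagonals do not;
    dividing by N^(1/p) gives the claim. *)
Lemma window_bound (g : nat -> nat -> R) (Bd : R) : 0 <= Bd ->
  (forall r t, 0 <= g r t) ->
  (forall r t, (r < N)%N ->
    bnd (fun u => E (fun i => window r i == t) (T (E (fun i => window r i == t) u))) (g r t)) ->
  \sum_(0 <= r < N) \sum_(t < K + N) g r t `^ p <= N%:R * Bd `^ p ->
  nrm (fun u => E predT (T (E predT u))) <= Bd + (2 * (N%:R `^ p^-1)^-1 + 2 * eps) * a.
Proof.
move=> Bd0 g0 hg hgB; set aK := nrm _.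
have NR : 0 < N%:R :> R by rewrite ltr0n.
have baK : bnd (fun u => E predT (T (E predT u))) aK.
  by apply: (nrmP p2 (bnd_projl predT K (bnd_projr predT K hT))).1.
have aK0 : 0 <= aK by case: baK.
have eps0 : 0 <= eps by have := hdelta 0; rewrite big_ord0.
pose B1 := fun j i : nat => blk i == j.+1.
pose B2 := fun j i : nat => (blk i).+1 == j.
have hB1 y : \sum_(j < K) hn (E (B1 j) y) ^+ 2 <= hn y ^+ 2.
  apply: le_trans (sum_hn2_proj hdot hbo K.+1 K blk y).
  by rewrite big_ord_recl/= lerDr sqr_ge0.
have hB2 y : \sum_(j < K) hn (E (B2 j) y) ^+ 2 <= hn y ^+ 2.
  exact: (sum_hn2_proj hdot hbo K K (fun i => (blk i).+1) y).
pose G r := (\sum_(t < K + N) g r t `^ p) `^ p^-1.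
pose D1 r := (\sum_(j < K) (if cutp r j then nrm (T \o E (B1 j)) `^ p else 0)) `^ p^-1.
(* The left neighbour of block [j] is block [j.-1]; for [j] = 0 the selection [B2 0] is empty, so
   the value of the cut there is immaterial. *)
pose D2 r := (\sum_(j < K) (if cutp r j.-1 then nrm (T \o E (B2 j)) `^ p else 0)) `^ p^-1.
have key r : (r < N)%N -> aK <= G r + D1 r + D2 r + 2 * eps * a.
  move=> rN.
  have b1 := row_sum_windows rN (g0 r) (fun t => hg r t rN).
  have b2 : bnd (row_sum right1 r) (D1 r).
    apply: (row_sum_diagonal (B := B1) (k := id)) => // j i.
    rewrite /right1 /B1 /in_window /window; case: eqP => //= ->.
    by [].
  have b3 : bnd (row_sum left1 r) (D2 r).
    apply: (row_sum_diagonal (B := B2) (k := predn)) => // j i.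
    rewrite /left1 /B2 /in_window /window; case: eqP => //= <- /=.
    by rewrite eq_sym.
  have b45 := bndD p2 (bndD p2 (bndD p2 (bndD p2 b1 b2) b3) (row_sum_far_right r)) (row_sum_far_left r).
  have := (nrmP p2 (eq_bnd p2 (window_split r) b45)).2.
  by rewrite -/aK -/(G r); lra.
have pw (F : nat -> R) r : 0 <= F r -> 1 * (F r `^ p^-1) `^ p = F r by move=> F0; rewrite mul1r powRVK.
have G0 r : 0 <= \sum_(t < K + N) g r t `^ p by rewrite sumr_ge0// => t _; exact: powR_ge0.
have C0 (B : nat -> pred nat) (k : nat -> nat) r :
    0 <= \sum_(j < K) (if cutp r (k j) then nrm (T \o E (B j)) `^ p else 0).
  by rewrite sumr_ge0// => j _; case: ifP => // _; exact: powR_ge0.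
pose s := index_iota 0 N.
pose n1 := N%:R `^ p^-1 : R.
have n10 : 0 < n1 by rewrite powR_gt0.
have n1p : n1 `^ p = N%:R by rewrite powRVK// ltW.
have sG : \sum_(r <- s) 1 * G r `^ p <= (n1 * Bd) `^ p.
  rewrite (powRM p (ltW n10) Bd0) n1p; apply: le_trans hgB.
  by apply: ler_sum => r _; rewrite mul1r powRVK.
have sD1 : \sum_(r <- s) 1 * D1 r `^ p <= a `^ p.
  apply: le_trans (diagonal_sum id hB1); apply: ler_sum => r _.
  by rewrite mul1r (powRVK pn0 (C0 B1 id r)).
have sD2 : \sum_(r <- s) 1 * D2 r `^ p <= a `^ p.
  apply: le_trans (diagonal_sum predn hB2); apply: ler_sum => r _.
  by rewrite mul1r (powRVK pn0 (C0 B2 predn r)).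
have e0 : 0 <= 2 * eps * a by rewrite !mulr_ge0.
have sE : \sum_(r <- s) 1 * (2 * eps * a) `^ p <= (n1 * (2 * eps * a)) `^ p.
  rewrite (powRM p (ltW n10) e0) n1p big_const_nat subn0 mul1r iter_addr addr0 -[leLHS]mulr_natl.
  exact: lexx.
have one i : i \in s -> 0 <= 1 :> R by [].
have gG i : i \in s -> 0 <= G i by move=> _; exact: powR_ge0.
have gD1 i : i \in s -> 0 <= D1 i by move=> _; exact: powR_ge0.
have gD2 i : i \in s -> 0 <= D2 i by move=> _; exact: powR_ge0.
have nB : 0 <= n1 * Bd by rewrite mulr_ge0 ?(ltW n10).
have nE : 0 <= n1 * (2 * eps * a) by rewrite mulr_ge0 ?(ltW n10).
have m1 := minkowski_bound p1 nB a0 one gG gD1 sG sD1.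
have m2 := minkowski_bound p1 (addr_ge0 nB a0) a0 one
  (fun i si => addr_ge0 (gG i si) (gD1 i si)) gD2 m1 sD2.
have m3 := minkowski_bound p1 (addr_ge0 (addr_ge0 nB a0) a0) nE one
  (fun i si => addr_ge0 (addr_ge0 (gG i si) (gD1 i si)) (gD2 i si)) (fun i _ => e0) m2 sE.
have : (n1 * aK) `^ p <= (n1 * Bd + a + a + n1 * (2 * eps * a)) `^ p.
  apply: le_trans m3; rewrite (powRM p (ltW n10) aK0) n1p.
  apply: (@le_trans _ _ (\sum_(r <- s) aK `^ p)).
    by rewrite big_const_nat subn0 iter_addr addr0 mulr_natl.
  rewrite !big_seq; apply: ler_sum => r; rewrite mem_index_iota => /andP[_ rN].
  rewrite mul1r ler_powR2 ?key//.
  by rewrite !addr_ge0 ?powR_ge0.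
rewrite ler_powR2//; last 2 first.
  by rewrite mulr_ge0 ?(ltW n10).
  by rewrite !addr_ge0.
move=> h; rewrite -(ler_pM2l n10); apply: (le_trans h).
rewrite le_eqVlt; apply/orP; left; apply/eqP; rewrite /n1.
by field; rewrite gt_eqF.
Qed.
End Windows.

(** * The averaging map into l_p(c_p^n) *)

Section Averaging.
Implicit Types (A B : pred nat).

Variable m : nat -> nat.
Hypotheses (m0 : m 0%N = 0%N) (hm : forall q, (m q < m q.+1)%N).
Variable N : nat.
Hypothesis N0 : (0 < N)%N.

Let c : R := (N%:R `^ p^-1)^-1.
Let NR : 0 < N%:R :> R. Proof. by rewrite ltr0n. Qed.
Let c0 : 0 < c. Proof. by rewrite invr_gt0 powR_gt0. Qed.
Let cpow : c `^ p = N%:R^-1.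
Proof. by rewrite /c -powRN -powRrM mulNr mulVf// powR_inv1// ltW. Qed.

(** All pairs of a window t and a shift r < N in one sequence, by q = t * N + r. *)
Definition cell (q i : nat) : bool := window m N (q %% N) i == (q %/ N)%N.
(** Position [n] of the direct sum holds matrices of size n + 1, so a cell must be placed where it
    fits. The last summand exceeds every index of cell [q], and the successors make the sequence of
    slots strictly increasing. *)
Definition slot (q : nat) : nat := \sum_(k < q.+1) (m ((k %/ N).+1 * N)).+1.

Lemma slot_lt q : (slot q < slot q.+1)%N.
Proof. by rewrite /slot [X in (_ < X)%N]big_ord_recr/= addnS ltnS leq_addr. Qed.

Lemma slot_le k l : (k <= l)%N -> (slot k <= slot l)%N.
Proof. by apply: homo_leq leqnn leq_trans _ k l => n; exact/ltnW/slot_lt. Qed.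

Lemma slot_inj : injective slot.
Proof.
move=> k l; have [kl|lk|//] := ltngtP k l; last by have := slot_le lk; have := slot_lt l; lia.
by have := slot_le kl; have := slot_lt k; lia.
Qed.

Lemma slot_self q : (q <= slot q)%N.
Proof. by elim: q => // q IH; exact: leq_ltn_trans IH (slot_lt q). Qed.

Lemma cell_slot q i : cell q i -> (i <= slot q)%N.
Proof.
move=> /eqP h; have /ltnW : (i < m ((q %/ N).+1 * N))%N.
  rewrite -(block_lt m0 hm); apply: leq_ltn_trans (leq_addr (q %% N) _) _.
  by rewrite -ltn_divLR// -[X in (X < _)%N]/(window m N (q %% N) i) h.
by move=> h1; apply: (leq_trans h1); rewrite /slot big_ord_recr/= addnS; lia.
Qed.

Lemma cell_grid t r i : (r < N)%N -> cell (t * N + r) i = (window m N r i == t).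
Proof. by move=> rN; rewrite /cell modnMDl divnMDl// modn_small// divn_small// addn0. Qed.

Definition compression A n T : H -> H := fun u => proj A n (T (proj A n u)).
Definition piece T q := compression (cell q) (slot q).+1 T.

Lemma compression_lin A n T : linear T -> linear (compression A n T).
Proof. by move=> linT a x y; rewrite /compression proj_lin linT proj_lin. Qed.

Lemma bnd_compression A n T M : bnd T M -> bnd (compression A n T) M.
Proof. by move=> h; apply: bnd_projl; exact: bnd_projr. Qed.

Lemma piece_widen T q n : (slot q < n)%N -> piece T q =1 compression (cell q) n T.
Proof.
move=> qn; have e : proj (cell q) (slot q).+1 =1 proj (cell q) n.
  move=> x; rewrite (proj_widen _ _ _ _ qn); apply: eq_proj => i _.
  by case: (boolP (cell q i)) => // /cell_slot; rewrite ltnS => ->.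
by move=> u; rewrite /piece /compression !e.
Qed.

(* Column [r] of the direct sum occupies the cells [q] with [q %% N = r], at
   the slots where they fit. *)
Definition averaging T : mxseq R := fun n =>
  if [pick q : 'I_n.+1 | slot q == n] is Some q
  then mxof dot b n.+1 (fun u => c%:C%C *: piece T q u) else 0.

Lemma averaging_slot T q : averaging T (slot q) =
  mxof dot b (slot q).+1 (fun u => c%:C%C *: piece T q u).
Proof.
have qs : (q < (slot q).+1)%N by rewrite ltnS slot_self.
rewrite /averaging; case: pickP => [k /eqP/slot_inj ->//|/(_ (Ordinal qs))].
by rewrite eqxx.
Qed.

Lemma averaging_out T n : (forall q, slot q != n) -> averaging T n = 0.
Proof. by move=> h; rewrite /averaging; case: pickP => // q; rewrite (negbTE (h q)). Qed.

Lemma averaging_lin a T S : averaging (a *: T + S) = a *: averaging T + averaging S.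
Proof.
apply: functional_extensionality_dep => n.
transitivity (a *: averaging T n + averaging S n); last by [].
rewrite /averaging; case: pickP => [q _|_]; last by rewrite scaler0 addr0.
apply/matrixP => i j; rewrite !mxE -dotZl -dotDl; congr (dot _ _).
rewrite /piece /compression !fctE projD projZ scalerDr !scalerA; congr (_ *: _ + _).
exact: mulrC.
Qed.

Lemma nrmZ T M d : bnd T M -> 0 < d -> nrm (fun u => d%:C%C *: T u) = d * nrm T.
Proof.
move=> hT d0; have [h1 h2] := nrmP p2 hT.
have hd := bndZ d%:C%C h1; rewrite cnR_ge0 ?(ltW d0)// in hd.
have [h3 h4] := nrmP p2 hd; apply/eqP; rewrite eq_le h4/= mulrC -ler_pdivlMr//.
have := bndZ d^-1%:C%C h3; rewrite cnR_ge0 ?invr_ge0 ?(ltW d0)// => h5.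
rewrite mulrC; apply: (nrmP p2 (eq_bnd p2 _ h5)).2 => u.
by rewrite scalerA -rmorphM/= mulVf ?gt_eqF// scale1r.
Qed.

Lemma averaging_norm T M q : linear T -> bnd T M ->
  cpn_norm p (averaging T (slot q)) `^ p = N%:R^-1 * nrm (piece T q) `^ p.
Proof.
move=> linT hT; have hG : bnd (piece T q) M by exact: bnd_compression.
rewrite averaging_slot (cpn_norm_nrm hdot p2 hb).
rewrite (_ : op _ _ _ = fun u => c%:C%C *: piece T q u).
  by rewrite (nrmZ hG c0) (powRM p (ltW c0) (nrm_ge0 p2 hG)) cpow.
apply/funext => u; rewrite op_mxof => [|a x y]; last first.
  by rewrite /piece (compression_lin _ _ linT) scalerDr !scalerA mulrC.
rewrite projZ; congr (_ *: _); rewrite /piece /compression.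
rewrite !(proj_proj hdot hbo) (eq_proj _ _ (B := cell q))//; congr (proj _ _ (T _)).
by apply: eq_proj => i _ /=; rewrite andbT.
Qed.

(** For a fixed shift the windows are disjoint and their p-th powers sum to at most M^p; the factor
    1/N turns the sum over N shifts into a mean. *)
Lemma averaging_upper T M K : linear T -> bnd T M ->
  \sum_(n < K) cpn_norm p (averaging T n) `^ p <= M `^ p.
Proof.
move=> linT hT; have M0 : 0 <= M by case: hT.
pose F n := cpn_norm p (averaging T n) `^ p.
have F0 n : 0 <= F n by exact: powR_ge0.
have Fout n : (forall q, slot q != n) -> F n = 0.
  by move=> h; rewrite /F averaging_out// (cpn_norm0 hdot p2 hb) powR0.
have widen (G : nat -> R) k l : (forall n, 0 <= G n) -> (k <= l)%N ->
    \sum_(n < k) G n <= \sum_(n < l) G n.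
  move=> G0 kl; rewrite -!(big_mkord predT G) [leRHS](big_cat_nat _ (n := k))//= lerDl.
  by rewrite sumr_ge0.
apply: (le_trans (widen F _ _ F0 (slot_self K))); rewrite (sum_range K slot_lt Fout).
apply: (le_trans (widen (F \o slot) _ (K * N)%N (fun=> F0 _) (leq_pmulr K N0))).
rewrite sum_grid; pose L := (slot (K * N)).+1.
apply: (@le_trans _ _ (\sum_(0 <= r < N) N%:R^-1 * M `^ p)); last first.
  by rewrite big_const_nat subn0 iter_addr addr0 -mulrnAl -[_ *+ N]mulr_natl mulfV ?mul1r// gt_eqF.
rewrite !big_seq; apply: ler_sum => r; rewrite mem_index_iota => /andP[_ rN].
rewrite (eq_bigr (fun t : 'I_K => N%:R^-1 * nrm (piece T (t * N + r)) `^ p)) => [|t _]; last first.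
  exact: (averaging_norm _ linT hT).
rewrite -mulr_sumr ler_wpM2l ?invr_ge0 ?ler0n//.
apply: le_trans (bnd_blocks_le p2 (Q := fun t : 'I_K => proj (fun i => window m N r i == t) L) hT _ _).
- apply: ler_sum => t _; pose Q := proj (fun i => window m N r i == t) L.
  have hQ : bnd (T \o Q) M by exact: (bnd_projr _ L hT).
  have [h1 _] := nrmP p2 hQ.
  rewrite ler_powR2//; last 2 first.
    exact: (nrm_ge0 p2 (bnd_compression (cell (t * N + r)) (slot (t * N + r)).+1 hT)).
    exact: (nrm_ge0 p2 hQ).
  have h2 := bnd_projl (fun i => window m N r i == t) L h1.
  apply: (nrmP p2 (eq_bnd p2 _ h2)).2 => u.
  have hL : (slot (t * N + r) < L)%N.
    by rewrite ltnS slot_le//; have := ltn_ord t; nia.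
  have e1 : proj (cell (t * N + r)) L =1 Q by apply: eq_proj => i _; exact: cell_grid.
  by rewrite (piece_widen T hL) /compression !e1.
- by move=> t u y; exact: proj_dot.
- by move=> y; exact: (sum_hn2_proj hdot hbo).
Qed.

Section LowerBound.
Variables (T : H -> H) (delta : nat -> R) (eps B : R).
Hypotheses (hT : cp dot p T) (delta0 : forall q, 0 < delta q).
Hypothesis hdelta : forall Q, \sum_(q < Q) delta q <= eps.
Hypothesis tails : forall q K A B, (forall j, A j -> (j < m q)%N) ->
  (forall j, B j -> (m q.+1 <= j)%N) ->
  bnd (fun u => proj A K (T (proj B K u))) (delta q * nrm T) /\
  bnd (fun u => proj B K (T (proj A K u))) (delta q * nrm T).
Hypotheses (B0 : 0 <= B)
  (hB : forall K, \sum_(n < K) cpn_norm p (averaging T n) `^ p <= B `^ p).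

(** The window estimate concerns corners; [T] is reached by letting the corner grow, at the cost of
    an arbitrarily small [e]. *)
Lemma averaging_lower : nrm T <= B + (2 * c + 2 * eps) * nrm T.
Proof.
have linT := cp_linear hT; have bT := cp_bnd sepH p2 hT.
have n0 := nrm_ge0 p2 bT.
apply/ler_addgt0Pr => e e0; have [K hK] := corner_approx hT e0.
have /(_ (leqnn K)) hTK := hK K.
pose g r t := nrm (piece T (t * N + r)).
have bp q : bnd (piece T q) (nrm T) by exact: bnd_compression.
have h : nrm (compression predT K T) <= B + (2 * c + 2 * eps) * nrm T.
  have wb := window_bound linT bT m0 hm delta0 hdelta tails N0 (K := K) B0 (g := g).
  refine (wb _ _ _).
  - by move=> r t; exact: (nrm_ge0 p2 (bp (t * N + r)%N)).
  (* The part of a window below [K] is a compression of the corresponding piece; both are written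
     with the common length [L]. *)
  - move=> r t rN; set q := (t * N + r)%N; pose L := (maxn K (slot q).+1).
    have KL : (K <= L)%N by rewrite leq_maxl.
    have h1 := bnd_compression (fun i => (i < K)%N) L (nrmP p2 (bp q)).1.
    apply: (eq_bnd p2 _ h1) => u; rewrite /compression.
    rewrite (piece_widen T (leq_maxr K (slot q).+1)) /compression !(proj_proj hdot hbo).
    have e1 : proj (fun i => window m N r i == t) K =1
        proj (predI (fun i => (i < K)%N) (cell q)) L.
      move=> x; rewrite (proj_widen _ _ _ _ KL); apply: eq_proj => i _ /=.
      by rewrite (cell_grid t i rN) andbC.
    rewrite !e1; congr (proj _ L (T _)); apply: eq_proj => i _ /=.
    by rewrite andbC.
  - rewrite -(sum_grid (fun q => nrm (piece T q) `^ p)).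
    rewrite -ler_pdivrMl// mulr_sumr.
    under eq_bigr do rewrite -(averaging_norm _ linT bT).
    have Fout n : (forall q, slot q != n) -> cpn_norm p (averaging T n) `^ p = 0.
      by move=> out; rewrite averaging_out// (cpn_norm0 hdot p2 hb) powR0.
    by rewrite -(sum_range _ slot_lt Fout); exact: hB.
have h1 := (nrmP p2 (bnd_compression predT K bT)).1.
have h2 := bndD p2 h1 hTK.
have [_] := nrmP p2 (eq_bnd p2 (S := T) (fun u => esym (subrKC _ _)) h2).
by move=> h3; apply: (le_trans h3); rewrite lerD2r.
Qed.
End LowerBound.
End Averaging.

(** * Completeness of X and embeddings of l_2 *)

Variable X : set (H -> H).
Hypothesis hX : closed_subspace (cp_norm dot p) X (cp dot p).
Let Xcp T : X T -> cp dot p T. Proof. by case: hX => h _ _; exact: h. Qed.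
Let Xlin T : X T -> linear T. Proof. by move=> /Xcp; exact: cp_linear. Qed.
Let Xsub : linear_subspace X. Proof. by case: hX. Qed.
Let Xbnd T : X T -> bnd T (nrm T). Proof. by move=> /Xcp; exact: cp_bnd. Qed.
Let XnormE T M : X T -> (cp_norm dot p T <= M%:E)%E = (nrm T <= M).
Proof. by move=> /Xcp h; rewrite (cp_normE sepH p2 h) lee_fin. Qed.

Lemma cp_homogeneous (Z : set (H -> H)) : Z `<=` X -> homogeneous (cp_norm dot p) Z.
Proof.
move=> ZX c M T /ZX XT c0 M0; rewrite (XnormE _ XT) (XnormE _ (subspaceZ _ Xsub XT)) => hM.
have := bndZ c%:C%C (Xbnd XT); rewrite cnR_ge0 ?(ltW c0)// => h.
by apply: (le_trans (nrmP p2 h).2); rewrite ler_pM2l.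
Qed.

(** A copy of l_2 in [X], followed by the isomorphism onto [Y], would be bounded above and below as
    a map into l_p(c_p^n). *)
Lemma isomorphic_no_l2 (Y : set (mxseq R)) : linear_subspace Y ->
  isomorphic (cp_norm dot p) X (lp_cpn_norm p) Y ->
  ~ exists Z : set (H -> H), [/\ linear_subspace Z, Z `<=` X &
      isomorphic (cp_norm dot p) Z l2_norm (@l2 R)].
Proof.
move=> sY [T [S isoTS]] [Z [sZ ZX [U [V isoUV]]]].
have linS := inverse_linear Xsub isoTS; have linV := inverse_linear sZ isoUV.
case: isoTS => linT XY YX [ST TS] [oT oS]; case: isoUV => linU Zl lZ [VU UV] [oU oV].
have hcp := cp_homogeneous (@subset_refl _ X); have hZ := cp_homogeneous ZX.
have hY := lp_cpn_homogeneous hdot p2 hb (Y := Y); have hl := @l2_homogeneous R.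
have [C1 C10 hC1] := opnorm_bound Xsub linT XY hcp hY oT.
have [C2 C20 hC2] := opnorm_bound sY linS YX hY hcp oS.
have [C3 C30 hC3] := opnorm_bound sZ linU Zl hZ hl oU.
have [C4 C40 hC4] := opnorm_bound l2_subspace linV lZ hl hZ oV.
have linF : linear_on (@l2 R) (T \o V).
  by move=> a x y lx ly; rewrite /= linV// linT//; apply/ZX/lZ.
apply: (no_l2_embedding hdot p2 hb linF (mulr_gt0 C10 C40) _ (mulr_gt0 C30 C20)).
- move=> x M lx M0 xM; rewrite -mulrA; apply: hC1; first exact/ZX/lZ.
    exact: mulr_gt0.
  exact: hC4.
- move=> x M lx M0 hM; have Xx := ZX _ (lZ _ lx).
  have := hC2 _ M (XY _ Xx) M0 hM; rewrite ST; last exact/mem_set.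
  by move/(hC3 _ _ (lZ _ lx) (mulr_gt0 C20 M0)); rewrite mulrA UV//; exact/mem_set.
Qed.

Lemma subspace_complete (u : nat -> H -> H) : (forall n, X (u n)) ->
  (forall eps, 0 < eps -> exists N, forall m n, (N <= m)%N -> (N <= n)%N ->
     bnd (u m - u n) eps) ->
  exists T, X T /\ forall eps, 0 < eps -> exists N, forall n, (N <= n)%N -> bnd (u n - T) eps.
Proof.
move=> Xu hu.
have Xuu m n : X (u m - u n) by exact: subspaceB.
have [|||T [cT cuT hT]] := @cp_complete _ _ _ sepH p p2 u.
- by move=> n; exact: Xcp.
- by move=> m n; exact: Xcp.
- move=> eps /hu[N hN]; exists N => m n Nm Nn.
  by apply: (cp_nrm_le p2); exact: hN.
exists T; split; last first.
  move=> eps /hT[N hN]; exists N => n Nn.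
  by apply: (bndW p2 (hN n Nn)); exact: cp_bnd.
case: hX => _ _; apply; [exact: Xu|exact: cT|].
rewrite (_ : (fun n => _) = (fun n => (nrm (u n - T))%:E)); last first.
  by apply/funext => n; rewrite (cp_normE sepH p2 (cuT n)).
by apply: cvge0 => [n|//]; apply: (nrm_ge0 p2 (cp_bnd sepH p2 (cuT n))).
Qed.

Section L2Embedding.
Variables (u : nat -> H -> H) (C kappa : R).
Hypotheses (Xu : forall n, X (u n)) (C0 : 0 < C) (kappa0 : 0 < kappa).
Local Notation comb a N := (\sum_(n < N) a n *: u n).
Hypothesis upper : forall N (a : nat -> R[i]) c, 0 <= c ->
  \sum_(n < N) cn (a n) ^+ 2 <= c ^+ 2 -> bnd (comb a N) (C * c).
Hypothesis lower : forall N (a : nat -> R[i]) B, bnd (comb a N) B ->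
  kappa ^+ 2 * \sum_(n < N) cn (a n) ^+ 2 <= B ^+ 2.

(** [T] is the sum of the series of the a_n u_n in the norm of c_p, expressed by bounds. *)
Let limcomb (a : nat -> R[i]) T := X T /\
  forall eps, 0 < eps -> exists N, forall n, (N <= n)%N -> bnd (comb a n - T) eps.

Let Xcomb (a : nat -> R[i]) N : X (comb a N).
Proof. by apply: subspace_sum => // n _; exact: subspaceZ. Qed.

Lemma limcomb_exists (a : nat -> R[i]^o) : l2 a -> exists T, limcomb a T.
Proof.
move=> /l2P[M M0 hM]; apply: subspace_complete => // eps eps0.
have e0 : 0 < eps / C by rewrite divr_gt0.
have [N hN] := bounded_sum_tail (fun n => sqr_ge0 (cn (a n))) hM (exprn_gt0 2 e0).
have key m n : (N <= n)%N -> (n <= m)%N -> bnd (comb a m - comb a n) eps.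
  move=> Nn nm; pose a' k : R[i] := if (k < n)%N then 0 else a k.
  have -> : comb a m - comb a n = comb a' m.
    rewrite -!(big_mkord predT (fun k => a k *: u k)) -(big_mkord predT (fun k => a' k *: u k)).
    rewrite [in LHS](big_cat_nat _ (n := n))//= addrAC subrr add0r.
    have z : \sum_(0 <= k < n) a' k *: u k = 0.
      by rewrite big_nat big1// => k /andP[_ kn]; rewrite /a' kn scale0r.
    rewrite [RHS](big_cat_nat _ (n := n))//= z add0r.
    by apply: eq_big_nat => k /andP[nk _]; rewrite /a' ltnNge nk.
  rewrite (_ : eps = C * (eps / C)); last by rewrite mulrC divfK// gt_eqF.
  apply: upper; first exact: ltW.
  rewrite -(big_mkord predT (fun k => cn (a' k) ^+ 2)).
  have z : \sum_(0 <= k < n) cn (a' k) ^+ 2 = 0.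
    by rewrite big_nat big1// => k /andP[_ kn]; rewrite /a' kn cn0 expr0n.
  rewrite (big_cat_nat _ (n := n))//= z add0r.
  rewrite (eq_big_nat _ _ (F2 := fun k => cn (a k) ^+ 2)); last first.
    by move=> k /andP[nk _]; rewrite /a' ltnNge nk.
  apply: le_trans (hN m (leq_trans Nn nm)).
  rewrite [leRHS](big_cat_nat _ (n := n))//= lerDr sumr_ge0// => k _; exact: sqr_ge0.
exists N => m n Nm Nn; have [nm|/ltnW mn] := leqP n m; first exact: key.
by apply: (bnd_le p2 _ (key n m Nm mn)) => x; rewrite !fctE hnBC.
Qed.

Lemma limcomb_uniq (a : nat -> R[i]) T S : limcomb a T -> limcomb a S -> T = S.
Proof.
move=> [XT hT] [XS hS]; apply/funext => x; apply/eqP; rewrite -subr_eq0.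
apply/eqP/hn_small_eq0 => eps eps0.
have e0 : 0 < eps / 2 / (hn x + 1) by rewrite !divr_gt0// ltr_wpDl ?hn_ge0.
have [N1 h1] := hT _ e0; have [N2 h2] := hS _ e0; pose n := maxn N1 N2.
have lin Z : X Z -> linear (comb a n - Z).
  by move=> XZ; apply: Xlin; exact: subspaceB.
have b1 := bnd_op hdot p2 x (lin _ XT) (h1 n (leq_maxl _ _)).
have b2 := bnd_op hdot p2 x (lin _ XS) (h2 n (leq_maxr _ _)).
have -> : T x - S x = (comb a n - S) x - (comb a n - T) x.
  by rewrite !fctE opprB [RHS]addrC addrA subrK.
apply: (le_trans (hnB _ _)); apply: (le_trans (lerD b2 b1)).
have h : eps / 2 / (hn x + 1) * hn x <= eps / 2.
  by rewrite mulrAC ler_pdivrMr ?ltr_wpDl ?hn_ge0// ler_pM2l ?divr_gt0// lerDl.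
by rewrite [leRHS](splitr eps) lerD.
Qed.

Lemma limcomb_lin al (a a' : nat -> R[i]^o) T S : limcomb a T -> limcomb a' S ->
  limcomb (al *: a + a' : nat -> R[i]^o) (al *: T + S).
Proof.
move=> [XT hT] [XS hS]; split; first by exact: Xsub.2.
move=> eps eps0.
have e1 : 0 < eps / 2 / (cn al + 1) by rewrite !divr_gt0// ltr_wpDl ?cn_ge0.
have e2 : 0 < eps / 2 by rewrite divr_gt0.
have [N1 h1] := hT _ e1; have [N2 h2] := hS _ e2.
exists (maxn N1 N2) => n; rewrite geq_max => /andP[/h1 b1 /h2 b2].
have -> : comb (al *: a + a' : nat -> R[i]^o) n = al *: comb a n + comb a' n.
  rewrite scaler_sumr -big_split/=; apply: eq_bigr => k _.
  by rewrite scalerA -scalerDl.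
apply: (bndW p2 _ (eq_bnd p2 _ (bndD p2 (bndZ al b1) b2))) => [|x].
  rewrite [leRHS](splitr eps) lerD2r mulrA ler_pdivrMr ?ltr_wpDl ?cn_ge0//.
  by rewrite mulrC ler_pM2l// lerDl.
by rewrite !fctE scalerBr opprD addrACA.
Qed.

(** The two estimates for finite combinations pass to sums of series, which exist because [X] is
    complete; the map obtained embeds l_2. *)
Lemma embeds_l2 : exists Y : set (H -> H), [/\ linear_subspace Y, Y `<=` X &
  isomorphic (cp_norm dot p) Y l2_norm (@l2 R)].
Proof.
have /choice[J hJ] : forall a : nat -> R[i]^o, exists T, l2 a -> limcomb a T.
  move=> a; have [/limcomb_exists[T hT]|na] := pselect (l2 a); first by exists T.
  by exists 0.
have linJ : linear_on (@l2 R) J.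
  move=> al x y lx ly; apply: (@limcomb_uniq (al *: x + y : nat -> R[i]^o)).
    by apply: hJ; exact: (@l2_subspace R).2.
  by apply: limcomb_lin; exact: hJ.
have JX a : l2 a -> X (J a) by move=> /hJ[].
have up a M : l2 a -> 0 <= M -> (l2_norm a <= M%:E)%E -> (cp_norm dot p (J a) <= (C * M)%:E)%E.
  move=> la M0 /(l2_norm_le _ M0) haM; have cJ := Xcp (JX _ la); have [kJ _] := cJ.
  have CM : 0 <= C * M by rewrite mulr_ge0 ?(ltW C0).
  apply/(cp_norm_le sepH p2 kJ CM); apply: (bnd_inf p2 CM) => eps eps0.
  have [_ hl] := hJ _ la; have [N hN] := hl _ eps0.
  apply: (bnd_le_add p2 _ (upper M0 (haM N)) (hN N (leqnn N))) => x.
  have -> : J a x = comb a N x - (comb a N - J a) x by rewrite !fctE opprB addrC subrK.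
  exact: hnB.
have lo a M : l2 a -> 0 <= M -> (cp_norm dot p (J a) <= M%:E)%E -> (l2_norm a <= (kappa^-1 * M)%:E)%E.
  move=> la M0 haM; have [kJ _] := Xcp (JX _ la).
  move/(cp_norm_le sepH p2 kJ M0) : haM => haM.
  have kM : 0 <= kappa^-1 * M by rewrite mulr_ge0 ?invr_ge0 ?(ltW kappa0).
  apply/(l2_norm_le _ kM) => K.
  have key eps : 0 < eps -> kappa ^+ 2 * \sum_(k < K) cn (a k) ^+ 2 <= (M + eps) ^+ 2.
    move=> eps0; have [_ hl] := hJ _ la; have [N hN] := hl _ eps0.
    have NK := hN (maxn N K) (leq_maxl _ _).
    have bU : bnd (comb a (maxn N K)) (M + eps).
      apply: (bnd_le_add p2 _ haM NK) => x.
      have -> : comb a (maxn N K) x = J a x + (comb a (maxn N K) - J a) x by rewrite !fctE [RHS]addrC subrK.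
      exact: hnD.
    apply: le_trans (lower bU); rewrite ler_wpM2l ?sqr_ge0//.
    rewrite -!(big_mkord predT (fun k => cn (a k) ^+ 2)).
    rewrite [leRHS](big_cat_nat _ (n := K)) ?leq_maxr//= lerDl sumr_ge0// => k _.
    exact: sqr_ge0.
  rewrite exprMn exprVn mulrC ler_pdivlMr ?exprn_gt0// mulrC.
  set S := _ * _ in key *; have S0 : 0 <= S.
    by rewrite /S mulr_ge0 ?sqr_ge0// sumr_ge0// => k _; exact: sqr_ge0.
  rewrite -(sqr_sqrtr S0) ler_sqr ?nnegrE ?sqrtr_ge0//.
  apply/ler_addgt0Pr => eps eps0.
  by rewrite -ler_sqr ?nnegrE ?sqrtr_ge0 ?addr_ge0 ?(ltW eps0)// sqr_sqrtr// key.
have injJ a : l2 a -> J a = 0 -> a = 0.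
  move=> la Ja; have := lo a 0 la (lexx _).
  have [kJ _] := Xcp (JX _ la).
  have -> : (cp_norm dot p (J a) <= 0%:E)%E.
    by apply/(cp_norm_le sepH p2 kJ) => //; rewrite Ja; exact: (bnd0 dot p2).
  move=> /(_ isT); rewrite mulr0 => /(l2_norm_le _ (lexx _)) h.
  apply/funext => k; apply/eqP; rewrite -cn_eq0.
  have := h k.+1; rewrite big_ord_recr/= expr0n/= => hk.
  rewrite -sqrf_eq0 eq_le sqr_ge0 andbT; apply: le_trans hk.
  by rewrite lerDr sumr_ge0// => l _; exact: sqr_ge0.
have [|||S [_ iso _ _]] := @embedding_isomorphism R _ _ (@l2_norm R) (@l2 R) (cp_norm dot p) J
    C kappa^-1 l2_subspace linJ.
- by move=> a la h; have := up a 1 la ler01 h; rewrite mulr1.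
- by move=> a la h; have := lo a 1 la ler01 h; rewrite mulr1.
- exact: injJ.
exists (J @` @l2 R); split.
- exact: image_subspace l2_subspace linJ.
- by move=> _ [a la <-]; exact: JX.
- by exists S, J.
Qed.

End L2Embedding.

Hypothesis noL2 : ~ exists Y : set (H -> H), [/\ linear_subspace Y, Y `<=` X &
  isomorphic (cp_norm dot p) Y l2_norm (@l2 R)].

(** * Choice of the humps *)

Section HumpSelection.
Variables (r : bool) (i : nat) (delta : R).
Hypothesis delta0 : 0 < delta.
Hypothesis bad : forall m, exists T K, [/\ X T, bnd T 1, (m <= K)%N &
  delta ^+ 2 < \sum_(m <= j < K) cn (line r i T j) ^+ 2].

(** Along an ultrafilter the entries of the m-corner converge, so two of the given elements nearly
    agree there. Choosing the second one after the line of the first has fallen below delta / 2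
    leaves at least delta / 2 in the difference. *)
Lemma hump_pair m eta : 0 < eta -> exists u K, [/\ X u, bnd u 2,
  forall a c, (a < m)%N -> (c < m)%N -> cn (dot (u (b a)) (b c)) <= eta, (m <= K)%N &
  (delta / 2) ^+ 2 <= \sum_(m <= j < K) cn (line r i u j) ^+ 2].
Proof.
move=> eta0; have /choice[xs hxs] := bad.
have /choice[Ks hKs] : forall k, exists K, [/\ X (xs k), bnd (xs k) 1, (k <= K)%N &
  delta ^+ 2 < \sum_(k <= j < K) cn (line r i (xs k) j) ^+ 2] by move=> k; exact: hxs.
have Xxs k : X (xs k) by have [] := hKs k.
have bxs k : bnd (xs k) 1 by have [] := hKs k.
have [U [UU sU]] := @ultraFilterLemma nat \oo _.
pose ent k (ac : 'I_m * 'I_m) := dot (xs k (b ac.1)) (b ac.2).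
have ent1 k ac : cn (ent k ac) <= 1.
  apply: (le_trans (cauchy_schwarz hdot _ _)); rewrite (hn_basis hdot hb) mulr1.
  by have := bnd_op hdot p2 (b ac.1) (Xlin (Xxs k)) (bxs k); rewrite (hn_basis hdot hb) mulr1.
have /choice[c hc] : forall ac, exists c, forall eta, 0 < eta -> U [set k | cn (ent k ac - c) < eta].
  by move=> ac; exact: (ultra_bounded UU (fun k => ent1 k ac)).
have e2 : 0 < eta / 2 by rewrite divr_gt0.
have US : U [set k | forall ac, cn (ent k ac - c ac) < eta / 2].
  by apply: filter_forall => ac; exact: hc.
have Ularge N : U [set k | (N <= k)%N] by apply: sU; exists N.
have [k hk] := filter_ex US.
have h2 : 0 < delta / 2 by rewrite divr_gt0.
have [m' hm'] := bounded_sum_tail (fun j => sqr_ge0 (cn (line r i (xs k) j)))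
   (fun K => line_bnd r i K (Xlin (Xxs k)) (bxs k)) (exprn_gt0 2 h2).
have [k' [hk' /= mk']] := filter_ex (filterI US (Ularge (maxn m m'))).
rewrite geq_max in mk'; have /andP[mk m'k] := mk'.
have [_ _ kK hbig] := hKs k'.
exists (xs k' - xs k), (Ks k'); split.
- exact: subspaceB.
- have := bndB p2 (bxs k') (bxs k); rewrite (_ : 1 + 1 = 2)//.
- move=> a d am dm; have := hk (Ordinal am, Ordinal dm); have := hk' (Ordinal am, Ordinal dm).
  rewrite /ent /= => h1 h3; rewrite !fctE dotBl.
  set z := c _ in h1 h3; rewrite -(subrK z (dot (xs k' _) _)) -addrA -opprB.
  apply: (le_trans (cnD _ _)); rewrite cnN (splitr eta). by apply: lerD; rewrite -cnN opprB ltW.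
- exact: leq_trans mk kK.
apply: (@le_trans _ _ (\sum_(k' <= j < Ks k') cn (line r i (xs k' - xs k) j) ^+ 2)); last first.
  by rewrite [leRHS](big_cat_nat _ (n := k'))//= lerDr sumr_ge0// => j _; exact: sqr_ge0.
rewrite leNgt; apply/negP => hlt.
have t2 : \sum_(k' <= j < Ks k') cn (line r i (xs k) j) ^+ 2 <= (delta / 2) ^+ 2.
  apply: le_trans (hm' (Ks k') (leq_trans m'k kK)).
  by rewrite [leRHS](big_cat_nat _ (n := k'))//= lerDr sumr_ge0// => j _; exact: sqr_ge0.
have := sum_sqr_minkowski (ltW h2) (ltW h2) (ltW hlt) t2.
rewrite -splitr leNgt => /negP; apply; apply: lt_le_trans hbig _.
apply: ler_sum => j _; rewrite (_ : line r i (xs k' - xs k) j + _ = line r i (xs k') j)//.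
by rewrite (lineB r i (xs k') (xs k)) subrK.
Qed.

(** Each u_n is small on the corner reached so far and is almost exhausted by the next one, so it
    differs little from the hump v_n between the two corners. The l_2 estimates for the v_n then
    pass to the u_n. *)
Lemma hump_contradiction : False.
Proof.
apply: noL2.
(* The perturbation costs [2 * d * c]. With d <= 1/2 the upper constant 2 + 2 grows to at most 5;
   with d <= delta / 16 the lower constant delta / 2 stays above delta / 4. *)
pose d := Num.min (delta / 16) (1 / 2).
have d0 : 0 < d by rewrite lt_min !divr_gt0.
have d1 : d <= delta / 16 by rewrite ge_min lexx.
have d2 : d <= 1 / 2 by rewrite ge_min lexx orbT.
(* The starting value i + 1 puts the index of the line inside the first corner. *)
pose last_ind (s : seq ((H -> H) * nat)) := last i.+1 (map snd s).
pose eta n : R := d * (2 ^+ n.+1)^-1.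
have eta0 n : 0 < eta n by rewrite mulr_gt0// invr_gt0 exprn_gt0.
have [s|st hst] := @dependent_choice _ (fun s (x : (H -> H) * nat) =>
   let m := last_ind s in let e := eta (size s) in
   [/\ X x.1, bnd x.1 2, bnd (fun y => P m (x.1 (P m y))) e, (m <= x.2)%N &
     bnd (fun y => x.1 y - P x.2 (x.1 (P x.2 y))) e /\
     (delta / 2) ^+ 2 <= \sum_(m <= j < x.2) cn (line r i x.1 j) ^+ 2]).
  set m := last_ind s; set e := eta (size s).
  have e0 : 0 < e by exact: eta0.
  have [u [K [Xu bu hent mK hline]]] := hump_pair m (divr_gt0 e0 (ltr0n R (m * m).+1)).
  have [m0 hm0] := corner_approx (Xcp Xu) e0.
  exists (u, maxn m0 K) => /=; split=> //.
  - apply: (bndW p2 _ (bnd_corner_entries m (Xlin Xu))).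
    apply: (@le_trans _ _ (\sum_(a < m) \sum_(c < m) e / (m * m).+1%:R)).
      by apply: ler_sum => a _; apply: ler_sum => c _; exact: hent.
    rewrite !sumr_const !card_ord -mulrnA -[leLHS]mulr_natr mulrAC ler_pdivrMr ?ltr0n//.
    by rewrite ler_pM2l// ler_nat.
  - exact: leq_trans (leq_maxr _ _).
  - by split; [apply: hm0; exact: leq_maxl|]; apply: (le_trans hline);
      rewrite [leRHS](big_cat_nat _ (n := K)) ?leq_maxr//= lerDl sumr_ge0// => j _; exact: sqr_ge0.
pose u n := (st n).1.
pose m n := if n is k.+1 then (st k).2 else i.+1.
have lastE n : last_ind (mkseq st n) = m n.
  by case: n => [//|n]; rewrite /last_ind mkseqS map_rcons last_rcons.
have {}hst n : [/\ X (u n), bnd (u n) 2, bnd (fun y => P (m n) (u n (P (m n) y))) (eta n),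
    (m n <= m n.+1)%N & bnd (fun y => u n y - P (m n.+1) (u n (P (m n.+1) y))) (eta n) /\
    (delta / 2) ^+ 2 <= \sum_(m n <= j < m n.+1) cn (line r i (u n) j) ^+ 2].
  by have := hst n; rewrite /= lastE size_mkseq.
have Xu n : X (u n) by have [] := hst n.
have bu n : bnd (u n) 2 by have [] := hst n.
have mm n : (m n <= m n.+1)%N by have [] := hst n.
have lu n : linear (u n) by exact: Xlin.
have hl n : (delta / 2) ^+ 2 <= \sum_(m n <= j < m n.+1) cn (line r i (u n) j) ^+ 2.
  by have [_ _ _ _ []] := hst n.
pose v n y := P (m n.+1) (u n (P (m n.+1) y)) - P (m n) (u n (P (m n) y)).
have buv n : bnd (fun y => u n y - v n y) (2 * eta n).
  have [_ _ h1 _ [h2 _]] := hst n.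
  apply: (bndW p2 _ (eq_bnd p2 _ (bndD p2 h2 h1))) => [|y]; first by lra.
  by rewrite /v opprB addrA addrAC.
have diff N (a : nat -> R[i]) c : 0 <= c -> \sum_(n < N) cn (a n) ^+ 2 <= c ^+ 2 ->
    bnd (fun y => \sum_(n < N) a n *: (u n y - v n y)) (2 * d * c).
  move=> c0 hc.
  have := bnd_sum p2 (index_enum 'I_N) (fun n (_ : xpredT n) => bndZ (a n) (buv n)).
  apply: (bndW p2); apply: (@le_trans _ _ (\sum_(n < N) (2 * d * c) * (2 ^+ n.+1)^-1)).
    apply: ler_sum => n _; rewrite /eta.
    have : cn (a n) <= c.
      rewrite -ler_sqr ?nnegrE ?cn_ge0//; apply: le_trans hc.
      by rewrite (bigD1 n)//= lerDl sumr_ge0// => k _; exact: sqr_ge0.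
    move=> /(ler_wpM2r (ltW (mulr_gt0 (ltr0n R 2) (eta0 n)))); rewrite /eta => /le_trans; apply.
    by rewrite le_eqVlt; apply/orP; left; apply/eqP; ring.
  rewrite -mulr_sumr ler_piMr ?sum_geometric//.
  by apply: mulr_ge0 => //; apply: mulr_ge0 => //; exact: ltW.
apply: (@embeds_l2 u 5 (delta / 4)) => //.
- by rewrite divr_gt0.
- move=> N a c c0 hc.
  have h1 := bnd_humps mm lu bu (ler0n R 2) c0 hc.
  apply: (bndW p2 _ (eq_bnd p2 _ (bndD p2 h1 (diff N a c c0 hc)))) => [|y].
    have : d * c <= 1 / 2 * c by rewrite ler_wpM2r.
    by lra.
  rewrite fct_sumE -big_split/=; apply: eq_bigr => n _.
  by rewrite -scalerDr /v addrC subrK.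
- move=> N a B hB; have B0 := hB.1.
  pose c := Num.sqrt (\sum_(n < N) cn (a n) ^+ 2).
  have S0 : 0 <= \sum_(n < N) cn (a n) ^+ 2 by rewrite sumr_ge0// => n _; exact: sqr_ge0.
  have c0 : 0 <= c by exact: sqrtr_ge0.
  have hc : \sum_(n < N) cn (a n) ^+ 2 = c ^+ 2 by rewrite sqr_sqrtr.
  have bV : bnd (fun y => \sum_(n < N) a n *: v n y) (B + 2 * d * c).
    have := diff N a c c0; rewrite hc => /(_ (lexx _)) hd.
    apply: (eq_bnd p2 _ (bndB p2 hB hd)) => y.
    rewrite fct_sumE -sumrB; apply: eq_bigr => n _.
    by rewrite -scalerBr opprB addrC subrK.
  have := line_humps mm (ltnSn i) lu hl bV; rewrite hc -!exprMn.
  have dc : 2 * d * c <= delta / 8 * c by rewrite ler_wpM2r//; lra.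
  have dd0 : 0 <= 2 * d * c by apply: mulr_ge0 => //; apply: mulr_ge0 => //; exact: ltW.
  have L0 : 0 <= delta / 2 * c by rewrite mulr_ge0 ?divr_ge0 ?(ltW delta0).
  have L1 : 0 <= delta / 4 * c by rewrite mulr_ge0 ?divr_ge0 ?(ltW delta0).
  have R0 : 0 <= B + 2 * d * c by exact: addr_ge0.
  by rewrite !ler_sqr ?nnegrE//; lra.
Qed.

End HumpSelection.

(** Failure of uniform tails, after normalisation, is exactly the situation excluded by the gliding
    hump. An element of norm 0 has no tail at all. *)
Lemma line_tails r i delta : 0 < delta -> exists m, forall T K, X T -> (m <= K)%N ->
  \sum_(m <= j < K) cn (line r i T j) ^+ 2 <= (delta * nrm T) ^+ 2.
Proof.
move=> delta0; apply: contrapT => hno; apply: (hump_contradiction (r := r) (i := i) delta0) => m.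
apply: contrapT => hm; apply: hno; exists m => T K XT mK; rewrite leNgt; apply/negP => hlt.
have hT := Xbnd XT; have n0 := nrm_ge0 p2 hT.
have nT : 0 < nrm T.
  rewrite lt_def n0 andbT; apply/negP => /eqP nT0.
  have := line_bnd r i K (Xlin XT) hT.
  rewrite nT0 -(big_mkord predT (fun j => cn (line r i T j) ^+ 2)) (big_cat_nat _ (n := m))//=.
  move=> h; move: hlt; rewrite nT0 mulr0 ltNge => /negP; apply; apply: le_trans h.
  by rewrite lerDr sumr_ge0// => j _; exact: sqr_ge0.
apply: hm; exists ((nrm T)^-1%:C%C *: T), K; split=> //.
- exact: subspaceZ.
- have := bndZ (nrm T)^-1%:C%C hT.
  by rewrite cnR_ge0 ?invr_ge0// mulVf// gt_eqF.
have lineZ j : line r i ((nrm T)^-1%:C%C *: T) j = (nrm T)^-1%:C%C * line r i T j.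
  by rewrite /line; case: (r); rewrite -dotZl.
under eq_bigr do rewrite lineZ cnM exprMn cnR_ge0 ?invr_ge0//.
rewrite -mulr_sumr exprVn mulrC ltr_pdivlMr ?exprn_gt0//.
by rewrite -exprMn.
Qed.

(** * Cutting the basis into blocks *)

Section BlockTails.
Implicit Types (A B : pred nat).

Lemma line_tail_pred r i delta m T K A : (forall K, (m <= K)%N ->
    \sum_(m <= j < K) cn (line r i T j) ^+ 2 <= (delta * nrm T) ^+ 2) ->
  (forall j, A j -> (m <= j)%N) ->
  \sum_(j < K | A j) cn (line r i T j) ^+ 2 <= (delta * nrm T) ^+ 2.
Proof.
move=> h hA; have [mK|/ltnW Km] := leqP m K; last first.
  rewrite big1 ?sqr_ge0// => j Aj; have := leq_trans (ltn_ord j) (leq_trans Km (hA _ Aj)).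
  by rewrite ltnn.
apply: le_trans (h K mK); rewrite big_mkcond/=.
rewrite -(big_mkord predT (fun j => if A j then cn (line r i T j) ^+ 2 else 0)).
rewrite (big_cat_nat _ (n := m))//= [X in X + _]big_nat big1 ?add0r => [|j /andP[_ jm]].
  by apply: ler_sum => j _; case: ifP => // _; exact: sqr_ge0.
by case: ifP => // /hA; rewrite leqNgt jm.
Qed.

Lemma count_bound m K A (c : R) : 0 <= c -> (forall j, A j -> (j < m)%N) ->
  \sum_(j < K | A j) c <= m%:R * c.
Proof.
move=> c0 hA; rewrite big_mkcond/= -(big_mkord predT (fun j => if A j then c else 0)).
apply: (@le_trans _ _ (\sum_(0 <= j < maxn m K) (if A j then c else 0))).
  rewrite [leRHS](big_cat_nat _ (n := K)) ?leq_maxr//= lerDl sumr_ge0// => j _.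
  by case: ifP.
rewrite (big_cat_nat _ (n := m)) ?leq_maxl//= [X in _ + X]big_nat [X in _ + X]big1 ?addr0; last first.
  by move=> j /andP[mj _]; case: ifP => // /hA; rewrite ltnNge mj.
apply: (@le_trans _ _ (\sum_(0 <= j < m) c)).
  by apply: ler_sum => j _; case: ifP.
by rewrite big_mkord sumr_const card_ord mulr_natl.
Qed.

(** A rectangle with fewer than m0 + 1 rows or columns is a sum of at most m0 rank one operators,
    one for each line; their norms are the tails of those lines. *)
Lemma block_tails m0 delta : 0 < delta -> exists2 m1, (m0 < m1)%N &
  forall T K A B, X T -> (forall j, A j -> (j < m0)%N) -> (forall j, B j -> (m1 <= j)%N) ->
    bnd (fun u => proj A K (T (proj B K u))) (delta * nrm T) /\
    bnd (fun u => proj B K (T (proj A K u))) (delta * nrm T).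
Proof.
move=> delta0; pose d := delta / m0.+1%:R.
have d0 : 0 < d by rewrite divr_gt0.
have /choice[f hf] : forall ri : bool * nat, exists m, forall T K, X T -> (m <= K)%N ->
    \sum_(m <= j < K) cn (line ri.1 ri.2 T j) ^+ 2 <= (d * nrm T) ^+ 2.
  by move=> [r i]; exact: line_tails.
(* Beyond the tail thresholds of all rows and columns with index below [m0]; the sum serves as a
   common upper bound. *)
pose m1 := (m0 + \sum_(i < m0) (f (true, i : nat) + f (false, i : nat))).+1%N.
exists m1 => [|T K A B XT hA hB]; first by rewrite ltnS leq_addr.
have hT := Xbnd XT; have linT := Xlin XT.
have n0 := nrm_ge0 p2 hT; have dn0 : 0 <= d * nrm T by rewrite mulr_ge0 ?(ltW d0).
have fB r i j : (i < m0)%N -> B j -> (f (r, i) <= j)%N.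
  move=> im /hB; apply: leq_trans; rewrite /m1 (bigD1 (Ordinal im))//=.
  by case: r; lia.
have tail r i : (i < m0)%N -> \sum_(j < K | B j) cn (line r i T j) ^+ 2 <= (d * nrm T) ^+ 2.
  by move=> im; apply: line_tail_pred (fB r i ^~ im) => // K'; exact: hf.
have total (F : nat -> H -> H) : (forall i, A i -> bnd (F i) (d * nrm T)) ->
    bnd (fun u => \sum_(i < K | A i) F i u) (delta * nrm T).
  move=> hF.
  have := bnd_sum p2 (index_enum 'I_K) (fun i (Ai : (fun i : 'I_K => A i) i) => hF i Ai).
  apply: (bndW p2); apply: (le_trans (count_bound K dn0 hA)).
  rewrite /d mulrA ler_wpM2r// mulrCA ler_piMr ?(ltW delta0)//.
  by rewrite ler_pdivrMr// mul1r ler_nat.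
split.
- pose a i := \sum_(j < K | B j) Num.conj (dot (T (b j)) (b i)) *: b j.
  have ha i : A i -> hn (a i) <= d * nrm T.
    move=> /hA im; rewrite -ler_sqr ?nnegrE ?hn_ge0//; apply: le_trans (tail true i im).
    rewrite /a (hn2_sum hdot) => [|j k jk]; last first.
      by rewrite dotZl dotZr hbo.1 ?mulr0.
    by apply: ler_sum => j _; rewrite hnZ cnJ (hn_basis hdot hb) mulr1.
  have b1 : bnd (fun u => \sum_(i < K | A i) dot u (a i) *: b i) (delta * nrm T).
    apply: (total (fun i u => dot u (a i) *: b i)) => i Ai.
    apply: (bndW p2 (ha i Ai)); rewrite -[hn _]mulr1; apply: (bnd_rank1 hdot p2) => // u.
    by rewrite hnZ (hn_basis hdot hb).
  apply: (eq_bnd p2 _ b1) => u; rewrite [LHS]/oproj; apply: eq_bigr => i _; congr (_ *: _).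
  rewrite /a dot_sumr /oproj (linm_sum linT) dot_suml; apply: eq_bigr => j _.
  by rewrite (linmZ linT) dotZl dotZr conjCK mulrC.
- have b1 : bnd (fun u => \sum_(i < K | A i) dot u (b i) *: proj B K (T (b i))) (delta * nrm T).
    apply: (total (fun i u => dot u (b i) *: proj B K (T (b i)))) => i Ai.
    rewrite -[_ * _]mul1r -(hn_basis hdot hb i); apply: (bnd_rank1 hdot p2) => // u.
    rewrite hnZ ler_wpM2l ?cn_ge0// -ler_sqr ?nnegrE ?hn_ge0//.
    by rewrite (hn2_proj hdot hbo); exact: (tail false i (hA _ Ai)).
  apply: (eq_bnd p2 _ b1) => u.
  rewrite {2}/oproj (linm_sum linT) (linm_sum (proj_lin dot b B K)); apply: eq_bigr => i _.
  by rewrite (linmZ linT) projZ.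
Qed.

Lemma block_sequence (delta : nat -> R) : (forall q, 0 < delta q) ->
  exists m : nat -> nat, [/\ m 0%N = 0%N, forall q, (m q < m q.+1)%N &
  forall q T K A B, X T -> (forall j, A j -> (j < m q)%N) -> (forall j, B j -> (m q.+1 <= j)%N) ->
    bnd (fun u => proj A K (T (proj B K u))) (delta q * nrm T) /\
    bnd (fun u => proj B K (T (proj A K u))) (delta q * nrm T)].
Proof.
move=> hd.
have /choice[f hf] : forall qm : nat * nat, exists m1, (qm.2 < m1)%N /\
  forall T K A B, X T -> (forall j, A j -> (j < qm.2)%N) -> (forall j, B j -> (m1 <= j)%N) ->
    bnd (fun u => proj A K (T (proj B K u))) (delta qm.1 * nrm T) /\
    bnd (fun u => proj B K (T (proj A K u))) (delta qm.1 * nrm T).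
  by move=> [q m0]; have [m1 ? ?] := block_tails m0 (hd q); exists m1.
pose m := fix m q := if q is k.+1 then f (k, m k) else 0%N.
by exists m; split=> // q; [exact: (hf (q, m q)).1|exact: (hf (q, m q)).2].
Qed.
End BlockTails.

(** Two terms of size N^(-1/p) and two of size [eps], each at most eta / 4, add up to [eta]; hence
    [eps] is eta / 4 and [N] exceeds (4 / eta)^p. *)
Lemma near_isometry eta : 0 < eta -> exists F : (H -> H) -> mxseq R,
  [/\ linear_on X F,
    forall T M, X T -> bnd T M -> forall K, \sum_(n < K) cpn_norm p (F T n) `^ p <= M `^ p &
    forall T B, X T -> 0 <= B -> (forall K, \sum_(n < K) cpn_norm p (F T n) `^ p <= B `^ p) ->
      nrm T <= B + eta * nrm T].
Proof.
move=> eta0; pose eps := eta / 4; have eps0 : 0 < eps by rewrite divr_gt0.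
pose delta q := eps * (2 ^+ q.+1)^-1 : R.
have delta0 q : 0 < delta q by rewrite mulr_gt0// invr_gt0 exprn_gt0.
have hdelta Q : \sum_(q < Q) delta q <= eps.
  by rewrite -mulr_sumr ler_piMr ?(ltW eps0)// sum_geometric.
have [m [m0 hm htails]] := block_sequence delta0.
pose N := (Num.truncn ((4 / eta) `^ p)).+1.
have N0 : (0 < N)%N by [].
exists (averaging m N); split=> [a T S _ _|T M XT hT K|T B XT B0 hB].
- exact: averaging_lin.
- exact: (averaging_upper m0 hm N0 K (Xlin XT) hT).
apply: (le_trans (averaging_lower m0 hm N0 (Xcp XT) delta0 hdelta
  (fun q K A B => htails q T K A B XT) B0 hB)).
rewrite lerD2l ler_wpM2r ?(nrm_ge0 p2 (Xbnd XT))//.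
have h : (4 / eta) <= N%:R `^ p^-1.
  have e0 : 0 <= 4 / eta by rewrite divr_ge0// ltW.
  rewrite -(ler_powR2 p0 e0 (powR_ge0 _ _)).
  by rewrite powRVK// ltW// truncnS_gt.
have h2 : (N%:R `^ p^-1)^-1 <= eta / 4.
  by rewrite -[leRHS]invrK lef_pV2 ?posrE ?invr_gt0 ?divr_gt0 ?powR_gt0 ?ltr0n// invf_div.
by rewrite /eps; lra.
Qed.

(** The copy is the image of the averaging map. It is closed because the lower estimate pulls Cauchy
    sequences back to [X], which is complete. *)
Lemma near_isometric_copy (e : R) : 0 < e -> exists X0 : set (mxseq R),
  closed_subspace (lp_cpn_norm p) X0 (lp_cpn p) /\
  (bm_dist (cp_norm dot p) X (lp_cpn_norm p) X0 < (1 + e)%:E)%E.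
Proof.
move=> e0; pose eta := e / (2 * (1 + e)).
have e1 : 0 < 1 + e by lra.
have eta0 : 0 < eta by rewrite divr_gt0 ?mulr_gt0.
(* The choice of [eta] gives (1 - eta)^-1 = 2 (1 + e) / (2 + e), strictly below 1 + e. *)
have hD : (1 - eta)^-1 < 1 + e.
  have -> : 1 - eta = (2 + e) / (2 * (1 + e)) by rewrite /eta; field; lra.
  rewrite invf_div ltr_pdivrMr; last by lra.
  by nra.
have eta1 : 0 < 1 - eta.
  have -> : 1 - eta = (2 + e) / (2 * (1 + e)) by rewrite /eta; field; lra.
  by rewrite divr_gt0 ?mulr_gt0//; lra.
have [F [linF up low0]] := near_isometry eta0.
have low T B : X T -> 0 <= B -> (forall K, \sum_(n < K) cpn_norm p (F T n) `^ p <= B `^ p) ->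
    nrm T <= (1 - eta)^-1 * B.
  move=> XT B0 /(low0 T B XT B0) h; rewrite ler_pdivlMl//.
  by move: h; rewrite mulrBl mul1r; lra.
have [|||S [iso _ nT nS]] := @embedding_isomorphism R _ _ (cp_norm dot p) X
  (lp_cpn_norm p) F 1 (1 - eta)^-1 Xsub linF.
- move=> T XT T1; apply/(lp_cpn_norm_le p2 _ ler01) => K; apply: up => //.
  by apply: (bndW p2 _ (Xbnd XT)); rewrite -(XnormE _ XT).
- move=> T XT /(lp_cpn_norm_le p2 _ ler01) h; rewrite (XnormE _ XT) -[leRHS]mulr1.
  exact: low.
- move=> T XT FT; have nT0 : nrm T <= 0.
    rewrite -[leRHS](mulr0 (1 - eta)^-1); apply: low => // K; rewrite FT.
    rewrite big1 ?powR_ge0// => n _; rewrite (cpn_norm0 hdot p2 hb) powR0//.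
  apply/funext => x; apply: hn_small_eq0 => d d0; apply: le_trans (ltW d0).
  apply: (le_trans (bnd_op hdot p2 _ (Xlin XT) (Xbnd XT))).
  by rewrite mulr_le0_ge0 ?hn_ge0.
exists (F @` X); split; last first.
  apply: (@le_lt_trans _ _ (1 * (1 - eta)^-1)%:E); last by rewrite lte_fin mul1r.
  rewrite EFinM; apply: le_trans (lee_pmul _ _ nT nS).
  - by apply: ereal_inf_lbound; exists (F, S).
  - apply: (opnorm_ge0 F Xsub.1); last by move=> A; exact: lp_norm_ge0.
    rewrite (XnormE _ Xsub.1); apply: le_trans ler01.
    exact: (nrmP p2 (bnd0 dot p2)).2.
  - have [FX0 _] := image_subspace Xsub linF.
    apply: (opnorm_ge0 S FX0); last by move=> T; exact: lp_norm_ge0.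
    apply/(lp_cpn_norm_le p2 _ ler01) => K; rewrite big1 ?powR_ge0// => k _.
    by rewrite (cpn_norm0 hdot p2 hb) powR0.
split; first 2 last.
- move=> u A XFu lA /cvge0P huA.
  have /choice[x hx] : forall n, exists T, X T /\ F T = u n.
    by move=> n; have [T XT <-] := XFu n; exists T.
  have near d : 0 < d -> exists N, forall n, (N <= n)%N -> forall K,
      \sum_(k < K) cpn_norm p ((u n - A) k) `^ p <= d `^ p.
    move=> d0; have [N hN] := huA d d0; exists N => n Nn.
    by apply/(lp_cpn_norm_le p2 _ (ltW d0)); exact: hN.
  have swap (B C : mxseq R) K d : \sum_(k < K) cpn_norm p ((B - C) k) `^ p <= d ->
      \sum_(k < K) cpn_norm p ((C - B) k) `^ p <= d.
    have eBC : C - B = -1 *: (B - C) by rewrite scaleN1r opprB.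
    apply: le_trans; apply: ler_sum => k _.
    rewrite (ler_powR2 p0 (cpn_norm_ge0 _ _) (cpn_norm_ge0 _ _)) eBC.
    by apply: (le_trans (cpn_normZ hdot p2 hb _ _)); rewrite cnN cn1 mul1r.
  have add (B C D : mxseq R) d d' : 0 <= d -> 0 <= d' ->
      (forall K, \sum_(k < K) cpn_norm p ((B - C) k) `^ p <= d `^ p) ->
      (forall K, \sum_(k < K) cpn_norm p ((C - D) k) `^ p <= d' `^ p) ->
      forall K, \sum_(k < K) cpn_norm p ((B - D) k) `^ p <= (d + d') `^ p.
    move=> d0 d'0 h1 h2 K.
    have -> : B - D = (B - C) + (C - D) by rewrite addrA subrK.
    pose f (E : mxseq R) k := cpn_norm p (E k) `^ p.
    have bm E : \sum_(0 <= k < K) f E k = \sum_(k < K) f E k by exact: big_mkord.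
    rewrite -(bm (B - C + (C - D))).
    apply: (lp_cpn_minkowski hdot p2 hb d0 d'0); first by rewrite (bm (B - C)); exact: h1.
    by rewrite (bm (C - D)); exact: h2.
  (* The preimages form a Cauchy sequence: two images within [d'] of [A] have preimages within (1 -
     eta)^-1 (d' + d') = d of each other. *)
  have [d d0|T [XT hT]] := subspace_complete (fun n => (hx n).1).
    pose d' := (1 - eta) * d / 2; have d'0 : 0 < d' by rewrite divr_gt0// mulr_gt0.
    have [N hN] := near d' d'0; exists N => i j Ni Nj.
    have Xij : X (x i - x j) by apply: subspaceB (hx i).1 (hx j).1.
    apply: (bndW p2 _ (Xbnd Xij)).
    have -> : d = (1 - eta)^-1 * (d' + d') by rewrite /d'; field; rewrite gt_eqF.
    apply: low => //; first by rewrite addr_ge0 ?ltW.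
    rewrite (linear_onB Xsub linF (hx i).1 (hx j).1) (hx i).2 (hx j).2.
    apply: (add _ A); rewrite ?(ltW d'0)//; first exact: hN.
    by move=> K; apply: swap; exact: hN.
  (* [A] and [F T] are both limits of the sequence [u], and the norm dominates every matrix entry,
     so they agree entry by entry. *)
  exists T => //; apply/functional_extensionality_dep => n; apply/matrixP => i j.
  apply/eqP; rewrite -subr_eq0 -cn_eq0 eq_le cn_ge0 andbT.
  apply/ler_addgt0Pr => d d0; rewrite add0r.
  have d2 : 0 < d / 2 by rewrite divr_gt0.
  have [N1 hN1] := near _ d2; have [N2 hN2] := hT _ d2; pose N := maxn N1 N2.
  have h : forall K, \sum_(k < K) cpn_norm p ((F T - A) k) `^ p <= (d / 2 + d / 2) `^ p.
    apply: (add _ (u N)); rewrite ?(ltW d2)//; last by move=> K; apply: hN1; rewrite leq_maxl.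
    move=> K; apply: swap; rewrite -(hx N).2 -(linear_onB Xsub linF (hx N).1 XT).
    apply: up; first by apply: subspaceB (hx N).1 XT.
    by apply: hN2; rewrite leq_maxr.
  have := h n.+1; rewrite -splitr big_ord_recr/= => hn1.
  have : cpn_norm p ((F T - A) n) `^ p <= d `^ p.
    by apply: le_trans hn1; rewrite lerDr sumr_ge0// => k _; exact: powR_ge0.
  rewrite ler_powR2 ?cpn_norm_ge0 ?(ltW d0)//; apply: le_trans.
  by apply: le_trans (entry_cpn_norm hdot p2 hb ((F T - A) n) i j); rewrite !mxE.
- move=> _ [T XT <-]; apply: le_lt_trans (ltry (nrm T)).
  by apply/(lp_cpn_norm_le p2 _ (nrm_ge0 p2 (Xbnd XT))); exact: up (Xbnd XT).
- exact: image_subspace.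
Qed.

End ClosedSubspaces.

Theorem corollary6p4 (R : realType) (H : completeNormedModType R[i])
    (dot : {dot H for Num.conj}) (p : R) (X : set (H -> H)) :
  separable_infdim_hilbert dot ->
  2 < p ->
  closed_subspace (cp_norm dot p) X (cp dot p) ->
  [<->
    (* (i) *)
    ~ (exists Y : set (H -> H),
        [/\ linear_subspace Y, Y `<=` X &
            isomorphic (cp_norm dot p) Y l2_norm (@l2 R)]);
    (* (ii) *)
    exists Y : set (mxseq R),
      [/\ linear_subspace Y, Y `<=` lp_cpn p &
          isomorphic (cp_norm dot p) X (lp_cpn_norm p) Y];
    (* (iii) *)
    forall e : R, 0 < e ->
      exists X0 : set (mxseq R),
        closed_subspace (lp_cpn_norm p) X0 (lp_cpn p) /\
        (bm_dist (cp_norm dot p) X (lp_cpn_norm p) X0 < (1 + e)%:E)%E].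
Proof.
move=> sepH p2 hX; have [b [hb cb]] := exists_basis sepH.
have i_iii := near_isometric_copy sepH p2 hb cb hX.
have iii_ii : (forall e : R, 0 < e -> exists X0 : set (mxseq R),
    closed_subspace (lp_cpn_norm p) X0 (lp_cpn p) /\
    (bm_dist (cp_norm dot p) X (lp_cpn_norm p) X0 < (1 + e)%:E)%E) ->
  exists Y : set (mxseq R), [/\ linear_subspace Y, Y `<=` lp_cpn p &
    isomorphic (cp_norm dot p) X (lp_cpn_norm p) Y].
  move=> /(_ 1 ltr01)[Y [[Ylp sY _] hd]]; exists Y; split=> //.
  by apply: bm_dist_isomorphic; apply: lt_trans hd (ltry _).
have ii_i Y (sY : linear_subspace Y) := isomorphic_no_l2 sepH p2 hb hX sY.
(* The implications proved are (i) to (iii), (iii) to (ii) and (ii) to (i); every arrow of the cycle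
   required here is a composition of two of them. *)
tfae.
- by move=> noL2; apply: iii_ii => e e0; exact: i_iii.
- by move=> [Y [sY _ iso]] e e0; apply: i_iii e0; exact: ii_i sY iso.
- by move=> /iii_ii[Y [sY _ iso]]; exact: ii_i sY iso.
Qed.
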